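(* Let $d\ge 1$, $\lambda>0$ and $r>0$. Let the location of the target be given by a function $g:\mathbb{R}_+\to\mathbb{R}^d$ that is bounded on compact time intervals and is independent of the nodes (that is, $g$ does not depend on the realization of the Poisson process and of the Brownian motions). Define $$T_{\mathrm{isol}}^{g}=\inf\Big\{t\ge 0:\ g(t)\notin\bigcup_i B(X_i+\xi_i(t),r)\Big\}.$$ Then, for any $t\ge 0$, the probability $\mathbf{P}(T_{\mathrm{isol}}^{g}>t)$ is maximized, over all such functions $g$, when $g\equiv 0$; that is, $\mathbf{P}(T_{\mathrm{isol}}^{g}>t)\le \mathbf{P}(T_{\mathrm{isol}}^{0}>t)$, where $T_{\mathrm{isol}}^{0}$ denotes $T_{\mathrm{isol}}^{g}$ with $g\equiv 0$.
   Context: Let $\Pi_0=\{X_i\}$ be a Poisson point process on $\mathbb{R}^d$ of intensity $\lambda>0$ (its points are called nodes). Let $(\xi_i(s))_{s\ge 0}$ be standard Brownian motions in $\mathbb{R}^d$ started at the origin, independent over different $i$ and independent of $\Pi_0$; the position of node $X_i$ at time $s$ is $X_i+\xi_i(s)$. $B(x,r)$ is the closed ball of radius $r$ centered at $x$. *)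

(* Defs.v *)
From HB Require Import structures.
From mathcomp Require Import all_boot all_order all_algebra.
From mathcomp Require Import all_classical all_reals all_analysis.

Set Implicit Arguments.
Unset Strict Implicit.
Unset Printing Implicit Defensive.

Import Order.TTheory GRing.Theory Num.Theory.
Import numFieldTopology.Exports numFieldNormedType.Exports.

Local Open Scope classical_set_scope.
Local Open Scope ring_scope.

Section euclidean_space.
Context {R : realType} {d : nat}.
Implicit Types x y : 'rV[R]_d.

(* The library's norm on 'rV[R]_d is the sup norm; its topology is the usual
   one. *)
Definition enorm x : R := Num.sqrt (\sum_(j < d) x ord0 j ^+ 2).

Definition cball x (r : R) : set 'rV[R]_d := [set y | enorm (y - x) <= r].

Definition borel : set (set 'rV[R]_d) :=
  <<s [set A : set 'rV[R]_d | open A] >>.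

(* Half-open boxes. *)
Definition box x y : set 'rV[R]_d :=
  [set z | forall j, x ord0 j < z ord0 j <= y ord0 j].

(* Lebesgue outer measure on R^d; its restriction to [borel] is Lebesgue
   measure. *)
Definition volume (A : set 'rV[R]_d) : \bar R :=
  ereal_inf [set v | exists a b : nat -> 'rV[R]_d,
    [/\ forall n j, a n ord0 j <= b n ord0 j,
        A `<=` \bigcup_n box (a n) (b n) &
        v = (\sum_(0 <= n <oo)
               (\prod_(j < d) (b n ord0 j - a n ord0 j))%:E)%E]].

End euclidean_space.

(* The sigma-algebra generated by the maps F i, i in D, into the measurable
   space (S, M). *)
Definition sigma_gen (Omega I S : Type) (M : set (set S)) (D : set I)
    (F : I -> Omega -> S) : set (set Omega) :=
  <<s \bigcup_(i in D) preimage_set_system setT (F i) M >>.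

Section processes.
Context {R : realType} {d : nat} {disp : measure_display}.
Context {Omega : measurableType disp}.
Variable P : probability Omega R.

Definition mutually_independent (I : eqType) (G : I -> set (set Omega)) :=
  forall (s : seq I) (E : I -> set Omega), uniq s ->
    (forall i, i \in s -> G i (E i)) ->
    P (\big[setI/setT]_(i <- s) E i) = (\prod_(i <- s) P (E i))%E.

Definition independent (G H : set (set Omega)) :=
  forall A B, G A -> H B -> P (A `&` B) = (P A * P B)%E.

Definition random_vector (Y : Omega -> 'rV[R]_d) :=
  forall A, borel A -> measurable (Y @^-1` A).

(* The event that exactly k of the points X_0, X_1, ... lie in A. *)
Definition count_event (X : nat -> Omega -> 'rV[R]_d) (A : set 'rV[R]_d)
    (k : nat) : set Omega :=
  [set w | ([set i | A (X i w)] #= `I_k)%card].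

(* The process is given through an enumeration X of its points, of which there
   are a.s. infinitely many when 0 < d.  In [poisson_prob m 0 [set k]], which
   is exp(-m) m^k / k!, the argument 0 is a dummy. *)
Record poisson_process (lambda : R) (X : nat -> Omega -> 'rV[R]_d) : Prop := {
  poisson_measurable : forall i, random_vector (X i);
  poisson_count : forall A k, borel A -> (volume A < +oo)%E ->
    P (count_event X A k) =
    poisson_prob (lambda * fine (volume A)) 0 [set k];
  poisson_independent : forall (n : nat) (A : 'I_n -> set 'rV[R]_d)
      (k : 'I_n -> nat),
    (forall j, borel (A j)) -> (forall j, (volume (A j) < +oo)%E) ->
    trivIset setT A ->
    P (\big[setI/setT]_(j < n) count_event X (A j) (k j)) =
    (\prod_(j < n) P (count_event X (A j) (k j)))%E
}.

(* Standard d-dimensional Brownian motion started at the origin; the values of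
   B at negative times are irrelevant. *)
Record brownian_motion (B : R -> Omega -> 'rV[R]_d) : Prop := {
  brownian_measurable : forall s, 0 <= s -> random_vector (B s);
  brownian_start : {ae P, forall w, B 0 w = 0};
  brownian_independent_increments : forall t : nat -> R,
    0 <= t 0%N -> nondecreasing_seq t ->
    mutually_independent (fun n : nat =>
      preimage_set_system setT (fun w => B (t n.+1) w - B (t n) w) borel);
  (* B t - B s is N(0, (t - s) I_d); the second parameter of [normal_prob] is
     the standard deviation. *)
  brownian_coordinates : forall s t, 0 <= s -> s < t ->
    mutually_independent (fun j : 'I_d =>
      preimage_set_system setT (fun w => (B t w - B s w) ord0 j)
        (@measurable _ (measurableTypeR R)));
  brownian_gaussian : forall s t, 0 <= s -> s < t ->
    forall (j : 'I_d) (V : set (measurableTypeR R)), measurable V ->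
    P [set w | V ((B t w - B s w) ord0 j)] =
    normal_prob 0 (Num.sqrt (t - s)) V;
  brownian_continuous :
    {ae P, forall w, {within [set s | 0 <= s], continuous (B ^~ w)}}
}.

(* The enumeration (X_i) of the Poisson points, and not only the point set, is
   independent of the motions. *)
Record mobile_nodes (lambda : R) (X : nat -> Omega -> 'rV[R]_d)
    (xi : nat -> R -> Omega -> 'rV[R]_d) : Prop := {
  nodes_poisson : poisson_process lambda X;
  nodes_brownian : forall i, brownian_motion (xi i);
  nodes_motions_independent : mutually_independent (fun i : nat =>
    sigma_gen borel [set s : R | 0 <= s] (xi i));
  nodes_points_motions_independent : independent
    (sigma_gen borel setT X)
    (sigma_gen borel [set p : nat * R | 0 <= p.2] (fun p => xi p.1 p.2))
}.

(* Probability of an event of the completed space: P^* agrees with P on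
   measurable sets and with the completion of P on its sigma-algebra.  Events
   such as {T_isol > t} constrain an uncountable set of times and belong in
   general only to the latter. *)
Definition prob (E : set Omega) : \bar R := mu_ext P E.

End processes.

Definition bounded_on_compacts {R : realType} {d : nat}
    (g : R -> 'rV[R]_d) : Prop :=
  forall a b : R, 0 <= a -> exists M : R,
    forall s, a <= s <= b -> enorm (g s) <= M.

Definition T_isol {R : realType} {d : nat} {Omega : Type}
    (X : nat -> Omega -> 'rV[R]_d) (xi : nat -> R -> Omega -> 'rV[R]_d)
    (r : R) (g : R -> 'rV[R]_d) (w : Omega) : \bar R :=
  ereal_inf [set t%:E | t in [set t : R | 0 <= t /\
    ~ (\bigcup_i cball (X i w + xi i t w) r) (g t)]].

(* Main.v *)
(* Sample the motions at the times h, 2h, ..., K h.  A node is then a point of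
   R^d x (R^d)^K (initial position and increments), with intensity lambda M,
   where M is the product of Lebesgue measure and centered Gaussians, and the
   numbers of nodes with given sets of visit times to the moving ball are
   independent Poisson variables.  By inclusion-exclusion, the probability that
   all sampled times are covered is a function of the M-measures w A of the
   nodes whose set of visit times is exactly A, and it increases with the sums
   of w A over A containing U, for U nonempty, that is, with the measures of
   the nodes visiting the ball at all times of U.  These are measures of
   translated intersections of symmetric convex sets under a log-concave
   symmetric measure, hence by Anderson's inequality (a consequence of
   Prekopa-Leindler) they are largest for g = 0.  For the continuous-time
   statement one lets h tend to 0 along dyadic times: by Ottaviani's inequality
   and Borel-Cantelli, almost surely only finitely many nodes visit the ball at
   dyadic times, so for g = 0 covering at dyadic times gives covering at all
   times by continuity of the paths. *)

Require Import Defs.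
From HB Require Import structures.
From mathcomp Require Import all_boot all_order all_algebra.
From mathcomp Require Import all_classical all_reals all_analysis.
From mathcomp Require Import measurable_realfun.
From mathcomp Require finmap.
From mathcomp Require Import ring lra.

Set Implicit Arguments.
Unset Strict Implicit.
Unset Printing Implicit Defensive.

Import Order.TTheory GRing.Theory Num.Theory.
Import numFieldTopology.Exports numFieldNormedType.Exports.

Local Open Scope classical_set_scope.
Local Open Scope ring_scope.

(** * Image, product and power measures *)

(** The individual rates [w A] need not be ordered: Anderson's inequality orders only their sums
    over the supersets of a nonempty [U]. Along the segment between two families of rates, the
    derivative of the covering probability with respect to the sum attached to [U] is the
    probability that the uncovered times are exactly [U], hence nonnegative.

    Prekopa-Leindler is used at midpoints only and in squared form, [f x * g y <= h (mid x y) ^ 2].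
    This suffices for symmetric sets, avoids roots of extended reals and passes to products by
    Fubini.

    No Poisson process of paths is constructed. Given the initial positions, the first [n] nodes
    move independently, and the probability that all nodes avoid a set of paths is the limit of the
    expectations of finite products [1 - psi (X i)], that is, the Laplace functional of the initial
    positions.

    Since [g] may be discontinuous, covering on grids is only an upper bound for [g]; the converse
    passage to all times is made for the zero path alone. The event [t < T_isol] forces covering a
    little beyond [t], whence the horizons [t + 1 / (m + 1)]. *)

Section image_measure.
Context d1 d2 (T1 : measurableType d1) (T2 : measurableType d2) (R : realType).

Definition image_measure (mu : {measure set T1 -> \bar R}) (f : T1 -> T2)
    (mf : measurable_fun setT f) : {measure set T2 -> \bar R} :=
  measure_function_pushforward__canonical__measure_function_Measure mu mf.

Lemma integral_image_measure (mu : {measure set T1 -> \bar R}) (f : T1 -> T2)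
    (mf : measurable_fun setT f) (F : T2 -> \bar R) :
  measurable_fun setT F -> (forall y, 0 <= F y)%E ->
  (\int[image_measure mu mf]_y F y = \int[mu]_x F (f x))%E.
Proof. by move=> mF F0; rewrite ge0_integral_pushforward. Qed.

Variables (mu : {sigma_finite_measure set T1 -> \bar R}) (f : T1 -> T2)
  (g : T2 -> T1) (mf : measurable_fun setT f) (mg : measurable_fun setT g)
  (fK : cancel f g).

Definition iso_image (_ : measurable_fun setT f) (_ : measurable_fun setT g)
    (_ : cancel f g) : set T2 -> \bar R := pushforward mu f.

HB.instance Definition _ := Measure.copy (iso_image mf mg fK)
  (image_measure mu mf).

Let iso_image_sigma_finite : sigma_finite setT (iso_image mf mg fK).
Proof.
have [F FT Foo] := sigma_finiteT mu.
exists (fun n => g @^-1` F n).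
  by rewrite -preimage_bigcup -FT preimage_setT.
move=> n; split; first by rewrite -[X in measurable X]setTI; apply: mg => //; exact: (Foo n).1.
rewrite /iso_image /pushforward; have -> : f @^-1` (g @^-1` F n) = F n.
  by apply/seteqP; split=> x /=; rewrite fK.
exact: (Foo n).2.
Qed.

HB.instance Definition _ := Measure_isSigmaFinite.Build _ _ _
  (iso_image mf mg fK) iso_image_sigma_finite.

Lemma integral_iso_image (F : T2 -> \bar R) :
  measurable_fun setT F -> (forall y, 0 <= F y)%E ->
  (\int[iso_image mf mg fK]_y F y = \int[mu]_x F (f x))%E.
Proof. by move=> mF F0; rewrite ge0_integral_pushforward. Qed.

End image_measure.

Section sigma_finite_product.
Local Open Scope ereal_scope.
Context d1 d2 (T1 : measurableType d1) (T2 : measurableType d2) (R : realType).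
Variables (m1 : {sigma_finite_measure set T1 -> \bar R})
  (m2 : {sigma_finite_measure set T2 -> \bar R}).

(* The library's canonical sigma-finite structure on [m1 \x m2] is only
   inferred for subprobabilities. *)
Definition prod_measure : set (T1 * T2) -> \bar R := m1 \x m2.

HB.instance Definition _ := Measure.on prod_measure.

Let prod_measure_sigma_finite : sigma_finite setT prod_measure.
Proof.
have /sigma_finiteP[F [FT ndF Foo]] := sigma_finiteT m1.
have /sigma_finiteP[G [GT ndG Goo]] := sigma_finiteT m2.
exists (fun n => F n `*` G n).
  apply/seteqP; split => // -[x y] _.
  have [i _ Fx] : (\bigcup_i F i) x by rewrite -FT.
  have [j _ Gy] : (\bigcup_i G i) y by rewrite -GT.
  exists (maxn i j) => //; split => /=.
    by move: x Fx; apply/subsetPset/ndF; exact: leq_maxl.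
  by move: y Gy; apply/subsetPset/ndG; exact: leq_maxr.
move=> k; have [mF Fk] := Foo k; have [mG Gk] := Goo k.
split; first exact: measurableX.
by rewrite /prod_measure product_measure1E// lte_mul_pinfty// ge0_fin_numE.
Qed.

HB.instance Definition _ := Measure_isSigmaFinite.Build _ _ _ prod_measure
  prod_measure_sigma_finite.

End sigma_finite_product.

Section tuple_cons.
Context d (T : measurableType d).

Definition tcons n (p : T * n.-tuple T) : n.+1.-tuple T :=
  [tuple of p.1 :: p.2].
Definition tuncons n (t : n.+1.-tuple T) : T * n.-tuple T :=
  (thead t, [tuple of behead t]).

Lemma tconsK n : cancel (@tcons n) (@tuncons n).
Proof. by move=> [x t]; rewrite /tuncons theadE; congr pair; exact/val_inj. Qed.

Lemma tnth_tcons_lift n x (t : n.-tuple T) j :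
  tnth (tcons (x, t)) (lift ord0 j) = tnth t j.
Proof. by rewrite !(tnth_nth x). Qed.

Lemma measurable_tcons n : measurable_fun setT (@tcons n).
Proof. by apply: measurable_cons => //; exact: measurable_fst. Qed.

Lemma measurable_tuncons n : measurable_fun setT (@tuncons n).
Proof.
apply/measurable_fun_pairP; split; first exact: measurable_tnth.
exact: measurable_behead.
Qed.

End tuple_cons.
Arguments tcons {d T n} p : simpl never.

Section product_measure_tuple.
Context d (T : measurableType d) (R : realType).
Implicit Type mu : nat -> {sigma_finite_measure set T -> \bar R}.

(** Recursion through binary products lets every property of powers be proved by induction from the
    case of two factors. The factors form a sequence, which the recursion shifts. *)
Fixpoint tuple_measure (mu : nat -> {sigma_finite_measure set T -> \bar R}) n :
    {sigma_finite_measure set (n.-tuple T) -> \bar R} :=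
  match n with
  | 0%N => \d_([tuple] : 0.-tuple T)
  | n.+1 => iso_image
      (prod_measure (mu 0%N) (tuple_measure (fun i => mu i.+1) n))
      (@measurable_tcons _ T n) (@measurable_tuncons _ T n) (@tconsK _ T n)
  end.

Definition tbox n (A : nat -> set T) : set (n.-tuple T) :=
  [set t | forall i : 'I_n, A i (tnth t i)].
Arguments tbox n A : clear implicits.

Lemma measurable_tbox n A : (forall i, (i < n)%N -> measurable (A i)) ->
  measurable (tbox n A).
Proof.
move=> mA; rewrite (_ : tbox n A =
    \bigcap_(i in [set: 'I_n]) ((fun t : n.-tuple T => tnth t i) @^-1` A i)).
  apply: fin_bigcap_measurable => [|i _]; first exact: finite_finset.
  by rewrite -[X in measurable X]setTI; apply: measurable_tnth => //; exact: mA.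
by apply/seteqP; split=> t /= At i; [move=> _|]; exact: At.
Qed.

Lemma tuple_measure_tbox mu n A : (forall i, (i < n)%N -> measurable (A i)) ->
  tuple_measure mu n (tbox n A) = (\prod_(i < n) mu i (A i))%E.
Proof.
elim: n mu A => [|n IHn] mu A mA.
  rewrite big_ord0 /= diracE mem_set//.
  by case.
rewrite big_ord_recl /= /iso_image /pushforward.
have -> : @tcons _ T n @^-1` tbox n.+1 A = A 0%N `*` tbox n (fun i => A i.+1).
  apply/seteqP; split=> -[x t] /=.
    move=> At; split; first exact: (At ord0).
    by move=> i; have := At (lift ord0 i); rewrite tnth_tcons_lift.
  move=> [Ax At] i; have [j ->|->//] := unliftP ord0 i.
  by rewrite tnth_tcons_lift; exact: At.
rewrite /prod_measure product_measure1E; [|exact: mA|].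
  by congr (_ * _)%E; apply: IHn => i; exact: (mA i.+1).
by apply: measurable_tbox => i; exact: (mA i.+1).
Qed.

Lemma measurable_tuple_tbox n :
  @measurable _ (n.-tuple T) =
  <<s [set tbox n A | A in [set A | forall i, measurable (A i)]] >>.
Proof.
apply/seteqP; split.
  apply: smallest_sub; first exact: smallest_sigma_algebra.
  rewrite -bigcup_seq => X [/= i _] [Y mY <-].
  apply: sub_sigma_algebra; exists (fun j => if j == i :> nat then Y else setT).
    by move=> j /=; case: ifP.
  rewrite setTI; apply/seteqP; split=> t /=; first by move=> /(_ i); rewrite eqxx.
  move=> Yt j; case: ifPn => // /eqP ji.
  by have -> : j = i by exact/val_inj.
apply: smallest_sub; first exact: sigma_algebra_measurable.
by move=> _ [A mA <-]; exact: measurable_tbox.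
Qed.

(** Boxes are stable under intersection, generate the sigma-algebra and include an exhausting
    sequence of finite mass. The laws of random tuples are identified this way, from probabilities
    of boxes only. *)
Lemma tuple_measure_unique mu n (m : {measure set (n.-tuple T) -> \bar R}) :
  (forall A, (forall i, measurable (A i)) ->
     m (tbox n A) = \prod_(i < n) mu i (A i))%E ->
  forall E, measurable E -> m E = tuple_measure mu n E.
Proof.
move=> mbox E mE.
have /choice[F FP] i : exists F : (set T)^nat, [/\ [set: T] = \bigcup_i F i,
    nondecreasing_seq F & forall k, measurable (F k) /\ (mu i (F k) < +oo)%E].
  by have /sigma_finiteP := sigma_finiteT (mu i).
apply: (measure_unique
  [set tbox n A | A in [set A | forall i, measurable (A i)]]
  (fun k => tbox n (fun i => F i k))) => //.
- exact: measurable_tuple_tbox.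
- move=> _ _ [A mA <-] [B mB <-]; exists (fun i => A i `&` B i).
    by move=> i; exact: measurableI.
  apply/seteqP; split=> t /=; first by move=> h; split=> i; have [] := h i.
  by move=> [At Bt] i; split.
- by move=> k; exists (fun i => F i k) => // i; have [_ _ /(_ k)[]] := FP i.
- apply/seteqP; split=> // t _.
  have /choice[k kP] (i : 'I_n) : exists k, F i k (tnth t i).
    have [FT _ _] := FP i; have : setT (tnth t i) by [].
    by rewrite FT => -[k _]; exists k.
  exists (\max_i k i)%N => // i; have [_ ndF _] := FP i.
  by move: (tnth t i) (kP i); apply/subsetPset/ndF; exact: leq_bigmax.
- by move=> _ [A mA <-]; rewrite mbox//; apply/esym/tuple_measure_tbox.
- move=> k; rewrite mbox => [|i]; last by have [_ _ /(_ k)[]] := FP i.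
  suff : (\prod_(i < n) mu i (F i k))%E \is a fin_num by rewrite ge0_fin_numE// prode_ge0.
  by apply: prode_fin_num => i _; rewrite ge0_fin_numE//; have [_ _ /(_ k)[]] := FP i.
Qed.

End product_measure_tuple.
Arguments tbox {d T} n A.

(** * Brunn-Minkowski and Prekopa-Leindler inequalities *)

Section brunn_minkowski.
Context {R : realType}.
Local Notation mu := (@lebesgue_measure R).
Implicit Types A B C : set R.
Local Open Scope ereal_scope.

(** The set on the right consists of the midpoints of [b] and the points of [A], which is the form
    in which it is compared with [C] below. *)
Lemma lebesgue_measure_dilation A (b : R) :
  measurable A ->
  mu A = 2%:E * mu [set c | A (2 * c - b)%R].
Proof.
move=> mA; have mphi : measurable_fun setT (fun c : measurableTypeR R => (2 * c - b)%R : measurableTypeR R).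
  by apply: measurable_funB => //; exact: measurable_funM.
pose m : {measure set (measurableTypeR R) -> \bar R} :=
  mscale (NngNum (ler0n R 2))
    (measure_function_pushforward__canonical__measure_function_Measure mu mphi).
rewrite (@lebesgue_measure_unique _ m)//; last first.
move=> _ [[x y] /= _ <-]; rewrite /m/= /mscale/= /pushforward/=.
rewrite (_ : _ @^-1` _ = `](x + b) / 2, (y + b) / 2]%classic)%R; last first.
  apply/seteqP; split=> c /=; rewrite !in_itv/=.
    by rewrite ltr_pdivrMr// ler_pdivlMr// ltrBrDr lerBlDr mulrC.
  by rewrite ltr_pdivrMr// ler_pdivlMr// ltrBrDr lerBlDr mulrC.
rewrite !lebesgue_measure_itv/= !lte_fin ltr_pM2r// ltrD2r.
case: ifP => _; last by rewrite mule0.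
by rewrite -EFinM; congr (_%:E); field.
Qed.

(** Take [a] in [A] almost maximal and [b] in [B] almost minimal. The midpoints of [A] with [b] and
    those of [a] with [B] all lie in [C]; the former end near [(a + b) / 2], the latter start near
    it, so they overlap only in a short interval [I]. *)
Lemma brunn_minkowski_bounded A B C (M : R) : measurable A -> measurable B -> measurable C ->
  A !=set0 -> B !=set0 ->
  (forall x, A x -> x <= M)%R -> (forall y, B y -> - M <= y)%R ->
  (forall x y, A x -> B y -> C ((x + y) / 2)%R) ->
  mu A + mu B <= 2%:E * mu C.
Proof.
move=> mA mB mC A0 B0 AM BM AB.
apply/lee_addgt0Pr => e e0.
(* Each of the two midpoint sets loses at most [eps] when [I] is removed, and the dilation doubles
   the loss: [2 * (eps + eps) = e]. *)
pose eps := (e / 4)%R.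
have eps0 : (0 < eps)%R by rewrite divr_gt0.
have [a Aa aM] : exists2 a, A a & forall x, A x -> (x <= a + eps)%R.
  have supA : has_sup A by split=> //; exists M => x /AM.
  have [a Aa ha] := sup_adherent eps0 supA; exists a => // x Ax.
  rewrite (le_trans (ub_le_sup supA.2 Ax))//.
  by rewrite -lerBlDr ltW.
have [b Bb bM] : exists2 b, B b & forall y, B y -> (b - eps <= y)%R.
  have infB : has_inf B by split=> //; exists (- M)%R => x /BM.
  have [b Bb hb] := inf_adherent eps0 infB; exists b => // y By.
  rewrite (le_trans _ (ge_inf infB.2 By))//.
  by rewrite lerBlDr ltW.
rewrite (lebesgue_measure_dilation b mA) (lebesgue_measure_dilation a mB).
set A1 := [set c | A _]; set B1 := [set c | B _].
pose I := `[(a + b - eps) / 2, (a + b + eps) / 2]%classic%R : set R.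
have mpre (D : set R) (z : R) : measurable D -> measurable [set c | D (2 * c - z)%R].
  move=> mD; have mphi : measurable_fun setT (fun c : measurableTypeR R => (2 * c - z)%R : measurableTypeR R).
    by apply: measurable_funB => //; exact: measurable_funM.
  by rewrite -[X in measurable X]setTI; exact: mphi.
have mA1 : measurable A1 by exact: mpre.
have mB1 : measurable B1 by exact: mpre.
have mI : measurable I by exact: measurable_itv.
have muI : mu I = eps%:E.
  have lt_ : ((a + b - eps) / 2 < (a + b + eps) / 2)%R by lra.
  by rewrite lebesgue_measure_itv/= lte_fin lt_ -EFinB; congr (_%:E); lra.
have h D : measurable D -> mu D <= mu (D `\` I) + eps%:E.
  move=> mD; rewrite -muI (measureDI mu mD mI) leeD2l// le_measure ?inE//.
  exact: measurableI.
have AB1 : mu (A1 `\` I) + mu (B1 `\` I) <= mu C.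
  rewrite -measureU; [|exact: measurableD|exact: measurableD|].
    apply: le_measure; rewrite ?inE//; first by apply: measurableU; exact: measurableD.
    move=> c [[Ac _]|[Bc _]].
      by have := AB _ _ Ac Bb; congr C; lra.
    by have := AB _ _ Aa Bc; congr C; lra.
  apply/seteqP; split=> // c [[Ac Ic] [Bc _]]; apply: Ic.
  rewrite /I /= in_itv/=; have := aM _ Ac; have := bM _ Bc; lra.
rewrite -ge0_muleDr//.
have -> : e%:E = 2%:E * (eps%:E + eps%:E).
  by rewrite -EFinD -EFinM; congr (_%:E); rewrite /eps; field.
rewrite -ge0_muleDr//; last by rewrite adde_ge0// lee_fin ltW.
apply: lee_wpmul2l => //; rewrite (le_trans (leeD (h _ mA1) (h _ mB1)))//.
by rewrite addeACA leeD2r.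
Qed.

(** [A] and [B] are cut to [[- n, n]], with [n] large enough to keep them nonempty, while [C] stays
    fixed; their measures increase to the limit. *)
Lemma brunn_minkowski1 A B C : measurable A -> measurable B -> measurable C ->
  A !=set0 -> B !=set0 ->
  (forall x y, A x -> B y -> C ((x + y) / 2)%R) ->
  mu A + mu B <= 2%:E * mu C.
Proof.
move=> mA mB mC [a Aa] [b Bb] AB.
pose J n : set R := `[- n%:R, n%:R]%classic%R.
have mJ n : measurable (J n) by exact: measurable_itv.
have cvgJ D : measurable D -> mu (D `&` J n) @[n --> \oo] --> mu D.
  move=> mD; rewrite [X in _ --> mu X](_ : D = \bigcup_n (D `&` J n)).
    apply: nondecreasing_cvg_mu.
    - by move=> n; apply: measurableI; [exact: mD|exact: mJ].
    - by apply: bigcupT_measurable => n; apply: measurableI; [exact: mD|exact: mJ].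
    - move=> m n mn; apply/subsetPset => x [Dx]; rewrite /J /= !in_itv/= => /andP[h1 h2].
      have mnR : (m%:R <= n%:R :> R)%R by rewrite ler_nat.
      by split=> //; apply/andP; split; lra.
  rewrite -setI_bigcupr; apply/esym/setIidPl => x _.
  exists (Num.bound `|x|) => //; rewrite /J /= in_itv/= -ler_norml.
  by rewrite ltW// (archi_boundP (normr_ge0 x)).
have cvgS : mu (A `&` J n) + mu (B `&` J n) @[n --> \oo] --> mu A + mu B.
  by apply: cvgeD; [rewrite ge0_adde_def ?inE|exact: cvgJ|exact: cvgJ].
rewrite -(cvg_lim _ cvgS)//; apply: lime_le; first by apply/cvg_ex; eexists; exact: cvgS.
exists (maxn (Num.bound `|a|) (Num.bound `|b|)) => // n /=.
rewrite geq_max => /andP[na nb].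
apply: (@brunn_minkowski_bounded _ _ _ n%:R) => //; try by [apply: measurableI; [|exact: mJ]].
- exists a; split=> //; rewrite /J /= in_itv/= -ler_norml.
  by rewrite (le_trans (ltW (archi_boundP (normr_ge0 a))))// ler_nat.
- exists b; split=> //; rewrite /J /= in_itv/= -ler_norml.
  by rewrite (le_trans (ltW (archi_boundP (normr_ge0 b))))// ler_nat.
- by move=> x [_]; rewrite /J /= in_itv/= => /andP[].
- by move=> x [_]; rewrite /J /= in_itv/= => /andP[].
- by move=> x y [Ax _] [By _]; exact: AB.
Qed.

End brunn_minkowski.

Section layer_cake.
Local Open Scope ereal_scope.
Context d (T : measurableType d) (R : realType).
Variable mu : {sigma_finite_measure set T -> \bar R}.
Local Notation leb := (@lebesgue_measure R).

(** Tonelli for the region [0 < s < 1], [s < f x]. Levels stop at 1 because [f] and [g] will be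
    normalized to supremum 1, whereas for [h] the truncated integral is a lower bound. *)
Lemma layer_cake (f : T -> \bar R) : measurable_fun setT f ->
  (forall x, 0 <= f x) ->
  \int[leb]_(s in `]0%R, 1%R[) mu [set x | s%:E < f x] =
  \int[mu]_x mine (f x) 1.
Proof.
move=> mf f0.
pose E : set (measurableTypeR R * T) := [set p | (0 < p.1 < 1)%R /\ p.1%:E < f p.2].
have mE : measurable E.
  rewrite (_ : E = (fst @^-1` `]0%R, 1%R[%classic) `&` [set p | p.1%:E < f p.2]); last first.
    by apply/seteqP; split=> p /=; rewrite in_itv.
  apply: measurableI.
    by rewrite -[X in measurable X]setTI; apply: measurable_fst => //; exact: measurable_itv.
  rewrite -[X in measurable X]setTI; apply: emeasurable_fun_lt => //.
    by apply/measurable_EFinP; exact: measurable_fst.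
  by apply: measurableT_comp => //; exact: measurable_snd.
have := indic_fubini_tonelli leb mu mE.
rewrite indic_fubini_tonelli_FE// indic_fubini_tonelli_GE// => H.
transitivity (\int[leb]_s (mu \o xsection E) s).
  rewrite integral_mkcond; apply: eq_integral => s _.
  rewrite patchE /=; case: ifPn => [|].
    rewrite inE/= in_itv/= => s01; congr (mu _).
    by apply/seteqP; split=> y /=; rewrite /xsection/= inE /E/= s01//; case.
  rewrite notin_setE/= in_itv/= => s01.
  rewrite (_ : xsection E s = set0) ?measure0//.
  by apply/seteqP; split=> y //=; rewrite /xsection/= inE /E/= => -[].
rewrite {}H; apply: eq_integral => x _ /=.
have [l fxl l0] : exists2 l : R, mine (f x) 1 = l%:E & (0 <= l)%R.
  have /= m0 : 0 <= mine (f x) 1 by rewrite le_min f0 lee01.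
  have m1 : mine (f x) 1 <= 1 by rewrite ge_min lexx orbT.
  by case: (mine (f x) 1) m0 m1 => // l; rewrite lee_fin; exists l.
rewrite fxl (_ : ysection E x = `]0, l[%classic%R).
  rewrite lebesgue_measure_itv/= lte_fin; case: ifPn; first by rewrite sube0.
  by rewrite -leNgt => l0'; congr (_%:E); apply/eqP; rewrite eq_le l0 l0'.
apply/seteqP; split=> s /=; rewrite /ysection/= inE /E/= in_itv/= -!(@lte_fin R) -fxl lt_min.
  by move=> [/andP[-> ->] ->].
by move=> /and3P[-> -> ->].
Qed.

End layer_cake.

Section prekopa_leindler_def.
Local Open Scope ereal_scope.
Context d (T : measurableType d) (R : realType).

(** The midpoint case of the inequality, squared. The operation [mid] is a parameter so that the
    property can be carried from the line to products, tuples and row vectors. *)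
Definition prekopa_leindler (mid : T -> T -> T) (mu : {measure set T -> \bar R}) :=
  forall f g h : T -> \bar R,
  measurable_fun setT f -> measurable_fun setT g -> measurable_fun setT h ->
  (forall x, 0 <= f x) -> (forall x, 0 <= g x) -> (forall x, 0 <= h x) ->
  (forall x y, f x * g y <= h (mid x y) * h (mid x y)) ->
  \int[mu]_x f x * \int[mu]_x g x <= \int[mu]_x h x * \int[mu]_x h x.

End prekopa_leindler_def.

Definition midpoint {R : realType} (x y : R) : R := (x + y) / 2.

Section prekopa_leindler1.
Local Open Scope ereal_scope.
Context {R : realType}.
Local Notation leb := (@lebesgue_measure R).
Implicit Types f g h : R -> \bar R.

(** Arithmetic-geometric mean inequality, [4 p q <= (p + q) ^ 2], extended to infinite values. *)
Lemma mule_le_sqr_of_adde_le (p q r : \bar R) : 0 <= p -> 0 <= q -> 0 <= r ->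
  p + q <= 2%:E * r -> p * q <= r * r.
Proof.
move=> p0 q0; case: r => [r r0|_ _|//]; last by rewrite mulyy leey.
case: p p0 => [p p0|_|//]; last by case: q q0 => [q| |] //= _; rewrite -EFinM.
case: q q0 => [q q0|_|//]; last by rewrite -EFinM.
rewrite -EFinD -!EFinM !lee_fin in p0 q0 r0 * => pqr.
have := ler_pM (addr_ge0 p0 q0) (addr_ge0 p0 q0) pqr pqr.
by have := sqr_ge0 (p - q); nra.
Qed.

(** For [0 < s < 1] the sets [s < f] and [s < g] are nonempty and their midpoints lie in [s < h],
    for otherwise [f x * g y <= s ^ 2]. Brunn-Minkowski applies at each level, and integration over
    [s] gives a bound on the sum of the integrals, stronger than one on their product. *)
Lemma prekopa_leindler_sup1 f g h :
  measurable_fun setT f -> measurable_fun setT g -> measurable_fun setT h ->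
  (forall x, 0 <= f x <= 1) -> (forall x, 0 <= g x <= 1) -> (forall x, 0 <= h x) ->
  (forall s : R, (0 < s < 1)%R -> exists x, s%:E < f x) ->
  (forall s : R, (0 < s < 1)%R -> exists x, s%:E < g x) ->
  (forall x y, f x * g y <= h (midpoint x y) * h (midpoint x y)) ->
  \int[leb]_x f x + \int[leb]_x g x <= 2%:E * \int[leb]_x h x.
Proof.
move=> mf mg mh f01 g01 h0 supf supg fgh.
have mlt (k : R -> \bar R) (s : R) : measurable_fun setT k ->
    measurable [set x | s%:E < k x].
  move=> mk; rewrite -[X in measurable X]setTI.
  by apply: emeasurable_fun_o_infty.
have mlev (k : R -> \bar R) : measurable_fun setT k -> (forall x, 0 <= k x) ->
    measurable_fun (`]0%R, 1%R[%classic : set R) (fun s : R => leb [set x | s%:E < k x]).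
  move=> mk k0; apply: measurable_funTS.
  pose E : set (measurableTypeR R * measurableTypeR R) := [set p | p.1%:E < k p.2].
  have mE : measurable E.
    rewrite -[X in measurable X]setTI; apply: emeasurable_fun_lt => //.
      by apply/measurable_EFinP; exact: measurable_fst.
    by apply: measurableT_comp => //; exact: measurable_snd.
  rewrite (_ : (fun s => _) = leb \o xsection E); first exact: measurable_fun_xsection.
  apply/funext => s /=; congr (leb _).
  by apply/seteqP; split=> y /=; rewrite /xsection/= inE.
have cake k : measurable_fun setT k -> (forall x, 0 <= k x <= 1) ->
    \int[leb]_x k x = \int[leb]_(s in `]0%R, 1%R[) leb [set x | s%:E < k x].
  move=> mk k01; rewrite layer_cake// => [|x]; last by have /andP[] := k01 x.
  by apply: eq_integral => x _; rewrite min_l//; have /andP[] := k01 x.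
rewrite cake// cake// -ge0_integralD//; last first.
- by apply: mlev => // x; have /andP[] := g01 x.
- by apply: mlev => // x; have /andP[] := f01 x.
apply: (@le_trans _ _ (2%:E * \int[leb]_x mine (h x) 1)); last first.
  apply: lee_wpmul2l => //; apply: ge0_le_integral => //.
  - by move=> x _; rewrite le_min h0 lee01.
  - by apply: measurable_mine.
  - by move=> x _; rewrite ge_min lexx.
rewrite -layer_cake// -ge0_integralZl//; last exact: mlev.
apply: ge0_le_integral => //.
- by move=> s _; rewrite adde_ge0.
- by apply: emeasurable_funD; apply: mlev => // x; [have /andP[] := f01 x|have /andP[] := g01 x].
- by apply: measurable_funeM; exact: mlev.
move=> s /=; rewrite in_itv/= => s01.
apply: brunn_minkowski1; try exact: mlt.
- exact: supf.
- exact: supg.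
move=> x y /= sf sg; rewrite ltNge; apply/negP => hs.
have /andP[s0 _] := s01.
have := le_trans (fgh x y) (lee_pmul (h0 _) (h0 _) hs hs).
rewrite leNgt => /negP; apply.
have [/andP[f0 f1] /andP[g0 g1]] := (f01 x, g01 y).
case: (f x) f0 f1 sf => [a| |] //; case: (g y) g0 g1 sg => [b| |] //.
by rewrite !lee_fin !lte_fin => b0 b1 sb a0 a1 sa; apply: ltr_pM => //; exact: ltW.
Qed.


(** Dividing [f] and [g] by their suprema [a] and [b], and [h] by [Num.sqrt (a * b)], preserves the
    hypothesis and reduces to suprema equal to 1. A zero supremum makes the left side vanish. *)
Lemma lebesgue_prekopa_leindler_bounded (M : R) f g h :
  measurable_fun setT f -> measurable_fun setT g -> measurable_fun setT h ->
  (forall x, 0 <= f x <= M%:E) -> (forall x, 0 <= g x <= M%:E) ->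
  (forall x, 0 <= h x) ->
  (forall x y, f x * g y <= h (midpoint x y) * h (midpoint x y)) ->
  \int[leb]_x f x * \int[leb]_x g x <= \int[leb]_x h x * \int[leb]_x h x.
Proof.
move=> mf mg mh fM gM h0 fgh.
have ih0 : 0 <= \int[leb]_x h x by exact: integral_ge0.
have normalize k : measurable_fun setT k -> (forall x, 0 <= k x <= M%:E) ->
    \int[leb]_x k x = 0 \/
    exists2 a : R, (0 < a)%R & exists k' : R -> \bar R,
      [/\ measurable_fun setT k', forall x, 0 <= k' x <= 1,
        forall x, k x = a%:E * k' x &
        forall s : R, (0 < s < 1)%R -> exists x, s%:E < k' x].
  move=> mk kM; set S := ereal_sup (range k).
  have kS x : k x <= S by apply: ereal_sup_ubound; exists x.
  have S0 : 0 <= S by rewrite (le_trans _ (kS 0%R))//; have /andP[] := kM 0%R.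
  have SM : S <= M%:E by apply: ge_ereal_sup => _ [x _ <-]; have /andP[] := kM x.
  have := ereal_sup_gt (S := range k); rewrite -/S.
  move: S0 SM kS; case: S => [a| |] //; rewrite !lee_fin => a0 _ ka supk.
  have [a_eq0|a_neq0] := eqVneq a 0%R.
    left; apply: integral0_eq => x _; apply/eqP; rewrite eq_le.
    by have := ka x; rewrite a_eq0 => ->; have /andP[] := kM x.
  have {}a0 : (0 < a)%R by rewrite lt_neqAle eq_sym a_neq0.
  right; exists a => //; exists (fun x => a^-1%:E * k x); split.
  - exact: measurable_funeM.
  - move=> x; have /andP[k0 _] := kM x; rewrite mule_ge0 ?lee_fin ?invr_ge0 ?(ltW a0)//=.
    by rewrite lee_pdivrMl// mule1.
  - by move=> x; rewrite muleA -EFinM divff// mul1e.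
  - move=> s /andP[s0 s1]; have [|_ [x _ <-] sx] := supk (s * a)%:E.
      by rewrite lte_fin gtr_pMl.
    by exists x; rewrite lte_pdivlMl// muleC.
have [->|[a a0 [f' [mf' f'01 fE supf]]]] := normalize _ mf fM.
  by rewrite mul0e mule_ge0.
have [->|[b b0 [g' [mg' g'01 gE supg]]]] := normalize _ mg gM.
  by rewrite mule0 mule_ge0.
pose c := Num.sqrt (a * b); have c0 : (0 < c)%R by rewrite sqrtr_gt0 mulr_gt0.
have cc : (c * c = a * b)%R by rewrite -expr2 sqr_sqrtr// ltW// mulr_gt0.
pose h' x := c^-1%:E * h x.
have h'0 x : 0 <= h' x by rewrite mule_ge0// lee_fin invr_ge0 ltW.
have hE x : h x = c%:E * h' x by rewrite muleA -EFinM divff ?gt_eqF// mul1e.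
have mh' : measurable_fun setT h' by exact: measurable_funeM.
have f'0 x : 0 <= f' x by have /andP[] := f'01 x.
have g'0 x : 0 <= g' x by have /andP[] := g'01 x.
have pqr : \int[leb]_x f' x * \int[leb]_x g' x <= \int[leb]_x h' x * \int[leb]_x h' x.
  apply: mule_le_sqr_of_adde_le; [exact: integral_ge0..|].
  apply: prekopa_leindler_sup1 => // x y.
  have := fgh x y; rewrite fE gE hE (muleACA a%:E) (muleACA c%:E) -!EFinM cc.
  by rewrite lee_pmul2l// lte_fin mulr_gt0.
have intZ (k k' : R -> \bar R) (u : R) : (0 < u)%R -> (forall x, 0 <= k' x) ->
    measurable_fun setT k' -> (forall x, k x = u%:E * k' x) ->
    \int[leb]_x k x = u%:E * \int[leb]_x k' x.
  move=> u0 k'0 mk' kE; rewrite -ge0_integralZl//; last by rewrite lee_fin ltW.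
  by apply: eq_integral => x _; rewrite kE.
rewrite (intZ _ _ _ a0 f'0 mf' fE) (intZ _ _ _ b0 g'0 mg' gE).
rewrite (intZ _ _ _ c0 h'0 mh' hE) (muleACA a%:E) (muleACA c%:E) -!EFinM cc.
by rewrite lee_pmul2l // lte_fin mulr_gt0.
Qed.

Lemma lebesgue_prekopa_leindler :
  @prekopa_leindler _ (measurableTypeR R) R midpoint leb.
Proof.
move=> f g h mf mg mh f0 g0 h0 fgh.
have ih0 : 0 <= \int[leb]_x h x by exact: integral_ge0.
have if0 : 0 <= \int[leb]_x f x by exact: integral_ge0.
have ig0 : 0 <= \int[leb]_x g x by exact: integral_ge0.
(* Zero integrals are set aside because the product of the two limits taken below would be
   indeterminate at [0 * +oo]. *)
have [->|f_neq0] := eqVneq (\int[leb]_x f x) 0; first by rewrite mul0e mule_ge0.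
have [->|g_neq0] := eqVneq (\int[leb]_x g x) 0; first by rewrite mule0 mule_ge0.
pose trunc (k : R -> \bar R) n x := mine (k x) n%:R%:E.
have cvg_trunc k : measurable_fun setT k -> (forall x, 0 <= k x) ->
    \int[leb]_x trunc k n x @[n --> \oo] --> \int[leb]_x k x.
  move=> mk k0; rewrite [X in _ --> X](_ : _ = \int[leb]_x limn (trunc k ^~ x)).
    apply: cvg_monotone_convergence => //.
    - by move=> n; apply: measurable_mine.
    - by move=> n x _; rewrite le_min k0 lee_fin ler0n.
    - move=> x _ m n mn; rewrite /trunc le_min ge_min lexx/= ge_min.
      by rewrite lee_fin ler_nat mn orbT.
  apply: eq_integral => x _; apply/esym/cvg_lim => //; rewrite /trunc.
  have := k0 x; case: (k x) => [r| |//] r0.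
    apply: cvg_near_cst; exists (Num.bound `|r|) => // n /= rn.
    rewrite min_l// lee_fin (le_trans (ler_norm r))//.
    by rewrite (le_trans (ltW (archi_boundP (normr_ge0 r))))// ler_nat.
  under eq_fun do rewrite minye.
  by apply/cvgeryP; exact: cvgr_idn.
have cvgM : \int[leb]_x trunc f n x * \int[leb]_x trunc g n x @[n --> \oo] -->
    \int[leb]_x f x * \int[leb]_x g x.
  by apply: cvgeM; [by rewrite mule_defE; apply/negP => /orP[/andP[/eqP e _]|/andP[/eqP e _]];
    [move/eqP: f_neq0|move/eqP: g_neq0]; exact|exact: cvg_trunc|exact: cvg_trunc].
rewrite -(cvg_lim _ cvgM)//; apply: lime_le; first by apply/cvg_ex; eexists; exact: cvgM.
apply: nearW => n; apply: (@lebesgue_prekopa_leindler_bounded n%:R) => //.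
- exact: measurable_mine.
- exact: measurable_mine.
- by move=> x; rewrite /trunc le_min f0 lee_fin ler0n/= ge_min lexx orbT.
- by move=> x; rewrite /trunc le_min g0 lee_fin ler0n/= ge_min lexx orbT.
- move=> x y; apply: le_trans (fgh x y); apply: lee_pmul.
  + by rewrite le_min f0 lee_fin ler0n.
  + by rewrite le_min g0 lee_fin ler0n.
  + by rewrite ge_min lexx.
  + by rewrite ge_min lexx.
Qed.

End prekopa_leindler1.

Section density.
Local Open Scope ereal_scope.
Context d (T : measurableType d) (R : realType).
Variables (mu nu : {measure set T -> \bar R}) (p : T -> R).
Hypotheses (mp : measurable_fun setT p) (p0 : forall x, (0 <= p x)%R).
Hypothesis nuE : forall A, measurable A -> nu A = \int[mu]_(x in A) (p x)%:E.
Import HBNNSimple.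

Lemma integral_density (f : T -> \bar R) :
  measurable_fun setT f -> (forall x, 0 <= f x) ->
  \int[nu]_x f x = \int[mu]_x (f x * (p x)%:E).
Proof.
move=> mf f0; pose f_ := nnsfun_approx measurableT mf.
have cvgf x : (f_ n x)%:E @[n --> \oo] --> f x by apply: cvg_nnsfun_approx.
have f_nd x : {homo (fun n => (f_ n x)%:E) : m n / (m <= n)%N >-> m <= n}.
  by move=> m n mn; rewrite lee_fin; exact/lefP/nd_nnsfun_approx.
transitivity (limn (fun n => \int[nu]_x (f_ n x)%:E)).
  rewrite -monotone_convergence//.
  - by apply: eq_integral => x _; apply/esym/cvg_lim => //.
  - by move=> n; exact/measurable_EFinP.
  - by move=> n x _; rewrite lee_fin.
transitivity (limn (fun n => \int[mu]_x ((f_ n x)%:E * (p x)%:E))); last first.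
  rewrite -monotone_convergence//.
  - apply: eq_integral => x _; apply/cvg_lim => //.
    by apply: cvgeZr => //.
  - by move=> n; apply: emeasurable_funM; exact/measurable_EFinP.
  - by move=> n x _; rewrite mule_ge0 ?lee_fin.
  - by move=> x _ m n mn; apply: lee_wpmul2r; [rewrite lee_fin|exact: f_nd].
congr (limn _); apply/funext => n.
under eq_integral do rewrite fimfunE -fsumEFin//.
rewrite ge0_integral_fsum//; last 2 first.
  - by move=> r; exact/measurable_EFinP/measurable_funM.
  - by move=> r x _; rewrite nnfun_muleindic_ge0.
under [RHS]eq_integral.
  move=> x _; rewrite fimfunE -fsumEFin// ge0_mule_fsuml; last first.
    by move=> r; rewrite nnfun_muleindic_ge0.
  over.
rewrite [RHS]ge0_integral_fsum//; last 2 first.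
  - move=> r; apply: emeasurable_funM; last exact/measurable_EFinP.
    exact/measurable_EFinP/measurable_funM.
  - by move=> r x _; rewrite mule_ge0 ?nnfun_muleindic_ge0 ?lee_fin.
apply: eq_fsbigr => r _.
rewrite integralZl_indic_nnsfun// integral_indic// setIT nuE//.
rewrite integral_mkcond.
have [r0|r0] := ltP r 0%R.
  rewrite preimage_nnfun0// [X in _ * X](_ : _ = 0) ?mule0; last first.
    by apply: integral0_eq => x _; rewrite patchE in_set0.
  by apply/esym; apply: integral0_eq => x _; rewrite indicE in_set0 mulr0 mul0e.
rewrite -ge0_integralZl//; last 2 first.
- by rewrite -measurable_restrictT//; exact/measurable_funTS/measurable_EFinP.
- by move=> x _; rewrite patchE; case: ifPn; rewrite ?lee_fin.
apply: eq_integral => x _; rewrite patchE indicE.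
by case: ifPn => _; rewrite ?mulr1 // mulr0 mul0e mule0.
Qed.

End density.

Section prekopa_leindler_constructions.
Local Open Scope ereal_scope.

(** The density satisfies [p x * p y <= p (midpoint x y) ^ 2], by convexity of the square, so it can
    be absorbed into [f], [g] and [h] in the Lebesgue case. *)
Lemma normal_prekopa_leindler (R : realType) (s : R) : s != 0%R ->
  @prekopa_leindler _ (measurableTypeR R) R midpoint (normal_prob 0 s).
Proof.
move=> s0 f g h mf mg mh f0 g0 h0 fgh.
pose p (x : measurableTypeR R) := normal_pdf 0 s x.
have p0 x : (0 <= p x)%R by exact: normal_pdf_ge0.
have mp : measurable_fun setT p by exact: measurable_normal_pdf.
have E k : measurable_fun setT k -> (forall x, 0 <= k x) ->
    \int[normal_prob 0 s]_x k x = \int[lebesgue_measure]_x (k x * (p x)%:E).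
  by move=> mk k0; apply: integral_density.
rewrite !E//; apply: lebesgue_prekopa_leindler.
1-3: by apply: emeasurable_funM => //; exact/measurable_EFinP.
1-3: by move=> x; rewrite mule_ge0 ?lee_fin.
move=> x y; rewrite muleACA [leRHS]muleACA; apply: lee_pmul => //.
- by rewrite mule_ge0.
- by rewrite mule_ge0 ?lee_fin.
rewrite -!EFinM lee_fin /p !normal_pdfE// mulrACA [leRHS]mulrACA.
apply: ler_wpM2l; first by rewrite mulr_ge0// normal_peak_ge0.
rewrite /normal_fun -!expRD ler_expR !subr0 -!mulrDl.
apply: ler_wpM2r; first by rewrite invr_ge0 mulrn_wge0// sqr_ge0.
rewrite /midpoint; have := sqr_ge0 (x - y)%R; rewrite !expr2; lra.
Qed.

(** The inequality for [m2] on the sections at [x], [y] and [mid1 x y] is exactly the hypothesis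
    needed by [m1] for the partial integrals. *)
Lemma prod_prekopa_leindler d1 d2 (T1 : measurableType d1) (T2 : measurableType d2)
    (R : realType) (m1 : {sigma_finite_measure set T1 -> \bar R})
    (m2 : {sigma_finite_measure set T2 -> \bar R}) mid1 mid2 :
  prekopa_leindler mid1 m1 -> prekopa_leindler mid2 m2 ->
  prekopa_leindler (fun p q => (mid1 p.1 q.1, mid2 p.2 q.2)) (prod_measure m1 m2).
Proof.
move=> PL1 PL2 f g h mf mg mh f0 g0 h0 fgh.
rewrite /prod_measure !fubini_tonelli1//; apply: PL1.
1-3: exact: measurable_fun_fubini_tonelli_F.
1-3: by move=> x; exact: integral_ge0.
move=> x y; apply: PL2; try exact: measurableT_comp.
- by move=> z; exact: f0.
- by move=> z; exact: g0.
- by move=> z; exact: h0.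
- by move=> z t; exact: fgh.
Qed.

Lemma iso_image_prekopa_leindler d1 d2 (T1 : measurableType d1)
    (T2 : measurableType d2) (R : realType)
    (mu : {sigma_finite_measure set T1 -> \bar R}) (f : T1 -> T2) (g : T2 -> T1)
    (mf : measurable_fun setT f) (mg : measurable_fun setT g) (fK : cancel f g)
    mid1 mid2 :
  (forall x y, mid2 (f x) (f y) = f (mid1 x y)) ->
  prekopa_leindler mid1 mu -> prekopa_leindler mid2 (iso_image mu mf mg fK).
Proof.
move=> midE PL u v w mu' mv mw u0 v0 w0 uvw.
rewrite (integral_iso_image mu mf mg fK mu')// (integral_iso_image mu mf mg fK mv)//.
rewrite (integral_iso_image mu mf mg fK mw)//.
apply: (PL (u \o f) (v \o f) (w \o f)); try by apply: measurableT_comp.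
- by move=> x; exact: u0.
- by move=> x; exact: v0.
- by move=> x; exact: w0.
- by move=> x y; rewrite /= -midE; exact: uvw.
Qed.

Definition tmap2 T n (op : T -> T -> T) (t u : n.-tuple T) : n.-tuple T :=
  [tuple op (tnth t i) (tnth u i) | i < n].

Lemma tcons_tmap2 d (T : measurableType d) (op : T -> T -> T) n x y
    (t u : n.-tuple T) :
  tmap2 op (tcons (x, t)) (tcons (y, u)) = tcons (op x y, tmap2 op t u).
Proof.
apply: eq_from_tnth => i; rewrite tnth_mktuple.
have [j ->|->//] := unliftP ord0 i.
by rewrite !tnth_tcons_lift tnth_mktuple.
Qed.

Lemma tuple_prekopa_leindler d (T : measurableType d) (R : realType)
    (mu : nat -> {sigma_finite_measure set T -> \bar R}) mid n :
  (forall i, prekopa_leindler mid (mu i)) ->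
  prekopa_leindler (@tmap2 T n mid) (tuple_measure mu n).
Proof.
elim: n mu => [|n IHn] mu PL.
  move=> f g h mf mg mh f0 g0 h0 fgh /=; rewrite !integral_dirac// !diracT !mul1e.
  by rewrite (le_trans (fgh _ _))// [tmap2 _ _ _]tuple0.
apply: iso_image_prekopa_leindler; last first.
  by apply: prod_prekopa_leindler; [exact: PL|exact: IHn].
by move=> [x t] [y u]; rewrite tcons_tmap2.
Qed.

End prekopa_leindler_constructions.

(** * Symmetries and translations of the measures *)

Definition measure_preserving d (T : measurableType d) (R : realType)
    (phi : T -> T) (mu : set T -> \bar R) :=
  forall A, measurable A -> mu (phi @^-1` A) = mu A.

Section measure_preserving.
Local Open Scope ereal_scope.

Lemma measure_preserving_prod d1 d2 (T1 : measurableType d1)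
    (T2 : measurableType d2) (R : realType)
    (m1 : {sigma_finite_measure set T1 -> \bar R})
    (m2 : {sigma_finite_measure set T2 -> \bar R}) phi1 phi2 :
  measurable_fun setT phi1 -> measurable_fun setT phi2 ->
  measure_preserving phi1 m1 -> measure_preserving phi2 m2 ->
  measure_preserving (fun p => (phi1 p.1, phi2 p.2)) (prod_measure m1 m2).
Proof.
move=> mphi1 mphi2 pres1 pres2 A mA.
have mphi : measurable_fun setT (fun p : T1 * T2 => (phi1 p.1, phi2 p.2)).
  apply/measurable_fun_pairP; split.
    by apply: (measurableT_comp mphi1) => //; exact: measurable_fst.
  by apply: (measurableT_comp mphi2) => //; exact: measurable_snd.
apply/esym; rewrite {1}/prod_measure.
rewrite (@product_measure_unique _ _ _ _ _ _ _ (image_measure (prod_measure m1 m2) mphi))//.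
move=> B C mB mC; rewrite /= /pushforward /prod_measure.
have -> : (fun p : T1 * T2 => (phi1 p.1, phi2 p.2)) @^-1` (B `*` C) =
    (phi1 @^-1` B) `*` (phi2 @^-1` C) by [].
rewrite product_measure1E; first by congr (_ * _); [exact: pres1|exact: pres2].
- by rewrite -[X in measurable X]setTI; exact: mphi1.
- by rewrite -[X in measurable X]setTI; exact: mphi2.
Qed.

Lemma measure_preserving_tuple d (T : measurableType d) (R : realType)
    (mu : nat -> {sigma_finite_measure set T -> \bar R}) n (phi : nat -> T -> T) :
  (forall i, measurable_fun setT (phi i)) ->
  (forall i, measure_preserving (phi i) (mu i)) ->
  measure_preserving (fun t : n.-tuple T => [tuple phi i (tnth t i) | i < n])
    (tuple_measure mu n).
Proof.
move=> mphi pres A mA.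
have mf : measurable_fun setT (fun t : n.-tuple T => [tuple phi i (tnth t i) | i < n]).
  apply/measurable_fun_tnthP => i.
  rewrite (_ : _ \o _ = phi i \o (fun t : n.-tuple T => tnth t i)); last first.
    by apply/funext => t /=; rewrite tnth_mktuple.
  by apply: measurableT_comp => //; exact: measurable_tnth.
have mpre i B : measurable B -> measurable (phi i @^-1` B).
  by move=> mB; rewrite -[X in measurable X]setTI; exact: mphi.
apply: (tuple_measure_unique (m := image_measure (tuple_measure mu n) mf)) => //.
move=> B mB; rewrite /= /pushforward.
rewrite (_ : _ @^-1` _ = tbox n (fun i => phi i @^-1` B i)).
  rewrite tuple_measure_tbox => [|i _]; last exact: mpre.
  by apply: eq_bigr => i _; rewrite pres.
by apply/seteqP; split=> t /= Bt i; have := Bt i; rewrite tnth_mktuple.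
Qed.

Lemma measure_preserving_iso d1 d2 (T1 : measurableType d1)
    (T2 : measurableType d2) (R : realType)
    (mu : {sigma_finite_measure set T1 -> \bar R}) (f : T1 -> T2) (g : T2 -> T1)
    (mf : measurable_fun setT f) (mg : measurable_fun setT g) (fK : cancel f g)
    phi1 phi2 :
  (forall x, phi2 (f x) = f (phi1 x)) ->
  measure_preserving phi1 mu -> measure_preserving phi2 (iso_image mu mf mg fK).
Proof.
move=> phiE pres A mA; rewrite /iso_image /pushforward -[RHS]pres.
  by congr (mu _); apply/seteqP; split=> x /=; rewrite phiE.
by rewrite -[X in measurable X]setTI; exact: mf.
Qed.

Lemma lebesgue_translation (R : realType) (a : R) :
  @measure_preserving _ (measurableTypeR R) R (fun x => x + a)%R lebesgue_measure.
Proof.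
move=> A mA.
have mphi : measurable_fun setT (fun x : measurableTypeR R => (x + a)%R : measurableTypeR R).
  exact: measurable_funD.
apply/esym; rewrite (@lebesgue_measure_unique _ (image_measure lebesgue_measure mphi))//.
move=> _ [[x y] /= _ <-]; rewrite /pushforward/=.
rewrite (_ : _ @^-1` _ = `]x - a, y - a]%classic)%R; last first.
  by apply/seteqP; split=> c /=; rewrite !in_itv/= ltrBlDr lerBrDr.
rewrite !lebesgue_measure_itv/= !lte_fin ltrD2r.
by case: ifP => // _; rewrite -!EFinB; congr (_%:E); ring.
Qed.

Lemma normal_opp (R : realType) (s : R) : s != 0%R ->
  @measure_preserving _ (measurableTypeR R) R -%R (normal_prob 0 s).
Proof.
move=> s0 A mA; rewrite /normal_prob.
have mN : measurable_fun setT (-%R : measurableTypeR R -> measurableTypeR R).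
  exact: oppr_measurable.
transitivity (\int[pushforward lebesgue_measure (-%R : _ -> measurableTypeR R)]_(x in A) (normal_pdf 0 s x)%:E).
  rewrite ge0_integral_pushforward//.
  - apply: eq_integral => x _ /=; rewrite !normal_pdfE// /normal_fun.
    by rewrite !subr0 sqrrN.
  - by apply/measurable_EFinP; apply: measurable_funTS; exact: measurable_normal_pdf.
  - by move=> x _; rewrite lee_fin normal_pdf_ge0.
by apply: eq_measure_integral => B mB _; exact: lebesgue_measureN.
Qed.

End measure_preserving.

(** * Measures on row vectors *)

Section borel_rV.
Context (R : realType) (d : nat).
Local Notation V := 'rV[R]_d.

Definition borelV : Type := g_sigma_algebraType [set A : set V | open A].
HB.instance Definition _ := Measurable.on borelV.

Lemma measurable_coord (j : 'I_d) :
  measurable_fun [set: borelV] (fun x : borelV => (x : V) ord0 j : measurableTypeR R).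
Proof.
apply: (measurability _ (RGenOpens.measurableE R)) => _ [_ [a [b ->] <-]].
rewrite setTI; apply: sub_sigma_algebra => /=.
have /continuousP := @coord_continuous R 1 d ord0 j; apply.
exact: interval_open.
Qed.

Lemma measurable_box (a b : V) : borel (box a b).
Proof.
rewrite (_ : box a b = \bigcap_(j in [set: 'I_d])
    ((fun x : borelV => (x : V) ord0 j) @^-1` `]a ord0 j, b ord0 j]%classic)).
  apply: (@fin_bigcap_measurable _ borelV) => // j _.
  by rewrite -[X in measurable X]setTI; apply: measurable_coord => //; exact: measurable_itv.
apply/seteqP; split=> x /= h j; first by move=> _; rewrite /= in_itv/=; exact: h.
by have := h j I; rewrite /= in_itv.
Qed.

Lemma countable_bigcup_measurable (I : countType) dT (T : measurableType dT) (F : I -> set T) :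
  (forall i, measurable (F i)) -> measurable (\bigcup_i F i).
Proof.
move=> mF; rewrite (_ : \bigcup_i F i =
    \bigcup_n (if unpickle n is Some i then F i else set0)).
  by apply: bigcupT_measurable => n; case: unpickle.
apply/seteqP; split=> [x [i _ Fx]|x [n _]].
  by exists (pickle i) => //; rewrite pickleK.
by case: unpickle => // i Fx; exists i.
Qed.

(** An open set is the union of the boxes with rational corners that it contains, a countable
    family. The balls of the topology are cubes, so the corners can be chosen one coordinate at a
    time. *)
Lemma borel_gen_box :
  @borel R d = <<s [set A | exists a b : V, A = box a b] >>.
Proof.
apply/seteqP; split; last first.
  apply: smallest_sub; first exact: smallest_sigma_algebra.
  by move=> _ [a [b ->]]; exact: measurable_box.
apply: smallest_sub; first exact: smallest_sigma_algebra.
move=> U oU /=.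
pose G := [set A | exists a b : V, A = box a b].
pose F (p : 'rV[rat]_d * 'rV[rat]_d) :=
  let B : set V := box (map_mx ratr p.1) (map_mx ratr p.2) in
  if pselect (B `<=` U) is left _ then B else set0.
have -> : U = \bigcup_p F p.
  apply/seteqP; split=> [z Uz|z [p _]]; last first.
    by rewrite /F; case: pselect => // BU /BU.
  have [e /= e0 zeU] : exists2 e : R, 0 < e & ball z e `<=` U.
    by have /nbhs_ballP[e e0 zeU] := open_nbhs_nbhs (conj oU Uz); exists e.
  have /choice[p pP] (j : 'I_d) : exists q : rat, z ord0 j - e < ratr q < z ord0 j.
    have /rat_in_itvoo[q qz] : z ord0 j - e < z ord0 j by rewrite ltrBlDr ltrDl.
    by exists q; move: qz; rewrite in_itv.
  have /choice[q qP] (j : 'I_d) : exists q : rat, z ord0 j < ratr q < z ord0 j + e.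
    have /rat_in_itvoo[q qz] : z ord0 j < z ord0 j + e by rewrite ltrDl.
    by exists q; move: qz; rewrite in_itv.
  exists (\row_j p j, \row_j q j) => //; rewrite /F /=.
  case: pselect => [_|].
    move=> j; rewrite !mxE; have /andP[_ ->] /= := pP j.
    by have /andP[/ltW-> _] := qP j.
  case; apply: subset_trans zeU => y By; split => // i j; rewrite ord1.
  have := By j; rewrite !mxE => /andP[py yq].
  have /andP[p1 p2] := pP j; have /andP[q1 q2] := qP j.
  rewrite /ball /= ltr_norml; lra.
suff : @measurable _ (g_sigma_algebraType G) (\bigcup_p F p) by [].
apply: countable_bigcup_measurable => p; rewrite /F; case: pselect => // _.
by apply: sub_sigma_algebra; do 2 eexists.
Qed.

Lemma measurable_fun_rV dT (T : measurableType dT) (f : T -> borelV) :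
  (forall j, measurable_fun setT (fun x => (f x : V) ord0 j : measurableTypeR R)) ->
  measurable_fun setT f.
Proof.
move=> mf; have mE : @measurable _ borelV = <<s [set A | exists a b : V, A = box a b] >>.
  exact: borel_gen_box.
apply: (measurability _ mE).
move=> _ [_ [a [b ->]] <-]; rewrite setTI.
rewrite (_ : f @^-1` _ = \bigcap_(j in [set: 'I_d])
    ((fun x => (f x : V) ord0 j : measurableTypeR R) @^-1` `]a ord0 j, b ord0 j]%classic)).
  apply: fin_bigcap_measurable => // j _.
  by rewrite -[X in measurable X]setTI; apply: mf => //; exact: measurable_itv.
apply/seteqP; split=> x /= h j; first by move=> _; rewrite /= in_itv/=; exact: h.
by have := h j I; rewrite /= in_itv.
Qed.

Definition rV_of_tuple (t : d.-tuple (measurableTypeR R)) : borelV :=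
  (\row_j tnth t j : V).
Definition tuple_of_rV (x : borelV) : d.-tuple (measurableTypeR R) :=
  [tuple (x : V) ord0 j | j < d].

Lemma rV_of_tupleK : cancel rV_of_tuple tuple_of_rV.
Proof. by move=> t; apply: eq_from_tnth => j; rewrite tnth_mktuple mxE. Qed.

Lemma tuple_of_rVK : cancel tuple_of_rV rV_of_tuple.
Proof. by move=> x; apply/rowP => j; rewrite mxE tnth_mktuple. Qed.

Lemma measurable_rV_of_tuple : measurable_fun setT rV_of_tuple.
Proof.
apply: measurable_fun_rV => j.
rewrite (_ : (fun _ => _) = (fun t : d.-tuple (measurableTypeR R) => tnth t j)).
  exact: measurable_tnth.
by apply/funext => t; rewrite mxE.
Qed.

Lemma measurable_tuple_of_rV : measurable_fun setT tuple_of_rV.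
Proof.
apply/measurable_fun_tnthP => j.
rewrite (_ : _ \o _ = (fun x : borelV => (x : V) ord0 j : measurableTypeR R)).
  exact: measurable_coord.
by apply/funext => x /=; rewrite tnth_mktuple.
Qed.

End borel_rV.

Section enorm_theory.
Context {R : realType} {d : nat}.
Implicit Types x y : 'rV[R]_d.

Lemma sqr_enorm x : enorm x ^+ 2 = \sum_(j < d) x ord0 j ^+ 2.
Proof. by rewrite sqr_sqrtr// sumr_ge0// => j _; exact: sqr_ge0. Qed.

Lemma enorm_ge0 x : 0 <= enorm x. Proof. exact: sqrtr_ge0. Qed.

Lemma enormZ (a : R) x : enorm (a *: x) = `|a| * enorm x.
Proof.
rewrite /enorm -sqrtr_sqr -sqrtrM ?sqr_ge0// mulr_sumr.
by congr Num.sqrt; apply: eq_bigr => j _; rewrite mxE exprMn.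
Qed.

Lemma enormN x : enorm (- x) = enorm x.
Proof. by rewrite -scaleN1r enormZ normrN normr1 mul1r. Qed.

(** Cauchy-Schwarz comes from the sum of the squares of [enorm y * x_j - enorm x * y_j], which is
    [2 * enorm x * enorm y] times the difference of its two sides; the vanishing norms are treated
    apart. *)
Lemma enormD x y : enorm (x + y) <= enorm x + enorm y.
Proof.
have x0 := enorm_ge0 x; have y0 := enorm_ge0 y.
suff dot : \sum_j x ord0 j * y ord0 j <= enorm x * enorm y.
  rewrite -(@ler_pXn2r _ 2)// ?nnegrE ?addr_ge0 ?enorm_ge0//.
  rewrite sqrrD !sqr_enorm.
  have -> : \sum_(j < d) (x + y) ord0 j ^+ 2 = \sum_j x ord0 j ^+ 2 +
      (\sum_j x ord0 j * y ord0 j) *+ 2 + \sum_j y ord0 j ^+ 2.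
    by rewrite -sumrMnl -!big_split; apply: eq_bigr => j _; rewrite mxE sqrrD.
  by rewrite lerD2r lerD2l lerMn2r dot orbT.
have [x0'|xn0] := eqVneq (enorm x) 0.
  have xj j : x ord0 j = 0.
    have /eqP := sqr_enorm x; rewrite x0' expr0n/= eq_sym psumr_eq0 => [|i _]; last exact: sqr_ge0.
    by move=> /allP /(_ j); rewrite mem_index_enum sqrf_eq0 => /(_ isT) /eqP.
  by rewrite x0' mul0r big1// => j _; rewrite xj mul0r.
have [y0'|yn0] := eqVneq (enorm y) 0.
  have yj j : y ord0 j = 0.
    have /eqP := sqr_enorm y; rewrite y0' expr0n/= eq_sym psumr_eq0 => [|i _]; last exact: sqr_ge0.
    by move=> /allP /(_ j); rewrite mem_index_enum sqrf_eq0 => /(_ isT) /eqP.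
  by rewrite y0' mulr0 big1// => j _; rewrite yj mulr0.
have : 0 <= \sum_j (enorm y * x ord0 j - enorm x * y ord0 j) ^+ 2.
  by rewrite sumr_ge0// => j _; exact: sqr_ge0.
have -> : \sum_j (enorm y * x ord0 j - enorm x * y ord0 j) ^+ 2 =
    (enorm x * enorm y) * (enorm x * enorm y - \sum_j x ord0 j * y ord0 j) *+ 2.
  transitivity (enorm y ^+ 2 * (\sum_j x ord0 j ^+ 2) + enorm x ^+ 2 * (\sum_j y ord0 j ^+ 2)
      - (enorm x * enorm y) * (\sum_j x ord0 j * y ord0 j) *+ 2).
    rewrite !mulr_sumr -sumrMnl -big_split -sumrB /=; apply: eq_bigr => j _.
    rewrite mulr2n; ring.
  by rewrite -!sqr_enorm !mulr2n; ring.
rewrite pmulrn_lge0// pmulr_rge0 ?subr_ge0//.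
by rewrite mulr_gt0// lt_neqAle eq_sym ?xn0 ?yn0.
Qed.

Lemma measurable_enorm :
  measurable_fun [set: borelV R d] (fun x : borelV R d => enorm (x : 'rV[R]_d) : measurableTypeR R).
Proof.
have msqrt : measurable_fun setT (@Num.sqrt R : measurableTypeR R -> measurableTypeR R).
  by apply: continuous_measurable_fun; exact: sqrt_continuous.
apply: (measurableT_comp msqrt).
by apply: measurable_sum => j; apply: measurable_funX; exact: measurable_coord.
Qed.

End enorm_theory.

Section measures_on_rV.
Local Open Scope ereal_scope.
Context (R : realType) (d : nat).
Local Notation V := 'rV[R]_d.
Local Notation leb :=
  (@lebesgue_measure R : {sigma_finite_measure set (measurableTypeR R) -> \bar R}).
Local Notation normal s :=
  (@normal_prob R 0 s : {sigma_finite_measure set (measurableTypeR R) -> \bar R}).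

Definition rV_measure (mu : {sigma_finite_measure set (measurableTypeR R) -> \bar R}) :=
  iso_image (tuple_measure (fun=> mu) d)
    (@measurable_rV_of_tuple R d) (@measurable_tuple_of_rV R d)
    (@rV_of_tupleK R d).
HB.instance Definition _ mu := SigmaFiniteMeasure.on (rV_measure mu).

Definition lebesgueV : {sigma_finite_measure set (borelV R d) -> \bar R} :=
  rV_measure leb.
Definition gaussianV s : {sigma_finite_measure set (borelV R d) -> \bar R} :=
  rV_measure (normal s).

Implicit Type mu : {sigma_finite_measure set (measurableTypeR R) -> \bar R}.

Lemma rV_measure_rect mu (A : 'I_d -> set (measurableTypeR R)) :
  (forall j, measurable (A j)) ->
  rV_measure mu [set x | forall j, A j ((x : V) ord0 j)] = \prod_(j < d) mu (A j).
Proof.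
move=> mA; pose A' i := if insub i is Some j then A j else setT.
have A'E (j : 'I_d) : A' j = A j by rewrite /A' valK.
rewrite /rV_measure /iso_image /pushforward.
rewrite (_ : _ @^-1` _ = tbox d A'); last first.
  apply/seteqP; split=> t /= At j; first by rewrite A'E; have := At j; rewrite mxE.
  by rewrite mxE -A'E; exact: At.
rewrite tuple_measure_tbox; last by move=> i _; rewrite /A'; case: insub.
by apply: eq_bigr => j _; rewrite A'E.
Qed.

Lemma rV_measure_unique mu (m : {measure set (borelV R d) -> \bar R}) :
  (forall A : 'I_d -> set (measurableTypeR R), (forall j, measurable (A j)) ->
    m [set x | forall j, A j ((x : V) ord0 j)] = \prod_(j < d) mu (A j)) ->
  forall E, measurable E -> m E = rV_measure mu E.
Proof.
move=> mrect E mE; rewrite /rV_measure /iso_image /pushforward.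
rewrite -(tuple_measure_unique (m := image_measure m (@measurable_tuple_of_rV R d))).
- rewrite /= /pushforward; congr (m _).
  by apply/seteqP; split=> x /=; rewrite tuple_of_rVK.
- move=> A mA; rewrite /= /pushforward -(mrect (fun j => A j))//; congr (m _).
  by apply/seteqP; split=> x /= Ax j; have := Ax j; rewrite tnth_mktuple.
- by rewrite -[X in measurable X]setTI; exact: measurable_rV_of_tuple.
Qed.

Lemma lebesgueV_box (a b : V) : (forall j, a ord0 j <= b ord0 j)%R ->
  lebesgueV (box a b) = (\prod_(j < d) (b ord0 j - a ord0 j))%:E.
Proof.
move=> ab; rewrite (_ : box a b =
    [set x : borelV R d | forall j, `]a ord0 j, b ord0 j]%classic ((x : V) ord0 j)]).
  transitivity (\prod_(j < d) leb (`]a ord0 j, b ord0 j]%classic : set (measurableTypeR R))).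
    by apply: rV_measure_rect => j; exact: measurable_itv.
  rewrite -prodEFin; apply: eq_bigr => j _.
  rewrite [LHS]lebesgue_measure_itv /= lte_fin; case: ltP => [_|ba]; first by rewrite -EFinB.
  by rewrite (@le_anti _ _ (a ord0 j) (b ord0 j)) ?subrr// ab ba.
by apply/seteqP; split=> x /= Ax j; have := Ax j; rewrite /= in_itv.
Qed.

Definition midV (x y : borelV R d) : borelV R d := (2^-1 *: ((x : V) + y))%R.

Lemma rV_measure_prekopa_leindler mu :
  @prekopa_leindler _ (measurableTypeR R) R midpoint mu -> prekopa_leindler midV (rV_measure mu).
Proof.
move=> PL; apply: iso_image_prekopa_leindler; last first.
  by apply: tuple_prekopa_leindler => i; exact: PL.
move=> t u; apply/rowP => j; rewrite !mxE tnth_mktuple /midpoint.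
by rewrite mulrC.
Qed.

Lemma rV_measure_opp mu : @measure_preserving _ (measurableTypeR R) R -%R mu ->
  measure_preserving (fun x : borelV R d => (- (x : V))%R : borelV R d) (rV_measure mu).
Proof.
move=> pres.
have presT := @measure_preserving_tuple _ (measurableTypeR R) R (fun=> mu) d
  (fun=> -%R) (fun=> @oppr_measurable R setT) (fun=> pres).
apply: measure_preserving_iso presT.
by move=> t; apply/rowP => j; rewrite !mxE tnth_mktuple.
Qed.

Lemma lebesgueV_translation (a : V) :
  measure_preserving (fun x : borelV R d => ((x : V) + a)%R : borelV R d) lebesgueV.
Proof.
pose a' i : R := if insub i is Some j then a ord0 j else 0%R.
have ma i : measurable_fun setT (fun x : measurableTypeR R => (x + a' i)%R : measurableTypeR R).
  exact: measurable_funD.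
have presT := @measure_preserving_tuple _ (measurableTypeR R) R (fun=> leb) d
  _ ma (fun i => @lebesgue_translation R (a' i)).
apply: measure_preserving_iso presT.
by move=> t; apply/rowP => j; rewrite !mxE tnth_mktuple /a' valK.
Qed.

Lemma gaussianV_setT s : gaussianV s setT = 1.
Proof.
transitivity (gaussianV s [set x | forall j : 'I_d, setT ((x : V) ord0 j)]).
  by congr (gaussianV s _); apply/seteqP; split.
transitivity (\prod_(j < d) normal s setT); first exact: rV_measure_rect.
by rewrite big1// => j _; exact: probability_setT.
Qed.

End measures_on_rV.

(** * Anderson's inequality and random walks *)

Lemma lee_of_sqr (R : realType) (a b : \bar R) :
  (0 <= b -> a * a <= b * b -> a <= b)%E.
Proof.
move=> b0 H; rewrite leNgt; apply/negP => ba; move: H; rewrite leNgt => /negP; apply.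
move: b b0 ba => [b| |] //; move: a => [a| |] //.
- by rewrite lte_fin lee_fin => b0 ba; rewrite -!EFinM lte_fin; apply: ltr_pM.
- by move=> _ _; rewrite mulyy -EFinM ltry.
Qed.

(* Anderson's inequality: if [A] is convex, then [B] contains all midpoints of
   points of [A] and of [- A]. *)
Lemma anderson d (T : measurableType d) (R : realType)
    (mu : {measure set T -> \bar R}) (mid : T -> T -> T) (opp : T -> T)
    (A B : set T) :
  prekopa_leindler mid mu -> measurable_fun setT opp -> measure_preserving opp mu ->
  measurable A -> measurable B ->
  (forall p q, A p -> A (opp q) -> B (mid p q)) -> (mu A <= mu B)%E.
Proof.
move=> PL mopp pres mA mB AB; apply: lee_of_sqr => //.
have mA' : measurable (opp @^-1` A) by rewrite -[X in measurable X]setTI; exact: mopp.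
(* One factor [mu A] becomes the measure of the reflected set, so that the inequality applies to the
   indicators of [A], its reflection and [B]. *)
rewrite -[X in (_ * X <= _)%E]pres//.
have := PL (EFin \o \1_A) (EFin \o \1_(opp @^-1` A)) (EFin \o \1_B).
rewrite !integral_indic ?setIT//; apply.
1-3: by apply/measurable_EFinP; exact: measurable_indic.
1-3: by move=> x; rewrite lee_fin.
move=> p q; rewrite -!EFinM lee_fin !indicE.
case: (boolP (p \in A)) => [|_]; last by rewrite mul0r mulr_ge0.
case: (boolP (q \in _)) => [|_]; last by rewrite mulr0 mulr_ge0.
by rewrite !inE => Aq Ap; rewrite mem_set ?mulr1//; exact: AB.
Qed.

Section walk.
Local Open Scope ereal_scope.
Context (R : realType) (d : nat).
Local Notation V := 'rV[R]_d.
Local Notation BV := (borelV R d).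

Definition walk n (x : V) (u : n.-tuple BV) (k : nat) : V :=
  (x + \sum_(i < n | (i < k)%N) (tnth u i : V))%R.

Lemma walk0 n x (u : n.-tuple BV) : walk x u 0 = x.
Proof. by rewrite /walk big_pred0 ?addr0. Qed.

Lemma walk_tcons n x (z : BV) (u : n.-tuple BV) k :
  walk x (tcons (z, u)) k.+1 = walk (x + (z : V))%R u k.
Proof.
rewrite /walk -addrA; congr (_ + _)%R; rewrite big_mkcond big_ord_recl/=.
congr (_ + _)%R; rewrite [RHS]big_mkcond /=; apply: eq_bigr => i _.
by rewrite tnth_tcons_lift ltnS.
Qed.

Lemma measurable_walk n k : measurable_fun setT
  (fun p : BV * n.-tuple BV => walk (p.1 : V) p.2 k : BV).
Proof.
apply: measurable_fun_rV => j.
rewrite (_ : (fun _ => _) = (fun p : BV * n.-tuple BV => ((p.1 : V) ord0 j +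
  \sum_(i < n) (if (i < k)%N then (tnth p.2 i : V) ord0 j else 0))%R)); last first.
  by apply/funext => p; rewrite /walk mxE summxE big_mkcond.
apply: measurable_funD.
  by apply: (measurableT_comp (@measurable_coord R d j)); exact: measurable_fst.
apply: measurable_sum => i; case: (i < k)%N; last by [].
apply: (measurableT_comp (@measurable_coord R d j)).
by apply: (measurableT_comp (@measurable_tnth _ _ n i)); exact: measurable_snd.
Qed.

Definition hit n (g : V) (r : R) k : set (BV * n.-tuple BV) :=
  [set p | enorm (g - walk (p.1 : V) p.2 k) <= r]%R.

Lemma measurable_cball (a : V) (r : R) :
  measurable ([set x : BV | enorm (a - (x : V)) <= r]%R : set BV).
Proof.
have mf : measurable_fun setT (fun x : BV => (a - (x : V))%R : BV).
  apply: measurable_fun_rV => j.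
  rewrite (_ : (fun _ => _) = (fun x : BV => (a ord0 j - (x : V) ord0 j)%R)).
    by apply: measurable_funB => //; exact: measurable_coord.
  by apply/funext => x; rewrite !mxE.
have mn : measurable_fun setT (fun x : BV => enorm (a - (x : V))%R : measurableTypeR R).
  by apply: (measurableT_comp (@measurable_enorm R d)); exact: mf.
rewrite (_ : mkset _ = (fun x : BV => enorm (a - (x : V))%R) @^-1` `]-oo, r]%classic).
  by rewrite -[X in measurable X]setTI; apply: mn => //; exact: measurable_itv.
by apply/seteqP; split=> x /=; rewrite in_itv.
Qed.

Lemma measurable_hit n g r k : measurable (@hit n g r k).
Proof.
rewrite (_ : hit _ _ _ = (fun p : BV * n.-tuple BV => walk (p.1 : V) p.2 k : BV) @^-1`
   [set x : BV | enorm (g - (x : V)) <= r]%R) //.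
rewrite -[X in measurable X]setTI; apply: measurable_walk => //.
exact: measurable_cball.
Qed.

Variable s : R.
Hypothesis s0 : s != 0%R.

Definition walk_measure n : {sigma_finite_measure set (n.-tuple BV) -> \bar R} :=
  tuple_measure (fun=> gaussianV d s) n.

Definition node_measure n : {sigma_finite_measure set (BV * n.-tuple BV)%type -> \bar R} :=
  prod_measure (lebesgueV R d) (walk_measure n).

Lemma walk_measure_setT n : walk_measure n setT = 1.
Proof.
transitivity (walk_measure n (tbox n (fun=> setT))).
  by congr (walk_measure n _); apply/seteqP; split.
transitivity (\prod_(i < n) gaussianV d s setT); first exact: tuple_measure_tbox.
by rewrite big1// => i _; exact: gaussianV_setT.
Qed.

Let oppV (x : BV) : BV := (- (x : V))%R.

Let measurable_oppV : measurable_fun setT oppV.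
Proof.
apply: measurable_fun_rV => j.
rewrite (_ : (fun _ => _) = (fun x : BV => - (x : V) ord0 j)%R).
  by apply: (measurableT_comp (@oppr_measurable R setT)); exact: measurable_coord.
by apply/funext => x; rewrite mxE.
Qed.

Let opp_tuple n (u : n.-tuple BV) : n.-tuple BV := [tuple oppV (tnth u i) | i < n].

Let measurable_opp_tuple n : measurable_fun setT (@opp_tuple n).
Proof.
apply/measurable_fun_tnthP => i.
rewrite (_ : _ \o _ = (fun t : n.-tuple BV => oppV (tnth t i))).
  by apply: (measurableT_comp measurable_oppV); exact: measurable_tnth.
by apply/funext => t /=; rewrite tnth_mktuple.
Qed.

Let walk_opp n x (u : n.-tuple BV) k :
  walk (- x)%R (opp_tuple u) k = (- walk x u k)%R.
Proof.
rewrite /walk opprD; congr (_ + _)%R.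
by rewrite -sumrN; apply: eq_bigr => i _; rewrite tnth_mktuple.
Qed.

Let walk_mid n x y (u v : n.-tuple BV) k :
  walk (2^-1 *: (x + y))%R (tmap2 (@midV R d) u v) k =
  (2^-1 *: (walk x u k + walk y v k))%R.
Proof.
rewrite /walk [in RHS]addrACA [in RHS]scalerDr; congr (_ + _)%R.
rewrite -big_split scaler_sumr; apply: eq_bigr => i _.
by rewrite tnth_mktuple.
Qed.

Let walk_measure_opp n : measure_preserving (@opp_tuple n) (walk_measure n).
Proof.
apply: (@measure_preserving_tuple _ BV R (fun=> gaussianV d s) n (fun=> oppV)) => // _.
by apply: rV_measure_opp; exact: normal_opp.
Qed.

Let walk_measure_prekopa_leindler n :
  prekopa_leindler (tmap2 (@midV R d)) (walk_measure n).
Proof.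
apply: tuple_prekopa_leindler => _.
by apply: rV_measure_prekopa_leindler; exact: normal_prekopa_leindler.
Qed.

(** Convexity and symmetry of the ball enter here, through the triangle inequality for
    [- (w + z) = (a - w) + (- a - z)]. The equation [b = - a] is a premise so as to match the
    centers met below. *)
Let enorm_mid (a b w z : V) (r : R) : (b = - a)%R ->
  (enorm (a - w) <= r -> enorm (b - z) <= r ->
   enorm (0 - 2^-1 *: (w + z)) <= r)%R.
Proof.
move=> -> aw az.
rewrite sub0r enormN enormZ ger0_norm// ler_pdivrMl// -enormN.
rewrite (_ : - _ = (a - w) + (- a - z))%R; last by rewrite addrACA subrr add0r opprD.
by rewrite (le_trans (enormD _ _))// (le_trans (lerD aw az))// mulr2n mulrDl mul1r.
Qed.

(** Reflection and midpoints of nodes commute with [walk]: a reflected node follows the reflected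
    path and a midpoint node the path of midpoints. Anderson's inequality thus applies at all times
    of [S] at once. The ordinal [k] stands for time [k.+1], time 0 not being sampled. *)
Lemma node_measure_hit_le n (S : {set 'I_n}) (g : 'I_n -> V) r :
  node_measure n (\bigcap_(k in [set` S]) hit (g k) r k.+1) <=
  node_measure n (\bigcap_(k in [set` S]) hit 0%R r k.+1).
Proof.
have mhit (h : 'I_n -> V) : measurable (\bigcap_(k in [set` S]) @hit n (h k) r k.+1).
  by apply: fin_bigcap_measurable => // k _; exact: measurable_hit.
apply: (@anderson _ _ _ _ (fun p q => (midV p.1 q.1, tmap2 (@midV R d) p.2 q.2))
    (fun p => (oppV p.1, opp_tuple p.2))) => //.
- apply: prod_prekopa_leindler => //.
  by apply: rV_measure_prekopa_leindler; exact: lebesgue_prekopa_leindler.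
- apply/measurable_fun_pairP; split.
    by apply: (measurableT_comp measurable_oppV); exact: measurable_fst.
  by apply: (measurableT_comp (@measurable_opp_tuple n)); exact: measurable_snd.
- apply: measure_preserving_prod; [exact: measurable_oppV|exact: measurable_opp_tuple| |
    exact: walk_measure_opp].
  by apply: rV_measure_opp; exact: lebesgue_measureN.
- move=> p q Ap Aq k kS; have := Ap k kS; have := Aq k kS.
  rewrite /hit /= walk_opp walk_mid opprK -enormN opprD => hq hp.
  exact: enorm_mid hp hq.
Qed.

(** Anderson's inequality for the increments alone. Taking the first increment for [a] will show
    that the walk is less and less likely to end in a given centered ball as steps are added. *)
Lemma walk_measure_ball_le n (a : V) r :
  walk_measure n [set u | enorm (a + walk 0 u n) <= r]%R <=
  walk_measure n [set u | enorm (walk 0 u n) <= r]%R.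
Proof.
have mball (b : V) : measurable [set u : n.-tuple BV | enorm (b - walk 0 u n) <= r]%R.
  have := measurable_xsection (0%R : BV) (@measurable_hit n b r n).
  by congr measurable; apply/seteqP; split=> u; rewrite /xsection /= inE.
pose A := [set u : n.-tuple BV | enorm (- a - walk 0 u n) <= r]%R.
rewrite (_ : [set u | _] = A); last first.
  by apply/seteqP; split=> u; rewrite /A /= -enormN opprD ?opprK.
rewrite (_ : [set u | enorm (walk 0 u n) <= r]%R = [set u | enorm (0 - walk 0 u n) <= r]%R); last first.
  by apply/seteqP; split=> u; rewrite /= sub0r enormN.
apply: (@anderson _ _ _ _ (tmap2 (@midV R d)) (@opp_tuple n)); [exact: walk_measure_prekopa_leindler|
  exact: measurable_opp_tuple|exact: walk_measure_opp|exact: mball|exact: mball|].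
move=> u v; rewrite /A /=.
have -> : walk 0%R (opp_tuple v) n = (- walk 0%R v n)%R.
  by rewrite -(walk_opp 0%R) oppr0.
have -> : walk 0%R (tmap2 (@midV R d) u v) n = (2^-1 *: (walk 0 u n + walk 0 v n))%R.
  by rewrite -walk_mid addr0 scaler0.
move=> hu hv; apply: (enorm_mid (esym (opprK a)) hu).
by rewrite -enormN opprB addrC; move: hv; rewrite opprK.
Qed.

End walk.

(** * A maximal inequality for Gaussian walks *)

Section ottaviani.
Local Open Scope ereal_scope.
Context (R : realType) (d : nat) (s : R).
Local Notation V := 'rV[R]_d.
Local Notation BV := (borelV R d).
Local Notation Gamma := (@walk_measure R d s).

(** Conditioning on the first increment; both sides unfold to the same integral. *)
Lemma walk_measureS n (E : set (n.+1.-tuple BV)) :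
  Gamma n.+1 E =
  \int[gaussianV d s]_z Gamma n [set u | E (tcons (z, u))].
Proof.
rewrite /walk_measure /= /iso_image /pushforward /prod_measure /product_measure1.
apply: eq_integral => z _ /=; congr (tuple_measure _ _ _).
by apply/seteqP; split=> u; rewrite /xsection /= inE.
Qed.

Lemma measurable_walk_measure_section n (E : set (n.+1.-tuple BV)) :
  measurable E ->
  measurable_fun setT (fun z => Gamma n [set u | E (tcons (z, u))]).
Proof.
move=> mE.
have mE' : measurable (@tcons _ BV n @^-1` E).
  by rewrite -[X in measurable X]setTI; exact: measurable_tcons.
rewrite (_ : (fun z => _) = Gamma n \o xsection (@tcons _ BV n @^-1` E)).
  exact: measurable_fun_xsection.
apply/funext => z /=; congr (Gamma n _).
by apply/seteqP; split=> u; rewrite /xsection /= inE.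
Qed.

Lemma measurable_walk_ball n (y : V) r k :
  measurable [set u : n.-tuple BV | enorm (walk y u k) <= r]%R.
Proof.
have := measurable_xsection (y : BV) (@measurable_hit R d n 0%R r k).
congr measurable; apply/seteqP; split=> u; rewrite /xsection /hit /= inE /=;
  by rewrite sub0r enormN.
Qed.

Lemma walk_addr n (y z : V) (u : n.-tuple BV) k :
  walk (y + z)%R u k = (y + walk z u k)%R.
Proof. by rewrite /walk addrA. Qed.

Lemma walk_measure_le1 n E : measurable E -> Gamma n E <= 1.
Proof.
by move=> mE; rewrite -(walk_measure_setT d s n); apply: le_measure; rewrite ?inE.
Qed.

(** Given the first increment [z], the remaining walk is shifted by [z], which by Anderson's
    inequality can only lower the probability. Hence a bound by 1/2 from below for [n] steps holds
    for all shorter walks as well. *)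
Lemma walk_measure_ball_nonincreasing r : s != 0%R ->
  {homo (fun n => Gamma n [set u | enorm (walk 0 u n) <= r]%R) :
    m n / (m <= n)%N >-> n <= m}.
Proof.
move=> s0; apply: homo_leq => [n //|a b c ba cb|n]; first exact: le_trans cb ba.
rewrite walk_measureS.
rewrite -[leRHS]mul1e -(gaussianV_setT d s) muleC -integral_cst//.
apply: ge0_le_integral => //.
- by apply: measurable_walk_measure_section; exact: measurable_walk_ball.
move=> z _; apply: le_trans (walk_measure_ball_le s0 _ (z : V) _).
rewrite le_eqVlt; apply/orP; left; apply/eqP; congr (Gamma n _).
apply/seteqP; split=> u /=.
  by rewrite walk_tcons add0r -(walk_addr (z : V) 0%R u n) addr0.
by rewrite walk_tcons add0r -(walk_addr (z : V) 0%R u n) addr0.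
Qed.

(* Ottaviani's maximal inequality *)
Lemma walk_measure_maximal (r c : R) n : s != 0%R ->
  (2^-1)%:E <= Gamma n [set u | enorm (walk 0 u n) <= c]%R ->
  forall y : V,
  Gamma n (\bigcup_(k in `I_n.+1) [set u | enorm (walk y u k) <= r]%R) <=
  2%:E * Gamma n [set u | enorm (walk y u n) <= r + c]%R.
Proof.
(* A walk that starts in the ball of radius [r] and moves by at most [c] ends in the ball of radius
   [r + c], and it does so with probability at least 1/2. *)
move=> s0; have ball_sub m (y : V) : (enorm y <= r)%R ->
    (2^-1)%:E <= Gamma m [set u | enorm (walk 0 u m) <= c]%R ->
    1 <= 2%:E * Gamma m [set u | enorm (walk y u m) <= r + c]%R.
  move=> yr half; apply: (@le_trans _ _ (2%:E * Gamma m [set u | enorm (walk 0 u m) <= c]%R)).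
    apply: le_trans (lee_wpmul2l _ half) => //.
    by rewrite -EFinM divff.
  apply: lee_wpmul2l => //; apply: le_measure; rewrite ?inE; try exact: measurable_walk_ball.
  move=> u /= uc; rewrite -[y]addr0 walk_addr (le_trans (enormD _ _))//.
  by rewrite lerD.
have mhit m (y : V) :
    measurable (\bigcup_(k in `I_m.+1) [set u : m.-tuple BV | enorm (walk y u k) <= r]%R).
  by apply: bigcup_measurable => k _; exact: measurable_walk_ball.
(* Instead of a first hitting time: if [y] is in the ball, [ball_sub] concludes; if not, time 0
   contributes nothing and the induction hypothesis is used from [y + z], with [z] the first
   increment. *)
elim: n => [|n IHn] half y.
all: have [yr|yr] := leP (enorm y) r.
- by apply: le_trans (ball_sub _ _ yr half); apply: walk_measure_le1; exact: mhit.
- rewrite (_ : \bigcup_(k in _) _ = set0) ?measure0 ?mule_ge0//.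
  by apply/seteqP; split=> // u [[|//] _] /=; rewrite walk0 leNgt yr.
- by apply: le_trans (ball_sub _ _ yr half); apply: walk_measure_le1; exact: mhit.
have {}IHn := IHn (le_trans half (walk_measure_ball_nonincreasing c s0 (leqnSn n))).
rewrite [leLHS]walk_measureS [Gamma n.+1 _]walk_measureS.
have mball := measurable_walk_measure_section (measurable_walk_ball y (r + c)%R n.+1).
rewrite -ge0_integralZl//; apply: ge0_le_integral => //.
- by apply: measurable_walk_measure_section; exact: mhit.
- by apply: measurable_funeM; exact: mball.
move=> z _.
rewrite (_ : [set u | _ (tcons (z, u))] =
    \bigcup_(k in `I_n.+1) [set u | enorm (walk (y + (z : V)) u k) <= r]%R).
  apply: le_trans (IHn _) _; apply: lee_wpmul2l => //; rewrite le_eqVlt; apply/orP; left; apply/eqP.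
  by congr (Gamma n _); apply/seteqP; split=> u; rewrite /= walk_tcons.
apply/seteqP; split=> u /= [k].
  case: k => [_|k kn]; first by rewrite /= walk0 leNgt yr.
  by rewrite /= walk_tcons; exists k.
by move=> kn uk; exists k.+1 => //=; rewrite walk_tcons.
Qed.

End ottaviani.

(** * Monotonicity of the covering probability in the visit rates *)

Section vacant_set.
Context {R : realType} {T : finType}.
Implicit Types (w : {set T} -> R) (S U A C : {set T}).

(** Total rate of the nodes that visit at some time of [S]. The exponential of its opposite is the
    probability that all times of [S] are vacant, and [cover_prob] is the inclusion-exclusion
    formula built on it. *)
Definition hitting_mass w S : R := \sum_(A | A :&: S != finset.set0) w A.

Definition cover_prob w : R :=
  \sum_(S : {set T}) (-1) ^+ #|S| * expR (- hitting_mass w S).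

(** By inclusion-exclusion over the times outside [U], the probability that the set of vacant times
    is exactly [U]. *)
Definition vacant_prob w U : R :=
  \sum_(S : {set T} | U \subset S) (-1) ^+ #|S :\: U| * expR (- hitting_mass w S).

(** The sum factors over the points of [T], with each factor 0 or 1; it equals 1 if [U = C] and 0
    otherwise. *)
Lemma alternating_sum_ge0 U C :
  0 <= \sum_(S : {set T} | (U \subset S) && (S \subset C)) (-1) ^+ #|S :\: U| :> R.
Proof.
pose F i : R := if i \in C then (if i \in U then 1 else -1) else 0.
pose G i : R := if i \in U then 0 else 1.
rewrite (_ : \sum_(S | _) _ = \sum_(S : {set T}) \prod_i (if i \in S then F i else G i)).
  rewrite -(bigA_distr _ _ F G); apply: prodr_ge0 => i _.
  rewrite /F /G; case: (i \in C); case: (i \in U) => //=; lra.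
rewrite big_mkcond; apply: eq_bigr => S _; case: ifPn => [/andP[US SC]|].
  rewrite -prodr_const big_mkcond; apply: eq_bigr => i _.
  rewrite inE /F /G; have /fintype.subsetP/(_ i) := US; have /fintype.subsetP/(_ i) := SC.
  case: (i \in S) => [->//|_]; last by case: (i \in U) => [/(_ isT)|].
  by case: (i \in U).
rewrite negb_and => /orP[] /fintype.subsetPn[i iX iY]; apply/esym.
  by rewrite (bigD1 i)//= (negbTE iY) /G iX mul0r.
by rewrite (bigD1 i)//= iX /F (negbTE iY) mul0r.
Qed.

Lemma alternating_sum_eq0 A :
  \sum_(U : {set T} | U \subset A) (-1) ^+ #|U| = (A == finset.set0)%:R :> R.
Proof.
pose F i : R := if i \in A then -1 else 0.
pose G (i : T) : R := 1.
rewrite (_ : \sum_(U | _) _ = \sum_(U : {set T}) \prod_i (if i \in U then F i else G i)).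
  rewrite -(bigA_distr _ _ F G); have [A0|/finset.set0Pn[i iA]] := eqVneq A finset.set0.
    by rewrite big1// => i _; rewrite /F /G A0 finset.in_set0 /= add0r.
  by rewrite (bigD1 i)//= /F /G iA addNr mul0r.
rewrite big_mkcond; apply: eq_bigr => S _; case: ifPn => [SA|/fintype.subsetPn[i iS iA]].
  rewrite -prodr_const big_mkcond; apply: eq_bigr => i _.
  by rewrite /F /G; have /fintype.subsetP/(_ i) := SA; case: (i \in S) => [->|].
by rewrite (bigD1 i)//= iS /F (negbTE iA) mul0r.
Qed.

Lemma expR_sum (I : finType) (P : pred I) (F : I -> R) :
  expR (\sum_(i | P i) F i) = \prod_(i | P i) expR (F i).
Proof. by apply: (big_morph expR (@expRD R) (@expR0 R)). Qed.

(* Expanding the product over the types [A] turns [vacant_prob] into a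
   nonnegative combination of alternating sums over intervals of sets. *)
Lemma vacant_prob_ge0 w U : (forall A, A != finset.set0 -> 0 <= w A) -> 0 <= vacant_prob w U.
Proof.
move=> w0.
(* [a' A] and [b A] are the probabilities that no node, respectively some node, has [A] as its set
   of visit times. The empty set gets 1 and 0, since it meets no [S]. *)
pose a A := expR (- w A); pose b A := if A == finset.set0 then 0 else 1 - a A.
pose a' A := if A == finset.set0 then 1 else a A.
have b0 A : 0 <= b A.
  rewrite /b; case: eqVneq => // A0; rewrite subr_ge0 -expR0 ler_expR oppr_le0.
  exact: w0.
have a0 A : 0 <= a' A by rewrite /a'; case: ifP => // _; exact: expR_ge0.
(* [J] is the set of types that occur: all times of [S] are vacant exactly when no type in [J] meets
   [S]. *)
have E S : expR (- hitting_mass w S) =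
    \sum_(J : {set {set T}}) (\prod_A (if A \in J then b A else a' A)) *
      (S \subset finset.setC (finset.cover J))%:R.
  rewrite /hitting_mass -sumrN expR_sum.
  transitivity (\prod_A (b A * (A :&: S == finset.set0)%:R + a' A)).
    rewrite big_mkcond; apply: eq_bigr => A _; rewrite /b /a'.
    have [->|A0] := eqVneq A finset.set0; first by rewrite finset.set0I eqxx/= mul0r add0r.
    by case: eqP => _ /=; rewrite ?mulr1 ?mulr0 ?add0r// subrK.
  rewrite bigA_distr; apply: eq_bigr => J _.
  have [SJ|] := boolP (S \subset _); rewrite ?mulr1 ?mulr0.
    apply: eq_bigr => A _; case: ifPn => // AJ.
    rewrite (_ : A :&: S == _) ?mulr1//; apply/eqP/finset.setP => i; rewrite !inE.
    apply/negP => /andP[iA iS]; have /fintype.subsetP/(_ i iS) := SJ.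
    by rewrite inE => /negP; apply; apply/finset.bigcupP; exists A.
  move=> /fintype.subsetPn[i iS]; rewrite inE negbK => /finset.bigcupP[A AJ iA].
  rewrite (bigD1 A)//= AJ (_ : _ == _ = false) ?mulr0 ?mul0r//.
  by apply/negbTE/finset.set0Pn; exists i; rewrite inE iA.
rewrite /vacant_prob; under eq_bigr do rewrite E mulr_sumr.
rewrite exchange_big /=; apply: sumr_ge0 => J _.
under eq_bigr do rewrite mulrCA.
rewrite -mulr_sumr; apply: mulr_ge0.
  by apply: prodr_ge0 => A _; case: ifP.
under eq_bigr => S _ do rewrite -[_%:R]/(_ *+ _) mulr_natr.
rewrite (_ : \sum_(S | _) _ = \sum_(S : {set T} | (U \subset S) &&
   (S \subset finset.setC (finset.cover J))) (-1) ^+ #|S :\: U|).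
  exact: alternating_sum_ge0.
by rewrite big_mkcondr; apply: eq_bigr => S _; case: (S \subset _).
Qed.

(** The indicator that [A] meets [S] is minus the alternating sum over the nonempty subsets of their
    intersection. This expresses the masses through the sums over supersets, the quantities that
    Anderson's inequality compares. *)
Lemma hitting_massE w S : hitting_mass w S =
  - \sum_(U : {set T} | (U \subset S) && (U != finset.set0))
      (-1) ^+ #|U| * \sum_(A : {set T} | U \subset A) w A.
Proof.
have -> : \sum_(U : {set T} | (U \subset S) && (U != finset.set0))
      (-1) ^+ #|U| * \sum_(A : {set T} | U \subset A) w A =
  \sum_A w A * \sum_(U : {set T} | (U \subset A :&: S) && (U != finset.set0)) (-1) ^+ #|U|.
  under eq_bigr do rewrite mulr_sumr.
  rewrite (exchange_big_dep xpredT)//=; apply: eq_bigr => A _.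
  rewrite mulr_sumr; under [RHS]eq_bigl do rewrite finset.subsetI.
  by apply: eq_big => [U|U _]; [rewrite andbC andbA|rewrite mulrC].
rewrite -sumrN /hitting_mass big_mkcond; apply: eq_bigr => A _.
have := alternating_sum_eq0 (A :&: S).
rewrite (bigD1 finset.set0) ?finset.sub0set//= cards0 expr0.
move: (\sum_(i | _) _) => Y; case: eqP => _ /= H.
  by rewrite (_ : Y = 0) ?mulr0 ?oppr0//; lra.
by rewrite (_ : Y = -1) ?mulrN1 ?opprK//; lra.
Qed.

Lemma is_derive_bigsum (I : Type) (r : seq I) (h : I -> R -> R) (dh : I -> R) (x : R) :
  (forall i, is_derive x 1 (h i) (dh i)) ->
  is_derive x 1 (fun t => \sum_(i <- r) h i t) (\sum_(i <- r) dh i).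
Proof.
move=> hd; elim: r => [|i r IHr].
  by rewrite big_nil; under eq_fun do rewrite big_nil; exact: is_derive_cst.
rewrite big_cons; under eq_fun do rewrite big_cons; exact: is_deriveD.
Qed.

Lemma is_derive_expR_affine (a b c t : R) :
  is_derive t 1 (fun u => c * expR (a + u * b)) (c * (expR (a + t * b) * b)).
Proof.
have h : is_derive t (1 : R) (fun u : R => a + u * b) b.
  have -> : (fun u : R => a + u * b) = cst a + (b *: id).
    by apply/funext => u; rewrite !fctE /= mulrC.
  by apply: is_derive_eq; rewrite add0r scaler1.
have := is_deriveZ c (is_derive1_comp (is_derive_expR _) h).
exact.
Qed.

(* The derivative of [cover_prob] along the segment from [w1] to [w0] is
   [\sum_U (m0 U - m1 U) * vacant_prob U], where [mi U] is the sum of [wi A]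
   over all [A] containing [U]. *)
Lemma cover_prob_le w0 w1 :
  (forall A, A != finset.set0 -> 0 <= w0 A) ->
  (forall A, A != finset.set0 -> 0 <= w1 A) ->
  (forall U, U != finset.set0 ->
    \sum_(A : {set T} | U \subset A) w1 A <= \sum_(A : {set T} | U \subset A) w0 A) ->
  cover_prob w1 <= cover_prob w0.
Proof.
move=> w0_ge0 w1_ge0 le_w.
pose D A := w0 A - w1 A.
pose w t A := w1 A + t * D A.
pose phi t := cover_prob (w t).
pose dphi t := \sum_(U : {set T} | U != finset.set0)
  (\sum_(A : {set T} | U \subset A) D A) * vacant_prob (w t) U.
have massE t S : hitting_mass (w t) S = hitting_mass w1 S + t * hitting_mass D S.
  by rewrite /hitting_mass big_split mulr_sumr.
(* The right side is the termwise derivative. Expanding the mass of [D] over subsets [U] of [S] and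
   exchanging sums gives [dphi], since the sign of [S :\: U] is the product of those of [S] and
   [U]. *)
have dphiE t : dphi t = \sum_(S : {set T})
    (-1) ^+ #|S| * (expR (- hitting_mass (w t) S) * (- hitting_mass D S)).
  rewrite /dphi /vacant_prob; under eq_bigr do rewrite mulr_sumr.
  rewrite (exchange_big_dep xpredT)//=; apply: eq_bigr => S _.
  rewrite (hitting_massE D) opprK !mulr_sumr.
  apply: eq_big => [U|U /andP[U0 US]]; first by rewrite andbC.
  have -> : (-1) ^+ #|S :\: U| = (-1) ^+ #|S| * (-1) ^+ #|U| :> R.
    by rewrite -(cardsID U S) (finset.setIidPr US) addnC exprD -mulrA -exprD addnn -mul2n exprM sqrrN expr1n expr1n mulr1.
  by ring.
have dphi_ge0 t : 0 <= t <= 1 -> 0 <= dphi t.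
  move=> /andP[t0 t1]; apply: sumr_ge0 => U U0; apply: mulr_ge0.
    by rewrite sumrB subr_ge0; exact: le_w.
  apply: vacant_prob_ge0 => A A0; rewrite /w /D.
  have := w0_ge0 A A0; have := w1_ge0 A A0; nra.
have dphiP (t : R) : is_derive t 1 phi (dphi t).
  rewrite dphiE; apply: is_derive_bigsum => S.
  rewrite (_ : (fun t => _) = (fun t => (-1) ^+ #|S| * expR (- hitting_mass w1 S + t * - hitting_mass D S))).
    by rewrite massE opprD -mulrN; exact: is_derive_expR_affine.
  by apply/funext => u; rewrite massE opprD mulrN.
have [|c c01] := @MVT_segment R phi dphi 0 1 ler01 (fun t _ => dphiP t).
  apply: continuous_subspaceT => t.
  by apply: differentiable_continuous; apply/derivable1_diffP; exact: ex_derive.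
rewrite subr0 mulr1 => phiE.
have -> : cover_prob w1 = phi 0.
  by rewrite /phi; congr cover_prob; apply/funext => A; rewrite /w mul0r addr0.
have -> : cover_prob w0 = phi 1.
  by rewrite /phi; congr cover_prob; apply/funext => A; rewrite /w /D mul1r addrC subrK.
by rewrite -subr_ge0 phiE; apply: dphi_ge0; move: c01; rewrite in_itv.
Qed.

End vacant_set.

(** * Counts and Laplace functional of a Poisson process *)

Section counting.
Import finmap.
Implicit Type S : set nat.

Definition partial_count S m : nat := count (fun i => `[< S i >]) (iota 0 m).

Lemma partial_countS S m : partial_count S m.+1 = (partial_count S m + `[< S m >])%N.
Proof. by rewrite /partial_count -addn1 iotaD count_cat /= add0n addn0. Qed.

Lemma card_eq_partial_count S m k : S `<=` `I_m -> (S #= `I_k)%card <-> partial_count S m = k.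
Proof.
move=> Sm; pose F : {fset nat} := [fset i in [seq i <- iota 0 m | `[< S i >]]]%fset.
have SF : S = [set` F].
  apply/seteqP; split=> i; rewrite /= !inE mem_filter mem_iota add0n.
    by move=> Si; apply/andP; split; [apply/asboolP|exact: Sm].
  by move=> /andP[/asboolP].
have FE : (#|` F| = partial_count S m)%N.
  by rewrite card_fseq undup_id ?filter_uniq ?iota_uniq// size_filter.
by rewrite {1}SF -FE; split=> /card_eq_fsetP.
Qed.

(** Turns a cardinality, possibly of an infinite set, into a countable condition on partial counts;
    it gives both the measurability of count events and the value of limits over the nodes. *)
Lemma card_eq_eventually S k : (S #= `I_k)%card <->
  exists m, forall n, (m <= n)%N -> partial_count S n = k.
Proof.
have bounded m : (forall n, (m <= n)%N -> partial_count S n = partial_count S m) -> S `<=` `I_m.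
  move=> H i Si /=; rewrite ltnNge; apply/negP => mi.
  have := H i.+1 (leqW mi); rewrite partial_countS (H i mi) asboolT//.
  by move/eqP; rewrite -[X in _ == X]addn0 eqn_add2l.
split=> [Sk|[m Sm]].
  have /finite_seqP[s Ss] : finite_set S by apply/finite_setP; exists k.
  exists (\max_(i <- s) i).+1%N => n mn; apply/card_eq_partial_count => //.
  move=> i Si /=; apply: leq_trans mn; rewrite ltnS.
  have : i \in s by move: Si; rewrite Ss.
  by move=> si; apply: (@leq_bigmax_seq _ _ xpredT id).
by apply/(@card_eq_partial_count S m); [apply: bounded => n mn|]; rewrite !Sm.
Qed.

End counting.

Section poisson_mass.
Context {R : realType}.
Implicit Types a c : R.
Local Open Scope ereal_scope.

Lemma poisson_prob_set1 a n k : (0 <= a)%R ->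
  poisson_prob a n [set k] = (a ^+ k / k`!%:R * expR (- a))%:E.
Proof.
rewrite le_eqVlt => /predU1P[<-|a0]; rewrite /poisson_prob.
  (* At rate 0 the distribution is by convention the Dirac mass at 0. *)
  rewrite ltxx diracE oppr0 expR0 mulr1 expr0n; case: k => [|k] /=.
    by rewrite mem_set// fact0 divr1.
  by rewrite memNset// mul0r.
rewrite a0 esum_set1; first by rewrite /poisson_pmf a0.
by rewrite lee_fin poisson_pmf_ge0.
Qed.

Lemma nneseries_poisson_prob a n : (0 <= a)%R ->
  \sum_(k <oo) poisson_prob a n [set k] = 1.
Proof.
move=> a0; rewrite -(probability_setT (poisson_prob a n)).
rewrite -measure_semi_bigcup//.
- by congr (poisson_prob a n _); apply/seteqP; split=> // k _; exists k.
- by move=> i j _ _ [k [/= -> ->]].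
Qed.

Lemma nneseries_poisson_mean a n : (0 <= a)%R ->
  \sum_(k <oo) (k%:R%:E * poisson_prob a n [set k]) = a%:E.
Proof.
move=> a0; rewrite nneseries_recl; [|by move=> k _; rewrite mule_ge0|by []].
rewrite mul0e add0e -[RHS]mule1 -(nneseries_poisson_prob n a0) -nneseriesZl//.
rewrite -nneseries_addn; last by move=> k; rewrite mule_ge0.
apply: eq_eseriesr => k _; rewrite !poisson_prob_set1// -!EFinM; congr (_%:E).
rewrite addn1 exprS factS natrM invfM.
have k1 : (k.+1%:R : R)%R != 0%R by rewrite pnatr_eq0.
have k0 : (k`!%:R : R)%R != 0%R by rewrite pnatr_eq0 -lt0n fact_gt0.
by move: (k.+1%:R : R)%R (k`!%:R : R)%R k1 k0 => K F K0 F0; field; rewrite K0 F0.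
Qed.

(** [c ^+ k] times the Poisson weight of mean [a] is [expR (- (a * (1 - c)))] times the Poisson
    weight of mean [c * a], and the latter weights sum to 1. *)
Lemma nneseries_poisson_gen a n c : (0 <= a)%R -> (0 <= c)%R ->
  \sum_(k <oo) ((c ^+ k)%:E * poisson_prob a n [set k]) = (expR (- (a * (1 - c))))%:E.
Proof.
move=> a0 c0; have ca0 : (0 <= c * a)%R by rewrite mulr_ge0.
rewrite -[RHS]mule1 -(nneseries_poisson_prob n ca0) -nneseriesZl//.
apply: eq_eseriesr => k _; rewrite !poisson_prob_set1// -!EFinM; congr (_%:E).
have -> : expR (- a) = (expR (- (a * (1 - c))) * expR (- (c * a)))%R.
  by rewrite -expRD; congr expR; ring.
by rewrite exprMn; ring.
Qed.

End poisson_mass.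

Section poisson_counts.
Local Open Scope ereal_scope.
Context {R : realType} {d : nat} {disp : measure_display}.
Context {Omega : measurableType disp}.
Variables (P : probability Omega R) (lambda : R) (X : nat -> Omega -> 'rV[R]_d).
Hypothesis lambda0 : (0 < lambda)%R.
Hypothesis pp : poisson_process P lambda X.
Local Notation V := 'rV[R]_d.
Local Notation BV := (borelV R d).
Implicit Type A : set BV.

Lemma measurable_point i : measurable_fun setT (X i : Omega -> BV).
Proof. by move=> _ A mA; rewrite setTI; exact: (poisson_measurable pp i). Qed.

Lemma measurable_point_preimage i A : measurable A -> measurable (X i @^-1` A).
Proof. by move=> mA; exact: (poisson_measurable pp i). Qed.

Lemma measurable_partial_count A n k : measurable A ->
  measurable [set w | partial_count [set i | A (X i w)] n = k].
Proof.
move=> mA; elim: n k => [|n IHn] k.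
  case: k => [|k]; [rewrite (_ : mkset _ = setT)|rewrite (_ : mkset _ = set0)] => //.
    by apply/seteqP; split.
  by apply/seteqP; split.
rewrite (_ : mkset _ =
    [set w | partial_count [set i | A (X i w)] n = k] `&` ~` (X n @^-1` A) `|`
    (if k is k'.+1 then
       [set w | partial_count [set i | A (X i w)] n = k'] `&` (X n @^-1` A)
     else set0)).
  apply: measurableU.
    by apply: measurableI => //; apply: measurableC; exact: measurable_point_preimage.
  by case: k => // k; apply: measurableI => //; exact: measurable_point_preimage.
apply/seteqP; split=> w /=; rewrite partial_countS.
  case: asboolP => Aw; rewrite ?addn0 ?addn1; last by left.
  by move=> <-; right.
case: asboolP => Aw; rewrite ?addn0 ?addn1 => -[[]//|].
  by case: k => // k [->].
by case: k => // k [].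
Qed.

Lemma measurable_count_event A k : measurable A -> measurable (count_event X A k).
Proof.
move=> mA; rewrite (_ : count_event X A k = \bigcup_m \bigcap_(n in [set n | (m <= n)%N])
    [set w | partial_count [set i | A (X i w)] n = k]).
  apply: bigcupT_measurable => m; apply: bigcap_measurable; first by exists m => /=.
  by move=> n _; exact: measurable_partial_count.
by apply/seteqP; split=> w /=; [move/card_eq_eventually => -[m h]; exists m|
  move=> [m _ h]; apply/card_eq_eventually; exists m].
Qed.

Lemma trivIset_count_event A : trivIset setT (count_event X A).
Proof.
move=> j k _ _ [w [/= wj wk]]; apply/card_eq_II.
by apply: card_eq_trans wk; rewrite card_eq_sym; exact: wj.
Qed.

Lemma volume_ge0 A : 0 <= volume (A : set V).
Proof.
apply: le_ereal_inf_tmp => _ [a [b [ab _ ->]]]; apply: nneseries_ge0 => n _ _.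
by rewrite lee_fin prodr_ge0// => j _; rewrite subr_ge0.
Qed.

Let mass A := (lambda * fine (volume (A : set V)))%R.

Let mass_ge0 A : (0 <= mass A)%R.
Proof. by rewrite mulr_ge0 ?fine_ge0 ?volume_ge0// ltW. Qed.

(** Infinitely many points in [A] are not excluded by definition, but the Poisson weights of the
    finite counts already sum to 1. *)
Lemma count_event_full A : measurable A -> volume (A : set V) < +oo ->
  P (\bigcup_k count_event X A k) = 1.
Proof.
move=> mA Aoo.
rewrite measure_semi_bigcup; last by apply: bigcupT_measurable => k; exact: measurable_count_event.
- rewrite -(nneseries_poisson_prob 0 (mass_ge0 A)); apply: eq_eseriesr => k _.
  exact: (poisson_count pp).
- by move=> k; exact: measurable_count_event.
- exact: trivIset_count_event.
Qed.

Lemma integral_count_event A D (f : Omega -> \bar R) :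
  measurable A -> volume (A : set V) < +oo -> measurable D ->
  measurable_fun setT f -> (forall w, 0 <= f w) ->
  \int[P]_(w in D) f w = \sum_(k <oo) \int[P]_(w in D `&` count_event X A k) f w.
Proof.
move=> mA Aoo mD mf f0.
have mC k := measurable_count_event k mA.
have mU : measurable (\bigcup_k count_event X A k) by exact: bigcupT_measurable.
rewrite -ge0_integral_bigcup//=.
- rewrite -setI_bigcupr.
  rewrite (ge0_negligible_integral (N := ~` (\bigcup_k count_event X A k)))//.
  + by rewrite setDE setCK.
  + exact: measurableC.
  + exact: measurable_funTS.
  + by apply: (eq_trans (probability_setC P mU)); rewrite count_event_full// subee.
- by move=> k; exact: measurableI.
- exact: measurable_funTS.
- by move=> i j _ _ [w [[_ wi] [_ wj]]]; apply: (@trivIset_count_event A) => //; exists w.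
Qed.

(** The mean number of points, a measure by construction. It links the outer measure [volume] of the
    Poisson hypothesis to the product measure [lebesgueV], and so avoids a study of the sets
    measurable for [volume]. *)
Definition intensity : {measure set BV -> \bar R} :=
  mseries (fun i => image_measure P (measurable_point i)) 0.

Lemma intensity_volume A : measurable A -> volume (A : set V) < +oo ->
  intensity A = (mass A)%:E.
Proof.
move=> mA Aoo; rewrite /intensity /= /mseries /=.
have mI i : measurable_fun setT (fun w => (\1_(X i @^-1` A) w)%:E : \bar R).
  apply/measurable_EFinP; apply: measurable_indic.
  exact: measurable_point_preimage.
transitivity (\int[P]_w \sum_(i <oo) (\1_(X i @^-1` A) w)%:E).
  rewrite integral_nneseries//.
  apply: eq_eseriesr => i _; rewrite integral_indic ?setIT//.
  exact: measurable_point_preimage.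
rewrite (integral_count_event mA)//; last 2 first.
- by apply: ge0_emeasurable_sum => // i w _ _; rewrite lee_fin.
- by move=> w; apply: nneseries_ge0 => i _ _; rewrite lee_fin.
rewrite -(nneseries_poisson_mean 0 (mass_ge0 A)); apply: eq_eseriesr => k _.
rewrite setTI -(poisson_count pp)// -integral_cst//; last exact: measurable_count_event.
apply: eq_integral => w; rewrite inE => /card_eq_eventually[m mk].
apply/cvg_lim => //; apply: cvg_near_cst; exists m => // n /= mn.
rewrite -(mk _ mn) sumEFin /partial_count; congr (_%:E).
rewrite -sum1_count natr_sum /index_iota subn0 [RHS]big_mkcond.
apply: eq_bigr => i _; rewrite indicE.
by case: asboolP => Aw; [rewrite mem_set|rewrite memNset].
Qed.

Lemma volume_box (a b : V) : (0 < d)%N -> (forall j, a ord0 j <= b ord0 j)%R ->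
  volume (box a b) = lebesgueV R d (box a b).
Proof.
move=> d0 ab; apply/eqP; rewrite eq_le; apply/andP; split.
  (* The cover by one box is completed with boxes [box 0 0]; their volume is an empty product, equal
     to 1, unless [0 < d]. *)
  apply: ereal_inf_lbound; exists (fun n => if n == 0%N then a else 0%R),
    (fun n => if n == 0%N then b else 0%R).
  split.
  - by case.
  - by move=> x xab; exists 0%N.
  - rewrite lebesgueV_box// nneseries_recl//.
      rewrite eseries0 ?adde0// => -[|n]// _ _.
      by rewrite (bigD1 (Ordinal d0))//= subrr mul0r.
    move=> n _; rewrite lee_fin prodr_ge0// => j _.
    by case: n => [|n]; rewrite ?subr_ge0// subrr.
apply: le_ereal_inf_tmp => _ [a' [b' [ab' cover ->]]].
rewrite (eq_eseriesr (g := fun n => lebesgueV R d (box (a' n) (b' n)))); last first.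
  by move=> n _; rewrite lebesgueV_box.
have mb n : measurable (box (a' n) (b' n) : set BV) by exact: measurable_box.
apply: (@le_trans _ _ (lebesgueV R d (\bigcup_n box (a' n) (b' n)))).
  apply: le_measure; rewrite ?inE//; first exact: measurable_box.
  exact: bigcupT_measurable.
by apply: generalized_Boole_inequality => //; exact: bigcupT_measurable.
Qed.

(** Both sides are measures, so it is enough to compare them on boxes, which generate the Borel sets
    and whose outer measure is known. *)
Lemma intensityE (d0 : (0 < d)%N) A : measurable A ->
  intensity A = lambda%:E * lebesgueV R d A.
Proof.
move=> mA; pose m : {measure set BV -> \bar R} :=
  mscale (NngNum (ltW lambda0)) (lebesgueV R d).
pose c n : V := const_mx n%:R.
rewrite -[RHS]/(m A).
apply: (@measure_unique _ _ BV [set A | exists a b : V, A = box a b]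
  (fun n => box (- c n)%R (c n)) _ _ _ _ intensity m) => //.
- exact: borel_gen_box.
- move=> _ _ [a [b ->]] [a' [b' ->]].
  exists (\row_j Num.max (a ord0 j) (a' ord0 j)), (\row_j Num.min (b ord0 j) (b' ord0 j)).
  apply/seteqP; split=> x /=.
    move=> [xa xa'] j; rewrite !mxE gt_max le_min.
    by have /andP[-> ->] := xa j; have /andP[-> ->] := xa' j.
  move=> h; split=> j; have := h j; rewrite !mxE gt_max le_min.
    by move=> /andP[/andP[-> _] /andP[-> _]].
  by move=> /andP[/andP[_ ->] /andP[_ ->]].
- by move=> n; exists (- c n)%R, (c n).
- apply/seteqP; split=> // x _; exists (\max_j (Num.bound `|x ord0 j|)).+1%N => // j.
  rewrite !mxE; have := archi_boundP (normr_ge0 (x ord0 j)) => xb.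
  suff : (`|x ord0 j| < (\max_j (Num.bound `|x ord0 j|)).+1%:R)%R.
    by rewrite ltr_norml => /andP[-> /ltW->].
  apply: lt_le_trans xb _; rewrite ler_nat; apply: leqW.
  exact: (leq_bigmax j).
- move=> _ [a [b ->]].
  have [ab|] := pselect (forall j, a ord0 j <= b ord0 j)%R.
    rewrite intensity_volume; [|exact: measurable_box|].
      by rewrite /mass volume_box// /m /= /mscale /= EFinM fineK// lebesgueV_box.
    by rewrite volume_box// lebesgueV_box// ltry.
  move=> /existsNP[j /negP]; rewrite -ltNge => ba.
  rewrite (_ : box a b = set0) ?measure0//.
  apply/seteqP; split=> // x /(_ j) /andP[h1 h2].
  by have := lt_le_trans h1 h2; rewrite ltNge ltW.
- move=> n; rewrite intensity_volume; [|exact: measurable_box|]; first by rewrite ltry.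
  rewrite volume_box// ?lebesgueV_box ?ltry//= => j; rewrite !mxE.
    by rewrite (le_trans _ (ler0n _ _))// oppr_le0.
  by rewrite (le_trans _ (ler0n _ _))// oppr_le0.
Qed.

(* On bounded Borel sets the outer measure [volume] is Lebesgue measure: both
   give the mean number of points. *)
Lemma volume_lebesgueV (d0 : (0 < d)%N) A (a b : V) : measurable A ->
  (forall j, a ord0 j <= b ord0 j)%R -> A `<=` box a b ->
  volume (A : set V) = lebesgueV R d A.
Proof.
move=> mA ab Aab.
have Aoo : volume (A : set V) < +oo.
  have : volume (box a b) < +oo by rewrite volume_box// lebesgueV_box// ltry.
  apply: le_lt_trans; apply: le_ereal_inf => v [a' [b' [ab' cover vE]]].
  by exists a', b'; split=> //; exact: subset_trans cover.
have := intensityE d0 mA; rewrite intensity_volume// /mass EFinM.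
have Afin : volume (A : set V) \is a fin_num by rewrite ge0_fin_numE// volume_ge0.
rewrite fineK// => /(congr1 (fun x => (lambda^-1)%:E * x)).
by rewrite !muleA -!EFinM mulVf ?gt_eqF// !mul1e.
Qed.

End poisson_counts.

Lemma bounded_cvg_integral disp (T : measurableType disp) (R : realType)
    (P : probability T R) (f_ : nat -> T -> R) (f : T -> R) :
  (forall m, measurable_fun setT (f_ m)) -> (forall m w, 0 <= f_ m w <= 1) ->
  (forall w, f_ ^~ w @ \oo --> f w) ->
  (\int[P]_w (f_ m w)%:E @[m --> \oo] --> \int[P]_w (f w)%:E)%E.
Proof.
move=> mf f01 ff.
apply: (@dominated_cvg _ _ _ P setT measurableT _ _ (cst 1%E)) => //.
- by move=> m; exact/measurable_EFinP.
- by move=> w _; apply: cvg_EFin; [exact: nearW|exact: ff].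
- exact: finite_measure_integrable_cst.
- by move=> m w _; rewrite /= lee_fin ger0_norm; have /andP[] := f01 m w.
Qed.

(** * The Laplace functional of the Poisson process *)

Section laplace.
Local Open Scope ereal_scope.
Context {R : realType} {d : nat} {disp : measure_display}.
Context {Omega : measurableType disp}.
Variables (P : probability Omega R) (lambda : R) (X : nat -> Omega -> 'rV[R]_d).
Hypothesis lambda0 : (0 < lambda)%R.
Hypothesis pp : poisson_process P lambda X.
Local Notation V := 'rV[R]_d.
Local Notation BV := (borelV R d).

Section simple.
Variables (A : nat -> set BV) (b : nat -> R).
Hypothesis mA : forall l, measurable (A l).
Hypothesis Aoo : forall l, volume (A l : set V) < +oo.
Hypothesis tA : trivIset setT A.
Hypothesis b01 : forall l, (0 <= b l <= 1)%R.

Let mass l := (lambda * fine (volume (A l : set V)))%R.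
Let mass_ge0 l : (0 <= mass l)%R.
Proof. by rewrite mulr_ge0 ?fine_ge0 ?volume_ge0// ltW. Qed.

Let weight l (x : V) : R := (1 - b l * \1_(A l) x)%R.

Let weight01 l x : (0 <= weight l x <= 1)%R.
Proof.
rewrite /weight indicE; have /andP[b0 b1] := b01 l.
by case: (x \in _); rewrite ?mulr1 ?mulr0; apply/andP; split; lra.
Qed.

Let total l m w : R := (\prod_(i < m) weight l (X i w))%R.

Let totalE l m w :
  total l m w = ((1 - b l) ^+ partial_count [set i | A l (X i w)] m)%R.
Proof.
rewrite /total; elim: m => [|m IHm]; first by rewrite big_ord0 expr0.
rewrite big_ord_recr partial_countS exprD IHm; congr (_ * _)%R.
rewrite /weight indicE; case: asboolP => Ax.
  by rewrite mem_set// mulr1 expr1.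
by rewrite memNset// mulr0 subr0 expr0.
Qed.

Let total01 l m w : (0 <= total l m w <= 1)%R.
Proof.
apply/andP; split; first by apply: prodr_ge0 => i _; have /andP[] := weight01 l (X i w).
by apply: prodr_ile1 => i _; exact: weight01.
Qed.

Let limit l w : R := limn (fun m => total l m w).

Let cvg_total l w : (fun m => total l m w) @ \oo --> limit l w.
Proof.
apply: nonincreasing_is_cvgn.
  apply/nonincreasing_seqP => m; rewrite /total big_ord_recr /= ler_piMr//.
    by have /andP[] := total01 l m w.
  by have /andP[] := weight01 l (X m w).
by exists 0%R => _ [m _ <-]; have /andP[] := total01 l m w.
Qed.

Let limit01 l w : (0 <= limit l w <= 1)%R.
Proof.
apply/andP; split.
  apply: limr_ge; first by apply: cvgP; exact: cvg_total.
  by apply: nearW => m; have /andP[] := total01 l m w.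
apply: limr_le; first by apply: cvgP; exact: cvg_total.
by apply: nearW => m; have /andP[] := total01 l m w.
Qed.

Let measurable_total l m : measurable_fun setT (total l m).
Proof.
apply: measurable_prod => i _; rewrite /weight.
apply: measurable_funB => //; apply: measurable_funM => //.
rewrite (_ : (fun w => _) = \1_(X i @^-1` A l)) //.
by apply: measurable_indic; exact: (measurable_point_preimage pp).
Qed.

Let measurable_limit l : measurable_fun setT (limit l).
Proof.
by apply: (measurable_fun_cvg (h := total l)) => // w _; exact: cvg_total.
Qed.

Let limit_count l k w : count_event X (A l) k w -> limit l w = ((1 - b l) ^+ k)%R.
Proof.
move=> /card_eq_eventually[m mk]; apply/cvg_lim => //; apply: cvg_near_cst.
by exists m => // n /= mn; rewrite totalE mk.
Qed.

Let limits j n w : R := (\prod_(j <= l < j + n) limit l w)%R.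

(** Independence is assumed only for intersections of count events. The induction therefore keeps
    the first [j] counts fixed in the domain of integration and, at each step, sums over the count
    in [A j] with the Poisson generating function. *)
Let integral_limits j n (k : nat -> nat) :
  \int[P]_(w in \big[setI/setT]_(l < j) count_event X (A l) (k l)) (limits j n w)%:E =
  P (\big[setI/setT]_(l < j) count_event X (A l) (k l)) *
  (\prod_(j <= l < j + n) expR (- (mass l * b l)))%:E.
Proof.
have mC l i : measurable (count_event X (A l) i) by exact: (measurable_count_event pp).
have mD i (k' : nat -> nat) : measurable (\big[setI/setT]_(l < i) count_event X (A l) (k' l)).
  by apply: bigsetI_measurable.
have PD i (k' : nat -> nat) : P (\big[setI/setT]_(l < i) count_event X (A l) (k' l)) =
    \prod_(l < i) P (count_event X (A l) (k' l)).
  apply: (poisson_independent pp (A := fun l : 'I_i => A l) (fun l : 'I_i => k' l)).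
  - by move=> l; exact: mA.
  - by move=> l; exact: Aoo.
  - by move=> l l' _ _ h; apply: val_inj; exact: tA h.
have mlim i m : measurable_fun setT (limits i m).
  by apply: measurable_prod => l _; exact: measurable_limit.
have lim0 i m w : (0 <= limits i m w)%R.
  by apply: prodr_ge0 => l _; have /andP[] := limit01 l w.
elim: n j k => [|n IHn] j k.
  rewrite addn0 big_geq// mule1; under eq_integral do rewrite /limits addn0 big_geq//.
  by rewrite integral_cst// mul1e.
rewrite (integral_count_event lambda0 pp (mA j) (Aoo j) (mD j k));
  [|exact/measurable_EFinP|by move=> w; rewrite lee_fin].
pose k' i l := if l == j then i else k l.
have kE i : \big[setI/setT]_(l < j) count_event X (A l) (k l) `&` count_event X (A j) i =
    \big[setI/setT]_(l < j.+1) count_event X (A l) (k' i l).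
  rewrite big_ord_recr /= /k' eqxx; congr (_ `&` _); apply: eq_bigr => l _.
  by rewrite ltn_eqF.
have E i : \int[P]_(w in \big[setI/setT]_(l < j) count_event X (A l) (k l) `&` count_event X (A j) i)
    (limits j n.+1 w)%:E =
  ((1 - b j) ^+ i)%:E * poisson_prob (mass j) 0 [set i] *
    (P (\big[setI/setT]_(l < j) count_event X (A l) (k l)) *
     (\prod_(j.+1 <= l < j + n.+1) expR (- (mass l * b l)))%:E).
  transitivity (\int[P]_(w in \big[setI/setT]_(l < j.+1) count_event X (A l) (k' i l))
     (((1 - b j) ^+ i)%:E * (limits j.+1 n w)%:E)).
    rewrite -kE; apply: eq_integral => w; rewrite inE => -[_ wi].
    rewrite -EFinM /limits big_ltn; last by rewrite addnS ltnS leq_addr.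
    by rewrite (limit_count wi) addSnnS.
  have /andP[bj0 bj1] := b01 j.
  rewrite ge0_integralZl//; last 3 first.
  - by apply: measurable_funTS; exact/measurable_EFinP.
  - by move=> w _; rewrite lee_fin.
  - by rewrite lee_fin exprn_ge0// subr_ge0.
  rewrite IHn -kE [X in _ * (X * _)](_ : _ = P (\big[setI/setT]_(l < j) count_event X (A l) (k l)) *
     P (count_event X (A j) i)).
    rewrite (poisson_count pp i (mA j) (Aoo j)) addSnnS -!muleA; congr (_ * _).
    by rewrite [in LHS]muleA [in LHS](muleC (P _)) -muleA.
  rewrite kE !PD big_ord_recr /= /k' eqxx; congr (_ * _); apply: eq_bigr => l _.
  by rewrite ltn_eqF.
under eq_eseriesr do rewrite E.
have /andP[bj0 bj1] := b01 j.
have Pfin : P (\big[setI/setT]_(l < j) count_event X (A l) (k l)) \is a fin_num by exact: fin_num_measure.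
rewrite -(fineK Pfin) -EFinM.
under eq_eseriesr do rewrite muleC.
rewrite nneseriesZl; last first.
  by move=> i _; rewrite mule_ge0// lee_fin exprn_ge0// subr_ge0.
rewrite nneseries_poisson_gen ?subr_ge0//.
rewrite subKr -EFinM [in RHS]big_ltn; last by rewrite addnS ltnS leq_addr.
rewrite -EFinM.
by congr (_%:E); ring.
Qed.

Lemma laplace_simple L :
  \int[P]_w (\prod_(i < m) \prod_(l < L) weight l (X i w))%:E @[m --> \oo] -->
  (expR (- \sum_(l < L) mass l * b l))%:E.
Proof.
have := integral_limits 0 L (fun=> 0%N); rewrite !big_ord0 probability_setT mul1e.
rewrite !add0n [in X in _ = X -> _]big_mkord.
rewrite -sumrN (big_morph expR (@expRD R) (@expR0 R)) => <-.
under eq_fun do under eq_integral do rewrite exchange_big.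
apply: bounded_cvg_integral => [m|m w|w].
- by apply: measurable_prod => l _; exact: measurable_total.
- apply/andP; split; first by apply: prodr_ge0 => l _; have /andP[] := total01 l m w.
  by apply: prodr_ile1 => l _; exact: total01.
- rewrite /limits add0n big_mkord.
  elim: L => [|L IHL].
    by rewrite big_ord0; under eq_fun do rewrite big_ord0; exact: cvg_cst.
  rewrite big_ord_recr; under eq_fun do rewrite big_ord_recr.
  by apply: cvgM => //; exact: cvg_total.
Qed.

End simple.
End laplace.

Section laplace_functional.
Local Open Scope ereal_scope.
Context {R : realType} {d : nat} {disp : measure_display}.
Context {Omega : measurableType disp}.
Variables (P : probability Omega R) (lambda : R) (X : nat -> Omega -> 'rV[R]_d).
Hypothesis d0 : (0 < d)%N.
Hypothesis lambda0 : (0 < lambda)%R.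
Hypothesis pp : poisson_process P lambda X.
Local Notation V := 'rV[R]_d.
Local Notation BV := (borelV R d).
Local Notation leb := (lebesgueV R d).
Variable psi : BV -> R.
Hypothesis mpsi : measurable_fun setT psi.
Hypothesis psi01 : forall x, (0 <= psi x <= 1)%R.
Hypothesis psioo : \int[leb]_x (psi x)%:E < +oo.

Let cube n : set BV := box (- const_mx n%:R : V)%R (const_mx n%:R : V).

(** Dyadic rounding down of [psi] on a bounded cube, where volumes are finite and agree with
    [lebesgueV]. The first level starts at [1 / 2 ^+ n]: smaller values of [psi] are rounded to
    0. *)
Let level n l : set BV :=
  cube n `&` psi @^-1` [set` `[(l.+1%:R / 2 ^+ n)%R, (l.+2%:R / 2 ^+ n)%R[ ].

(** The default 0 beyond [2 ^ n] keeps all heights in [[0, 1]], as required for the infinite family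
    of levels. *)
Let height n l : R := if (l < 2 ^ n)%N then (l.+1%:R / 2 ^+ n)%R else 0%R.

Let exp2_gt0 n : (0 < 2 ^+ n :> R)%R. Proof. by rewrite exprn_gt0. Qed.

Let height01 n l : (0 <= height n l <= 1)%R.
Proof.
rewrite /height; case: ifPn => [ln|_]; last by rewrite lexx ler01.
by rewrite divr_ge0 ?(ltW (exp2_gt0 n))//= ler_pdivrMr ?exp2_gt0// mul1r -natrX ler_nat.
Qed.

Let measurable_level n l : measurable (level n l).
Proof.
apply: measurableI; first exact: measurable_box.
by rewrite -[X in measurable X]setTI; apply: mpsi => //; exact: measurable_itv.
Qed.

Let trivIset_level n : trivIset setT (level n).
Proof.
move=> i j _ _ [x [[_ /=]]]; rewrite in_itv/= => /andP[i1 i2] [_ /=].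
rewrite in_itv/= => /andP[j1 j2].
have := le_lt_trans i1 j2; have := le_lt_trans j1 i2.
by rewrite !ltr_pM2r ?invr_gt0// !ltr_nat !ltnS => ji ij; apply/eqP; rewrite eqn_leq ij ji.
Qed.

Let cube_le n j : ((- const_mx n%:R : V) ord0 j <= (const_mx n%:R : V) ord0 j)%R.
Proof. by rewrite !mxE (le_trans _ (ler0n _ _))// oppr_le0. Qed.

Let volume_level n l : volume (level n l : set V) = leb (level n l).
Proof.
by apply: (volume_lebesgueV lambda0 pp d0 (measurable_level n l) (@cube_le n)) => x [].
Qed.

Let leb_level_lty n l : leb (level n l) < +oo.
Proof.
have : leb (cube n) < +oo.
  by rewrite (lebesgueV_box (@cube_le n)) ltry.
apply: le_lt_trans; apply: le_measure; [| |exact: subIsetl]; rewrite inE//.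
exact: measurable_box.
Qed.

Let approx n x : R := (\sum_(l < 2 ^ n) height n l * \1_(level n l) x)%R.

Let approxP n x : [/\ (\prod_(l < 2 ^ n) (1 - height n l * \1_(level n l) x) = 1 - approx n x)%R,
  (0 <= approx n x <= psi x)%R & cube n x -> (psi x <= approx n x + (2 ^+ n)^-1)%R].
Proof.
have [[l lx]|nolx] := pselect (exists l : 'I_(2 ^ n), level n l x).
  have other (i : 'I_(2 ^ n)) : i != l -> \1_(level n i) x = 0%R :> R.
    move=> il; rewrite indicE memNset// => ix; move/eqP: il; apply; apply: val_inj.
    by apply: (@trivIset_level n _ _ Logic.I Logic.I); exists x.
  have aE : approx n x = (l.+1%:R / 2 ^+ n)%R.
    rewrite /approx (bigD1 l)//= big1 => [|i il]; last by rewrite other// mulr0.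
    by rewrite indicE mem_set// mulr1 addr0 /height ltn_ord.
  have [_ /=] := lx; rewrite in_itv/= => /andP[l1 l2].
  split.
  - rewrite (bigD1 l)//= big1 => [|i il]; last by rewrite other// mulr0 subr0.
    by rewrite indicE mem_set// !mulr1 aE /height ltn_ord.
  - by rewrite aE l1 divr_ge0// ltW.
  - by move=> _; rewrite aE -[X in (_ + X)%R]mul1r -mulrDl natr1 ltW.
have zero (i : 'I_(2 ^ n)) : \1_(level n i) x = 0%R :> R.
  by rewrite indicE memNset// => ix; apply: nolx; exists i.
have aE : approx n x = 0%R by rewrite /approx big1// => i _; rewrite zero mulr0.
have /andP[p0 p1] := psi01 x.
split; rewrite aE.
- by rewrite big1 ?subr0// => i _; rewrite zero mulr0 subr0.
- by rewrite lexx p0.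
- move=> cx; rewrite add0r leNgt; apply/negP => px.
  have pos : (0 <= 2 ^+ n * psi x)%R by rewrite mulr_ge0// ltW.
  have one : (1 < 2 ^+ n * psi x)%R by rewrite mulrC -ltr_pdivrMr// div1r.
  have /andP[t1 t2] := truncn_itv pos.
  have tr0 : (0 < Num.truncn (2 ^+ n * psi x))%N by rewrite truncn_gt0 ltW.
  have trn : ((Num.truncn (2 ^+ n * psi x)).-1 < 2 ^ n)%N.
    rewrite prednK//; rewrite -(ler_nat R) natrX (le_trans t1)//.
    by rewrite ler_piMr// ltW.
  apply: nolx; exists (Ordinal trn); split => //=.
  rewrite in_itv/= prednK//.
  by rewrite ler_pdivrMr// ltr_pdivlMr// ![(psi x * _)%R]mulrC t1 t2.
Qed.

Let measurable_approx n : measurable_fun setT (approx n).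
Proof. by apply: measurable_sum => l; apply: measurable_funM => //; exact: measurable_indic. Qed.

Let approx_cvg x : approx ^~ x @ \oo --> psi x.
Proof.
apply/cvgrPdist_le => /= e e0.
near=> n.
have [_ /andP[a0 ap] pa] := approxP n x.
have cx : cube n x.
  move=> j; rewrite !mxE.
  have : (\max_j (Num.bound `|(x : V) ord0 j|) < n)%N by near: n; exact: nbhs_infty_gt.
  move=> /(leq_ltn_trans (leq_bigmax j)); rewrite -(ltr_nat R) => bn.
  have := lt_trans (archi_boundP (normr_ge0 ((x : V) ord0 j))) bn.
  by rewrite ltr_norml => /andP[-> /ltW->].
rewrite ger0_norm ?subr_ge0// lerBlDl (le_trans (pa cx))// lerD2l.
have : (Num.bound e^-1 <= n)%N by near: n; exact: nbhs_infty_ge.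
move=> bn; rewrite -[leRHS]invrK lef_pV2 ?posrE ?invr_gt0//.
apply: ltW; apply: lt_le_trans (archi_boundP _) _; first by rewrite invr_ge0 ltW.
rewrite -natrX ler_nat (leq_trans bn)//.
by apply: ltnW; exact: ltn_expl.
Unshelve. all: by end_near. Qed.

Let mean n : R := (\sum_(l < 2 ^ n) height n l * fine (leb (level n l)))%R.

Let integral_approx n : \int[leb]_x (approx n x)%:E = (mean n)%:E.
Proof.
under eq_integral do rewrite -sumEFin.
rewrite ge0_integral_sum//; last 2 first.
- move=> l; apply/measurable_EFinP; apply: measurable_funM => //.
- by move=> l x _; rewrite lee_fin mulr_ge0//; have /andP[] := height01 n l.
rewrite /mean -sumEFin; apply: eq_bigr => l _.
under eq_integral do rewrite EFinM.
rewrite ge0_integralZl//; last 2 first.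
- exact/measurable_EFinP/measurable_indic.
- by rewrite lee_fin; have /andP[] := height01 n l.
rewrite integral_indic// setIT EFinM fineK//.
by rewrite ge0_fin_numE// leb_level_lty.
Qed.

Let v := fine (\int[leb]_x (psi x)%:E).

Let vE : \int[leb]_x (psi x)%:E = v%:E.
Proof.
by rewrite fineK// ge0_fin_numE// integral_ge0// => x _; rewrite lee_fin; have /andP[] := psi01 x.
Qed.

Let mean_cvg : mean n @[n --> \oo] --> v.
Proof.
suff : \int[leb]_x (approx n x)%:E @[n --> \oo] --> \int[leb]_x (psi x)%:E.
  by under eq_fun do rewrite integral_approx; rewrite vE => /fine_cvg.
apply: (@dominated_cvg _ _ _ leb setT measurableT _ _ (EFin \o psi)) => //.
- by move=> n; exact/measurable_EFinP.
- by move=> x _; apply: cvg_EFin; [exact: nearW|exact: approx_cvg].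
- apply/integrableP; split; first exact/measurable_EFinP.
  rewrite (eq_integral (EFin \o psi))// => x _ /=.
  by rewrite ger0_norm//; have /andP[] := psi01 x.
- by move=> n x _; rewrite /= lee_fin ger0_norm; have [_ /andP[]] := approxP n x.
Qed.

Let mean_le n : (mean n <= v)%R.
Proof.
rewrite -lee_fin -integral_approx -vE; apply: ge0_le_integral => //.
- by move=> x _; rewrite lee_fin; have [_ /andP[]] := approxP n x.
- exact/measurable_EFinP.
- exact/measurable_EFinP.
- by move=> x _; rewrite lee_fin; have [_ /andP[]] := approxP n x.
Qed.

Let E (f : BV -> R) m := \int[P]_w (\prod_(i < m) (1 - f (X i w)))%:E.

Let approx01 n x : (0 <= 1 - approx n x <= 1)%R.
Proof. have [_ /andP[a0 ap] _] := approxP n x; have /andP[_ p1] := psi01 x; apply/andP; lra. Qed.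

Let compl01 x : (0 <= 1 - psi x <= 1)%R.
Proof. have /andP[p0 p1] := psi01 x; apply/andP; lra. Qed.

Let measurable_E (f : BV -> R) m : measurable_fun setT f ->
  measurable_fun setT (fun w => \prod_(i < m) (1 - f (X i w)) : R)%R.
Proof.
move=> mf; apply: measurable_prod => i _; apply: measurable_funB => //.
exact: (measurableT_comp mf (measurable_point pp i)).
Qed.

Let E_nonincreasing (f : BV -> R) : measurable_fun setT f -> (forall x, 0 <= 1 - f x <= 1)%R ->
  nonincreasing_seq (E f).
Proof.
move=> mf f01; apply/nonincreasing_seqP => m; apply: ge0_le_integral => //.
- by move=> w _; rewrite lee_fin; apply: prodr_ge0 => i _; have /andP[] := f01 (X i w).
- by apply/measurable_EFinP; exact: measurable_E.
- by apply/measurable_EFinP; exact: measurable_E.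
- move=> w _; rewrite lee_fin big_ord_recr /= ler_piMr//.
    by apply: prodr_ge0 => i _; have /andP[] := f01 (X i w).
  by have /andP[] := f01 (X m w).
Qed.

Let E_approx_cvg n : E (approx n) m @[m --> \oo] --> (expR (- (lambda * mean n)))%:E.
Proof.
have levoo l : volume (level n l : set V) < +oo by rewrite volume_level leb_level_lty.
have := @laplace_simple _ _ _ _ _ _ _ lambda0 pp _ _ (measurable_level n) levoo
  (@trivIset_level n) (height01 n) (2 ^ n)%N.
rewrite (_ : (\sum_(l < 2 ^ n) _)%R = lambda * mean n)%R; last first.
  by rewrite mulr_sumr; apply: eq_bigr => l _; rewrite volume_level -mulrA [X in (_ * X)%R]mulrC.
rewrite (_ : E (approx n) = fun m => \int[P]_w (\prod_(i < m) \prod_(l < 2 ^ n)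
    (1 - height n l * \1_(level n l) (X i w)))%:E)//.
apply/funext => m; apply: eq_integral => w _; congr EFin.
by apply: eq_bigr => i _; have [-> _ _] := approxP n (X i w).
Qed.

(** The limits in the number [m] of nodes and in the approximation index [n] are interchanged by two
    inequalities. At fixed [m] the expectation for [approx n] decreases in [m] to a value at least
    the target, then [n] grows; at fixed [n], [approx n <= psi] bounds the limit in [m] from
    above. *)
Lemma laplace_functional :
  \int[P]_w (\prod_(i < m) (1 - psi (X i w)))%:E @[m --> \oo] -->
  (expR (- (lambda * fine (\int[leb]_x (psi x)%:E))))%:E.
Proof.
rewrite -/v -/(E psi).
have E_ge m : (expR (- (lambda * v)))%:E <= E psi m.
  have Enm : E (approx n) m @[n --> \oo] --> E psi m.
    apply: bounded_cvg_integral => [n|n w|w].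
    - exact: measurable_E.
    - apply/andP; split; first by apply: prodr_ge0 => i _; have /andP[] := approx01 n (X i w).
      by apply: prodr_ile1 => i _; exact: approx01.
    - elim: m => [|m IHm].
        by rewrite big_ord0; under eq_fun do rewrite big_ord0; exact: cvg_cst.
      rewrite big_ord_recr; under eq_fun do rewrite big_ord_recr.
      by apply: cvgM => //; apply: cvgB; [exact: cvg_cst|exact: approx_cvg].
  rewrite -(cvg_lim _ Enm)//; apply: lime_ge; first by apply: cvgP; exact: Enm.
  apply: nearW => n; apply: (@le_trans _ _ (expR (- (lambda * mean n)))%:E).
    by rewrite lee_fin ler_expR lerN2 ler_pM2l.
  rewrite -(cvg_lim _ (@E_approx_cvg n))//.
  apply: lime_le; first by apply: cvgP; exact: E_approx_cvg.
  by exists m => // k /= mk; exact: E_nonincreasing.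
have cE : cvgn (E psi) by apply: ereal_nonincreasing_is_cvgn; exact: E_nonincreasing.
suff -> : (expR (- (lambda * v)))%:E = limn (E psi) by [].
apply/eqP; rewrite eq_le; apply/andP; split.
  by apply: lime_ge => //; exact: nearW.
have : (expR (- (lambda * mean n)))%:E @[n --> \oo] --> (expR (- (lambda * v)))%:E.
  apply: cvg_EFin; first exact: nearW.
  apply: continuous_cvg; first exact: continuous_expR.
  by apply: cvgN; apply: cvgM; [exact: cvg_cst|exact: mean_cvg].
move=> cexp; rewrite -(cvg_lim _ cexp)//; apply: lime_ge; first by apply: cvgP; exact: cexp.
apply: nearW => n; rewrite -(cvg_lim _ (@E_approx_cvg n))//.
apply: lee_lim => //; first by apply: cvgP; exact: E_approx_cvg.
apply: nearW => m; apply: ge0_le_integral => //.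
- by move=> w _; rewrite lee_fin; apply: prodr_ge0 => i _; have /andP[] := compl01 (X i w).
- by apply/measurable_EFinP; exact: measurable_E.
- by apply/measurable_EFinP; exact: measurable_E.
- move=> w _; rewrite lee_fin; apply: ler_prod => i _.
  have /andP[-> _] /= := compl01 (X i w).
  by rewrite lerD2l lerN2; have [_ /andP[]] := approxP n (X i w).
Qed.

End laplace_functional.

(** * Laws of the motions and of the nodes *)

(** If [W] has law [mu] and is independent of [U], the pair is distributed as [(U w, z)] under [P]
    times [mu]. Integrating over [Omega] keeps the law of [U] implicit. *)
Lemma joint_law d1 d2 disp (T1 : measurableType d1) (T2 : measurableType d2)
    (Omega : measurableType disp) (R : realType) (P : probability Omega R)
    (mu : {sigma_finite_measure set T2 -> \bar R}) (U : Omega -> T1) (W : Omega -> T2) :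
  measurable_fun setT U -> measurable_fun setT W ->
  (forall A B, measurable A -> measurable B ->
    P (U @^-1` A `&` W @^-1` B) = P (U @^-1` A) * mu B)%E ->
  forall E, measurable E ->
  P [set w | E (U w, W w)] = (\int[P]_w mu (xsection E (U w)))%E.
Proof.
move=> mU mW UW E mE.
have mUW : measurable_fun setT (fun w => (U w, W w)) by exact/measurable_fun_pairP.
have mUz : measurable_fun setT (fun p : Omega * T2 => (U p.1, p.2)).
  apply/measurable_fun_pairP; split; last exact: measurable_snd.
  by apply: (measurableT_comp mU); exact: measurable_fst.
have /sigma_finiteP[F [FT ndF Foo]] := sigma_finiteT mu.
transitivity (image_measure (prod_measure P mu) mUz E); last first.
  rewrite /image_measure /= /pushforward /prod_measure /product_measure1.
  apply: eq_integral => w _; congr (mu _).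
rewrite -[LHS]/(image_measure P mUW E).
apply: (measure_unique [set A `*` B | A in measurable & B in measurable]
  (fun k => setT `*` F k)) => //.
- exact: measurable_prod_measurableType.
- move=> _ _ [A mA [B mB <-]] [A' mA' [B' mB' <-]].
  exists (A `&` A'); first exact: measurableI.
  by exists (B `&` B'); [exact: measurableI|rewrite setXI].
- by move=> k; exists setT => //; exists (F k) => //; have [] := Foo k.
- by rewrite -setX_bigcupr -FT setXTT.
- move=> _ [A mA [B mB <-]]; rewrite /image_measure /= /pushforward.
  rewrite (_ : _ @^-1` _ = U @^-1` A `&` W @^-1` B)//.
  rewrite UW//; apply/esym; rewrite (_ : _ @^-1` _ = (U @^-1` A) `*` B)//.
  apply: product_measure1E => //.
  by rewrite -[X in measurable X]setTI; exact: mU.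
- move=> k; apply: (@le_lt_trans _ _ 1%E); last by rewrite ltry.
  apply: probability_le1; rewrite -[X in measurable X]setTI; apply: mUW => //.
  by apply: measurableX => //; have [] := Foo k.
Qed.

Section sigma_gen_theory.
Context {R : realType} {d : nat} (Omega : pointedType) (I : Type) (D : set I).
Variable F : I -> Omega -> 'rV[R]_d.
Local Notation BV := (borelV R d).
Local Notation gen := (g_sigma_algebraType
  (\bigcup_(i in D) preimage_set_system setT (F i) (@borel R d))).

Lemma sigma_gen_preimage disp (T : measurableType disp) (f : Omega -> T) A :
  measurable_fun [set: gen] f -> measurable A -> sigma_gen (@borel R d) D F (f @^-1` A).
Proof. by move=> mf mA; rewrite -[f @^-1` A]setTI; exact: mf. Qed.

Lemma measurable_sigma_gen i : D i -> measurable_fun [set: gen] (F i : gen -> BV).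
Proof.
move=> Di _ A mA; apply: sub_sigma_algebra; exists i => //.
by exists A.
Qed.

End sigma_gen_theory.

Lemma sigma_gen_random_vector {R : realType} {d : nat} disp (Omega : measurableType disp)
    (I : Type) (D : set I) (F : I -> Omega -> 'rV[R]_d) :
  (forall i, D i -> random_vector (F i)) ->
  sigma_gen (@borel R d) D F `<=` measurable.
Proof.
move=> mF; apply: smallest_sub; first exact: sigma_algebra_measurable.
move=> _ [i Di [A mA <-]]; rewrite setTI; exact: mF.
Qed.

Section brownian_steps.
Context {R : realType} {d : nat}.
Local Notation V := 'rV[R]_d.
Local Notation BV := (borelV R d).

Definition steps (Omega : Type) (B : R -> Omega -> V) (h : R) n (w : Omega) : n.-tuple BV :=
  [tuple (B (k.+1%:R * h) w - B (k%:R * h) w : V) : BV | k < n].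

(** The sum telescopes. The term [B 0 w] stays because the motion starts at 0 only almost surely. *)
Lemma walk_steps (Omega : Type) (B : R -> Omega -> V) (h : R) n (w : Omega) x k : (k <= n)%N ->
  walk x (steps B h n w) k = x + (B (k%:R * h) w - B 0 w).
Proof.
move=> kn; rewrite /walk; congr (_ + _).
under eq_bigr do rewrite tnth_mktuple.
rewrite -(big_mkord (fun i => i < k)%N (fun i => B (i.+1%:R * h) w - B (i%:R * h) w)).
rewrite big_mkcond (@big_cat_nat _ _ _ k)//= [X in _ + X]big1_seq ?addr0; last first.
  by move=> i; rewrite mem_index_iota => /andP[_ /andP[ki _]]; rewrite ltnNge ki.
rewrite big_nat; under eq_bigr => i /= ik do rewrite ik.
by rewrite -big_nat telescope_sumr// mul0r.
Qed.

Lemma measurable_steps_gen (Omega : pointedType) (B : R -> Omega -> V) (h : R) n : 0 <= h ->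
  measurable_fun [set: g_sigma_algebraType
    (\bigcup_(s in [set s : R | 0 <= s]) preimage_set_system setT (B s) (@borel R d))]
  (steps B h n).
Proof.
move=> h0; apply/measurable_fun_tnthP => k; apply: measurable_fun_rV => j.
rewrite (_ : (fun x => _) = (fun w => B (k.+1%:R * h) w ord0 j - B (k%:R * h) w ord0 j)); last first.
  by apply/funext => w; rewrite /= tnth_mktuple !mxE.
apply: measurable_funB; apply: (measurableT_comp (@measurable_coord R d j));
  by apply: measurable_sigma_gen; rewrite /= mulr_ge0.
Qed.

Context {disp : measure_display} {Omega : measurableType disp}.
Variables (P : probability Omega R) (B : R -> Omega -> V).
Hypothesis BM : brownian_motion P B.

Lemma measurable_steps (h : R) n : 0 <= h ->
  measurable_fun setT (steps B h n).
Proof.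
move=> h0 _ A mA; rewrite setTI.
apply: (@sigma_gen_random_vector _ _ _ Omega _ [set s : R | 0 <= s] B).
  by move=> s s0; exact: (brownian_measurable BM).
apply: sigma_gen_preimage mA; exact: measurable_steps_gen.
Qed.

Lemma brownian_increment_law (s t : R) (A : set BV) : 0 <= s -> s < t -> measurable A ->
  P [set w | A (B t w - B s w)] = gaussianV d (Num.sqrt (t - s)) A.
Proof.
move=> s0 st mA.
have t0 : 0 <= t by rewrite (le_trans s0)// ltW.
have mcoord j : measurable_fun setT (fun w => (B t w - B s w) ord0 j : measurableTypeR R).
  rewrite (_ : (fun w => _) = (fun w => B t w ord0 j - B s w ord0 j)); last first.
    by apply/funext => w; rewrite !mxE.
  by apply: measurable_funB; apply: (measurableT_comp (@measurable_coord R d j));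
    move=> _ C mC; rewrite setTI; exact: (brownian_measurable BM).
have mB : measurable_fun setT (fun w => B t w - B s w : BV).
  exact: measurable_fun_rV.
rewrite -[LHS]/(image_measure P mB A).
apply: rV_measure_unique => // C mC.
rewrite /image_measure /= /pushforward.
rewrite (_ : _ @^-1` _ = \big[setI/setT]_(j <- enum 'I_d) [set w | C j ((B t w - B s w) ord0 j)]).
  rewrite (brownian_coordinates BM s0 st) ?enum_uniq//; last first.
    move=> j _; exists (C j) => //; by rewrite setTI.
  rewrite big_enum; apply: eq_bigr => j _; exact: (brownian_gaussian BM).
rewrite -bigcap_seq; apply/seteqP; split=> w /= h j; first by move=> _; exact: h.
by apply: h; rewrite /= mem_enum.
Qed.

Lemma brownian_steps_law (h : R) n (E : set (n.-tuple BV)) : 0 < h -> measurable E ->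
  P (steps B h n @^-1` E) = walk_measure d (Num.sqrt h) n E.
Proof.
move=> h0 mE; have mst := @measurable_steps h n (ltW h0).
rewrite -[LHS]/(image_measure P mst E).
apply: tuple_measure_unique => // A mA.
rewrite /image_measure /= /pushforward.
pose D k := [set w | A k (B (k.+1%:R * h) w - B (k%:R * h) w)].
rewrite (_ : _ @^-1` _ = \big[setI/setT]_(k <- iota 0 n) D k); last first.
  rewrite -bigcap_seq; apply/seteqP; split=> w /= Aw k.
    rewrite /= mem_iota add0n => kn.
    by have := Aw (Ordinal kn); rewrite tnth_mktuple.
  by rewrite tnth_mktuple; apply: Aw; rewrite /= mem_iota add0n ltn_ord.
have := brownian_independent_increments BM (t := fun k => k%:R * h).
rewrite mul0r lexx => /(_ isT).
have ndt : {homo (fun k : nat => k%:R * h) : m k / (m <= k)%N >-> m <= k}.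
  by move=> m k mk; rewrite ler_pM2r// ler_nat.
move=> /(_ ndt) /(_ (iota 0 n) D (iota_uniq _ _)) -> => [|k _]; last first.
  by exists (A k); [exact: mA|rewrite setTI].
rewrite -[in iota 0 n](subn0 n) big_mkord; apply: eq_bigr => k _.
have kh0 : 0 <= k%:R * h by rewrite mulr_ge0// ltW.
have khlt : k%:R * h < k.+1%:R * h by rewrite ltr_pM2r// ltr_nat.
apply: (eq_trans (brownian_increment_law kh0 khlt (mA k))).
by rewrite -mulrBl -natr1 addrAC subrr add0r mul1r.
Qed.

End brownian_steps.

Section mobile_nodes_law.
Local Open Scope ereal_scope.
Context {R : realType} {d : nat} {disp : measure_display} {Omega : measurableType disp}.
Variables (P : probability Omega R) (lambda : R) (X : nat -> Omega -> 'rV[R]_d).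
Variable xi : nat -> R -> Omega -> 'rV[R]_d.
Hypothesis nodes : mobile_nodes P lambda X xi.
Variables (h : R) (K : nat).
Hypothesis h0 : (0 < h)%R.
Local Notation V := 'rV[R]_d.
Local Notation BV := (borelV R d).
Local Notation Gamma := (walk_measure d (Num.sqrt h) K).
Local Notation Z i := (steps (xi i) h K).

Let mX i : measurable_fun setT (X i : Omega -> BV).
Proof. exact: (measurable_point (nodes_poisson nodes)). Qed.

Let mZ i : measurable_fun setT (Z i).
Proof. exact: (measurable_steps (nodes_brownian nodes i) (ltW h0)). Qed.

Let mZ_gen i : measurable_fun [set: g_sigma_algebraType
  (\bigcup_(p in [set p : nat * R | (0 <= p.2)%R])
     preimage_set_system setT (xi p.1 p.2) (@borel R d))] (Z i).
Proof.
apply/measurable_fun_tnthP => k; apply: measurable_fun_rV => j.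
rewrite (_ : (fun x => _) = (fun w => xi i (k.+1%:R * h)%R w ord0 j -
    xi i (k%:R * h)%R w ord0 j)%R); last first.
  by apply/funext => w; rewrite /= tnth_mktuple !mxE.
by apply: measurable_funB; apply: (measurableT_comp (@measurable_coord R d j));
  apply: (@measurable_sigma_gen _ _ _ _ _ (fun p => xi p.1 p.2) (i, _));
  rewrite /= mulr_ge0// ltW.
Qed.

Lemma node_visit_prob (E : set (BV * K.-tuple BV)) i : measurable E ->
  P [set w | E (X i w, Z i w)] = \int[P]_w Gamma (xsection E (X i w)).
Proof.
move=> mE; apply: joint_law => // A C mA mC.
rewrite (nodes_points_motions_independent nodes); first congr (_ * _).
- exact: (brownian_steps_law (nodes_brownian nodes i)).
- by apply: sigma_gen_preimage mA; exact: measurable_sigma_gen.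
- apply: sigma_gen_preimage mC; exact: mZ_gen.
Qed.

(** Given the positions, the increments of the first [n] nodes are independent with common law
    [Gamma]. So [joint_law] applies to the vectors [Xs] and [Zs], and the section of [F] is a
    box. *)
Lemma nodes_visit_prob (E : set (BV * K.-tuple BV)) n : measurable E ->
  P [set w | forall i, (i < n)%N -> E (X i w, Z i w)] =
  \int[P]_w \prod_(i < n) Gamma (xsection E (X i w)).
Proof.
move=> mE.
pose Xs w : n.-tuple BV := [tuple X i w | i < n].
pose Zs w : n.-tuple (K.-tuple BV) := [tuple Z i w | i < n].
pose F : set (n.-tuple BV * n.-tuple (K.-tuple BV)) :=
  [set p | forall i, E (tnth p.1 i, tnth p.2 i)].
have mF : measurable F.
  rewrite (_ : F = \bigcap_(i in [set: 'I_n])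
      ((fun p : n.-tuple BV * n.-tuple (K.-tuple BV) => (tnth p.1 i, tnth p.2 i)) @^-1` E)).
    apply: fin_bigcap_measurable => // i _; rewrite -[X in measurable X]setTI.
    suff : measurable_fun setT (fun p : n.-tuple BV * n.-tuple (K.-tuple BV) =>
      (tnth p.1 i, tnth p.2 i)) by exact.
    apply/measurable_fun_pairP; split.
      by apply: (measurableT_comp (measurable_tnth _)); exact: measurable_fst.
    by apply: (measurableT_comp (measurable_tnth _)); exact: measurable_snd.
  by apply/seteqP; split=> p /= Fp i; [move=> _|]; exact: Fp.
have mXs : measurable_fun setT Xs.
  apply/measurable_fun_tnthP => i.
  by rewrite (_ : _ \o _ = X i)//; apply/funext => w; rewrite /= tnth_mktuple.
have mZs : measurable_fun setT Zs.
  apply/measurable_fun_tnthP => i.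
  by rewrite (_ : _ \o _ = Z i)//; apply/funext => w; rewrite /= tnth_mktuple.
have lawZ C : measurable C -> P (Zs @^-1` C) = tuple_measure (fun=> Gamma) n C.
  move=> mC; rewrite -[LHS]/(image_measure P mZs C).
  apply: tuple_measure_unique => // A mA.
  rewrite /image_measure /= /pushforward.
  rewrite (_ : _ @^-1` _ = \big[setI/setT]_(i <- iota 0 n) (Z i @^-1` A i)); last first.
    rewrite -bigcap_seq; apply/seteqP; split=> w /= Aw i.
      rewrite /= mem_iota add0n => ni.
      by have := Aw (Ordinal ni); rewrite tnth_mktuple.
    by rewrite tnth_mktuple; apply: Aw; rewrite /= mem_iota add0n ltn_ord.
  rewrite (nodes_motions_independent nodes) ?iota_uniq//; last first.
    move=> i _; apply: sigma_gen_preimage (mA i).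
    by apply: measurable_steps_gen; exact: ltW.
  rewrite -[in iota 0 n](subn0 n) big_mkord; apply: eq_bigr => i _.
  exact: (brownian_steps_law (nodes_brownian nodes i)).
transitivity (P [set w | F (Xs w, Zs w)]).
  congr (P _); apply/seteqP; split=> w /= Ew i; first by rewrite !tnth_mktuple; exact: Ew.
  by move=> ni; have := Ew (Ordinal ni); rewrite !tnth_mktuple.
rewrite (joint_law (mu := tuple_measure (fun=> Gamma) n) mXs mZs _ mF) => [|A C mA mC].
  apply: eq_integral => w _.
  rewrite (_ : xsection F (Xs w) =
      tbox n (fun i => xsection E (X i w))).
    by rewrite tuple_measure_tbox// => i _; exact: measurable_xsection.
  apply/seteqP; split=> z; rewrite /xsection /tbox /= inE /= => Ez i.
    by have := Ez i; rewrite tnth_mktuple inE.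
  by have := Ez i; rewrite tnth_mktuple inE.
rewrite (nodes_points_motions_independent nodes) ?lawZ//.
- apply: sigma_gen_preimage mA; apply/measurable_fun_tnthP => i.
  rewrite (_ : _ \o _ = X i); last by apply/funext => w; rewrite /= tnth_mktuple.
  exact: measurable_sigma_gen.
- apply: sigma_gen_preimage mC; apply/measurable_fun_tnthP => i.
  rewrite (_ : _ \o _ = Z i); last by apply/funext => w; rewrite /= tnth_mktuple.
  exact: mZ_gen.
Qed.

End mobile_nodes_law.

Lemma measure_preimage_finType (R : realType) disp (T : measurableType disp) (C : finType)
    (mu : {measure set T -> \bar R}) (f : T -> C) (Q : pred C) :
  (forall c, measurable (f @^-1` [set c])) ->
  mu [set p | Q (f p)] = (\sum_(c | Q c) mu (f @^-1` [set c]))%E.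
Proof.
move=> mf; rewrite (_ : [set p | Q (f p)] = \bigcup_(c in [set` enum Q]) f @^-1` [set c]); last first.
  apply/seteqP; split=> [p Qp|p [c /=]]; first by exists (f p); rewrite //= mem_enum.
  by rewrite mem_enum => Qc ->.
rewrite measure_fin_bigcup//; last by move=> c c' _ _ [p [/= <- <-]].
by rewrite -fsbig_seq ?enum_uniq// big_enum.
Qed.

Section patterns.
Context {R : realType} {disp : measure_display} {T : measurableType disp} {C : finType}.
Variable V : C -> set T.
Hypothesis mV : forall c, measurable (V c).

Definition pattern (p : T) : {set C} := [set c | `[< V c p >]]%SET.

Lemma in_pattern c p : (c \in pattern p) = `[< V c p >].
Proof. by rewrite inE. Qed.

Lemma measurable_pattern (A : {set C}) : measurable (pattern @^-1` [set A]).
Proof.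
rewrite (_ : _ @^-1` _ = \bigcap_(c in [set: C]) (if c \in A then V c else ~` V c)).
  apply: fin_bigcap_measurable => // c _; case: ifP => // _; exact: measurableC.
apply/seteqP; split=> [p <- c _|p Vp]; first by rewrite in_pattern; case: asboolP.
apply/setP => c; rewrite in_pattern; have := Vp c Logic.I.
by case: (c \in A) => [|nV]; [move/asboolP|apply/asboolP].
Qed.

(** Each probability is split according to the set [A] of events that occur; the signs over the
    subsets of [A] cancel unless [A] is empty. *)
Lemma inclusion_exclusion (P : probability T R) :
  fine (P [set w | forall c, ~ V c w]) =
  \sum_(S : {set C}) (-1) ^+ #|S| * fine (P [set w | forall c, c \in S -> V c w]).
Proof.
have mp := measurable_pattern.
have PS (S : {set C}) : fine (P [set w | forall c, c \in S -> V c w]) =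
    \sum_(A : {set C} | S \subset A) fine (P (pattern @^-1` [set A])).
  rewrite sum_fine => [|A _]; last exact: fin_num_measure.
  rewrite -(@measure_preimage_finType _ _ _ _ P pattern (fun A : {set C} => S \subset A))//; congr (fine (P _)).
  apply/seteqP; split=> w /= Sw.
    by apply/fintype.subsetP => c cS; rewrite in_pattern; apply/asboolP; exact: Sw.
  by move=> c cS; have /fintype.subsetP/(_ c cS) := Sw; rewrite in_pattern => /asboolP.
under eq_bigr do rewrite PS mulr_sumr big_mkcond.
rewrite exchange_big (bigD1 finset.set0)//= [X in _ + X]big1 ?addr0 => [|A A0].
  rewrite (bigD1 finset.set0)//= finset.sub0set finset.cards0 expr0 mul1r.
  rewrite big1 ?addr0 => [|S S0]; last by rewrite finset.subset0 (negbTE S0).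
  congr (fine (P _)); apply/seteqP; split=> w /= Vw.
    by apply/setP => c; rewrite in_pattern finset.in_set0; apply/asboolP.
  by move=> c /asboolP; rewrite -in_pattern Vw finset.in_set0.
rewrite -big_mkcond -mulr_suml.
by rewrite (@alternating_sum_eq0 R C A) (negbTE A0) mul0r.
Qed.

End patterns.

Section hit_volume.
Local Open Scope ereal_scope.
Context {R : realType} {d : nat}.
Local Notation V := 'rV[R]_d.
Local Notation BV := (borelV R d).

Lemma lebesgueV_ball_lty (r : R) : lebesgueV R d [set x | enorm (x : V) <= r]%R < +oo.
Proof.
(* The margin 1 makes the left inequality of the half-open box strict, and the maximum with 0 orders
   its corners also when [r] is negative. *)
pose b : V := const_mx (Num.max r 0 + 1)%R.
have m0 : (0 <= Num.max r 0)%R by rewrite le_max lexx orbT.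
have bb j : ((- b) ord0 j <= b ord0 j)%R by rewrite !mxE; lra.
have mball : measurable ([set x : BV | enorm (x : V) <= r]%R : set BV).
  have := measurable_cball (0%R : V) r; congr measurable.
  by apply/seteqP; split=> x /=; rewrite sub0r enormN.
apply: (@le_lt_trans _ _ (lebesgueV R d (box (- b)%R b))); last first.
  by rewrite (lebesgueV_box bb) ltry.
apply: le_measure; [by rewrite inE|rewrite inE; exact: measurable_box|].
move=> x /= xr j; rewrite !mxE.
suff : (`|(x : V) ord0 j| <= Num.max r 0)%R by rewrite ler_norml => /andP[? ?]; apply/andP; split; lra.
rewrite le_max; apply/orP; left; apply: le_trans xr.
rewrite -sqrtr_sqr ler_sqrt; last by apply: sumr_ge0 => i _; exact: sqr_ge0.
by rewrite (bigD1 j)//= lerDl sumr_ge0// => i _; exact: sqr_ge0.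
Qed.

(** With the order of integration exchanged, the starting points for fixed increments form a
    translate of the ball, and the increments have total mass 1. *)
Lemma node_measure_hit (s : R) n (g : V) (r : R) k :
  node_measure d s n (hit g r k) = lebesgueV R d [set x | enorm (x : V) <= r]%R.
Proof.
have mball := measurable_cball (0%R : V) r.
transitivity ((lebesgueV R d \x^ walk_measure d s n) (hit g r k)).
  apply: (@product_measure_unique _ _ _ _ R (lebesgueV R d) (walk_measure d s n)).
    by move=> A B mA mB; exact: product_measure2E.
  exact: measurable_hit.
rewrite /product_measure2.
transitivity (\int[walk_measure d s n]_u cst (lebesgueV R d [set x | enorm (x : V) <= r]%R) u).
  apply: eq_integral => u _ /=.
  have := lebesgueV_translation (walk 0 u k - g)%R mball.
  have -> : [set x : BV | enorm (0 - (x : V)) <= r]%R = [set x : BV | enorm (x : V) <= r]%R.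
    by apply/seteqP; split=> x /=; rewrite sub0r enormN.
  move=> <-; congr (lebesgueV R d _).
  have shift (x : V) : enorm (g - walk x u k)%R = enorm (x + (walk 0 u k - g))%R.
    by rewrite -enormN opprB /walk add0r addrA.
  by apply/seteqP; split=> x; rewrite /ysection /hit /= inE /= shift.
rewrite integral_cst//; transitivity (lebesgueV R d [set x | enorm (x : V) <= r]%R * 1).
  by congr (_ * _); exact: walk_measure_setT.
by rewrite mule1.
Qed.

Lemma node_measure_hits_lty (s : R) n (S : {set 'I_n}) (g : 'I_n -> V) (r : R) :
  node_measure d s n (\bigcup_(k in [set` S]) hit (g k) r k.+1) < +oo.
Proof.
have mh (k : 'I_n) : measurable (@hit R d n (g k) r k.+1) by exact: measurable_hit.
pose F (i : nat) : set (BV * n.-tuple BV) :=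
  if insub i : option 'I_n is Some k then (if k \in S then hit (g k) r k.+1 else set0) else set0.
apply: (@le_lt_trans _ _ (\sum_(i < n) node_measure d s n (F i))).
  apply: content_subadditive.
  - by move=> i _; rewrite /F; case: insub => // k; case: ifP.
  - by apply: fin_bigcup_measurable.
  - move=> p [k /= kS kp]; rewrite -bigcup_mkord; exists k => //=.
    by rewrite /F valK kS.
apply: lte_sum_pinfty => i _; rewrite /F; case: insub => [k|]; last by rewrite measure0 ltry.
case: ifP => _; last by rewrite measure0 ltry.
by rewrite node_measure_hit lebesgueV_ball_lty.
Qed.

End hit_volume.

(** * Covering at finitely many times *)

Section covering.
Local Open Scope ereal_scope.
Context {R : realType} {d : nat} {disp : measure_display} {Omega : measurableType disp}.
Variables (P : probability Omega R) (lambda : R) (X : nat -> Omega -> 'rV[R]_d).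
Variable xi : nat -> R -> Omega -> 'rV[R]_d.
Hypothesis d0 : (0 < d)%N.
Hypothesis lambda0 : (0 < lambda)%R.
Hypothesis nodes : mobile_nodes P lambda X xi.
Variables (h : R) (K : nat).
Hypothesis h0 : (0 < h)%R.
Local Notation V := 'rV[R]_d.
Local Notation BV := (borelV R d).
Local Notation Gamma := (walk_measure d (Num.sqrt h) K).
Local Notation M := (node_measure d (Num.sqrt h) K).
Local Notation Z i := (steps (xi i) h K).

Let mX i : measurable_fun setT (X i : Omega -> BV).
Proof. exact: (measurable_point (nodes_poisson nodes)). Qed.

Let mZ i : measurable_fun setT (Z i).
Proof. exact: (measurable_steps (nodes_brownian nodes i) (ltW h0)). Qed.

Lemma measurable_node_event (E : set (BV * K.-tuple BV)) i : measurable E ->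
  measurable [set w | E (X i w, Z i w)].
Proof.
move=> mE; have mXZ : measurable_fun setT (fun w => (X i w : BV, Z i w)).
  by apply/measurable_fun_pairP; split; [exact: mX|exact: mZ].
by rewrite -[mkset _]setTI; exact: mXZ.
Qed.

Lemma measurable_avoid (E : set (BV * K.-tuple BV)) : measurable E ->
  measurable [set w | forall i, ~ E (X i w, Z i w)].
Proof.
move=> mE; rewrite (_ : mkset _ = \bigcap_i ~` [set w | E (X i w, Z i w)]).
  by apply: bigcapT_measurable => i; apply: measurableC; exact: measurable_node_event.
by apply/seteqP; split=> w /= Aw i; [move=> _|]; exact: Aw.
Qed.

(** Given its position [x], a node avoids [E] with probability [1 - psi x], where [psi x] is the
    mass of the section of [E]. The Laplace functional of the positions then yields the void
    probability of the marked process, since [psi] integrates to [M E]. *)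
Lemma avoid_prob (E : set (BV * K.-tuple BV)) : measurable E -> M E < +oo ->
  P [set w | forall i, ~ E (X i w, Z i w)] = (expR (- (lambda * fine (M E))))%:E.
Proof.
move=> mE Eoo.
pose psi x := fine (Gamma (xsection E x)).
have mx x : measurable (xsection E x) by exact: measurable_xsection.
have Gle1 x : Gamma (xsection E x) <= 1 by exact: walk_measure_le1 (mx x).
have Gfin x : Gamma (xsection E x) \is a fin_num.
  by rewrite ge0_fin_numE// (le_lt_trans (Gle1 x))// ltry.
have GC B : measurable B -> Gamma (~` B) = 1 - Gamma B.
  move=> mB; have G1 := walk_measure_setT d (Num.sqrt h) K.
  have Goo : Gamma setT < +oo by rewrite [X in X < _]G1 ltry.
  by rewrite -setTD; apply: (eq_trans (measureD measurableT mB Goo)); rewrite setTI [X in X - _]G1.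
have psiE x : (psi x)%:E = Gamma (xsection E x) by rewrite fineK.
have psi01 x : (0 <= psi x <= 1)%R.
  by rewrite fine_ge0//= -lee_fin psiE.
have mpsi : measurable_fun setT psi.
  apply/measurable_EFinP; rewrite (_ : _ \o _ = Gamma \o xsection E).
    exact: measurable_fun_xsection.
  by apply/funext => x; rewrite /= psiE.
have intpsi : \int[lebesgueV R d]_x (psi x)%:E = M E.
  by apply: eq_integral => x _; rewrite psiE.
have := laplace_functional d0 lambda0 (nodes_poisson nodes) mpsi psi01.
rewrite intpsi => /(_ Eoo) cvg_exp.
pose A n := [set w | forall i, (i < n)%N -> (~` E) (X i w, Z i w)].
have mA n : measurable (A n).
  rewrite (_ : A n = \bigcap_(i in `I_n) [set w | (~` E) (X i w, Z i w)]).
    by apply: bigcap_measurableType => i _; apply: measurable_node_event; exact: measurableC.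
  by apply/seteqP; split=> w Aw i; [move=> ni|]; exact: Aw.
have PA n : P (A n) = \int[P]_w (\prod_(i < n) (1 - psi (X i w)))%:E.
  rewrite (nodes_visit_prob nodes h0 n (measurableC mE)).
  apply: eq_integral => w _; rewrite -prodEFin; apply: eq_bigr => i _.
  rewrite (_ : xsection (~` E) (X i w) = ~` xsection E (X i w)); last first.
    by apply/seteqP; split=> z; rewrite /xsection /= !inE.
  by rewrite EFinB psiE GC.
have cvgA : P (A n) @[n --> \oo] --> P (\bigcap_n A n).
  apply: nonincreasing_cvg_mu => //.
  - by rewrite (le_lt_trans (probability_le1 _ (mA _)))// ltry.
  - exact: bigcapT_measurable.
  - by apply/nonincreasing_seqP => n; apply/subsetPset => w Aw i ni; apply: Aw; exact: ltnW.
have -> : [set w | forall i, ~ E (X i w, Z i w)] = \bigcap_n A n.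
  apply/seteqP; split=> w /= Aw; first by move=> n _ i _; exact: Aw.
  by move=> i; have := Aw i.+1 Logic.I i (ltnSn i).
move: cvgA; under eq_fun do rewrite PA.
by move=> cvgA; exact: (cvg_unique _ cvgA cvg_exp).
Qed.

Section pattern_weights.
Variables (g : 'I_K -> V) (r : R).

Definition covered : set Omega :=
  [set w | forall k : 'I_K, exists i, hit (g k) r k.+1 (X i w, Z i w)].

Let mhit (k : 'I_K) : measurable (@hit R d K (g k) r k.+1).
Proof. exact: measurable_hit. Qed.

(** For empty [A] the measure is infinite and [fine] returns its default 0; the identities below
    concern families of nonempty sets, on which the measure is finite. *)
Definition visit_weight (A : {set 'I_K}) : R :=
  (lambda * fine (M (pattern (fun k : 'I_K => hit (g k) r k.+1) @^-1` [set A])))%R.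

Lemma visit_weight_ge0 A : (0 <= visit_weight A)%R.
Proof. by rewrite mulr_ge0 ?fine_ge0// ltW. Qed.

Let pattern_fin A : A != finset.set0 ->
  M (pattern (fun k : 'I_K => hit (g k) r k.+1) @^-1` [set A]) \is a fin_num.
Proof.
move=> /finset.set0Pn[k kA]; rewrite ge0_fin_numE//.
apply: (@le_lt_trans _ _ (M (hit (g k) r k.+1))); last by rewrite node_measure_hit lebesgueV_ball_lty.
apply: le_measure; rewrite ?inE//; first exact: measurable_pattern.
by move=> p /= pA; move: kA; rewrite -pA in_pattern => /asboolP.
Qed.

Let sum_weight (Q : pred {set 'I_K}) : (forall A, Q A -> A != finset.set0) ->
  (\sum_(A | Q A) visit_weight A)%R =
  (lambda * fine (M [set p | Q (pattern (fun k : 'I_K => hit (g k) r k.+1) p)]))%R.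
Proof.
move=> Q0; rewrite -mulr_sumr; congr (_ * _)%R.
rewrite (@measure_preimage_finType _ _ _ _ _ _ Q) => [|A]; last exact: measurable_pattern.
by rewrite sum_fine// => A QA; apply: pattern_fin; exact: Q0.
Qed.

Lemma sum_visit_weight (U : {set 'I_K}) : U != finset.set0 ->
  (\sum_(A : {set 'I_K} | U \subset A) visit_weight A)%R =
  (lambda * fine (M (\bigcap_(k in [set` U]) hit (g k) r k.+1)))%R.
Proof.
move=> U0; rewrite sum_weight => [|A UA]; last first.
  by apply: contra_neq U0 => A0; apply/eqP; rewrite -finset.subset0 -A0.
congr (_ * fine (M _))%R; apply/seteqP; split=> p /= Up.
  move=> k kU; have /fintype.subsetP/(_ k kU) := Up; rewrite in_pattern.
  by move/asboolP.
by apply/fintype.subsetP => k kU; rewrite in_pattern; apply/asboolP; exact: Up.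
Qed.

Lemma hitting_mass_visit_weight (S : {set 'I_K}) :
  hitting_mass visit_weight S =
  (lambda * fine (M (\bigcup_(k in [set` S]) hit (g k) r k.+1)))%R.
Proof.
rewrite /hitting_mass sum_weight => [|A]; last first.
  by apply: contra_neq => ->; rewrite finset.set0I.
congr (_ * fine (M _))%R; apply/seteqP; split=> p /=.
  move=> /finset.set0Pn[k]; rewrite finset.in_setI in_pattern => /andP[/asboolP kp kS].
  by exists k.
move=> [k kS kp]; apply/finset.set0Pn; exists k.
by rewrite finset.in_setI in_pattern kS andbT; apply/asboolP.
Qed.

Lemma measurable_covered : measurable covered.
Proof.
rewrite (_ : covered = \bigcap_(k in [set: 'I_K]) ~` [set w | forall i, ~ hit (g k) r k.+1 (X i w, Z i w)]).
  apply: fin_bigcap_measurable => // k _; apply: measurableC.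
  exact: measurable_avoid.
apply/seteqP; split=> w /= Cw k; first by move=> _ nh; have [i] := Cw k; exact: nh.
by have /existsNP[i /contrapT] := Cw k Logic.I; exists i.
Qed.

(** Inclusion-exclusion over the vacant times: all times of [S] are vacant exactly when every node
    avoids the union of the hits over [S], an event of known probability. *)
Lemma covered_prob : fine (P covered) = cover_prob visit_weight.
Proof.
pose W (k : 'I_K) := [set w | forall i, ~ hit (g k) r k.+1 (X i w, Z i w)].
have -> : covered = [set w | forall k, ~ W k w].
  apply/seteqP; split=> w Cw k; first by move=> nh; have [i] := Cw k; exact: nh.
  by have /existsNP[i /contrapT] := Cw k; exists i.
rewrite inclusion_exclusion => [|k]; last exact: measurable_avoid.
apply: eq_bigr => S _; congr (_ * _)%R; rewrite hitting_mass_visit_weight.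
have mU : measurable (\bigcup_(k in [set` S]) @hit R d K (g k) r k.+1).
  by apply: fin_bigcup_measurable => // k _; exact: mhit.
have := avoid_prob mU (node_measure_hits_lty _ S g r).
have -> : [set w | forall k, k \in S -> W k w] = [set w | forall i,
    ~ (\bigcup_(k in [set` S]) hit (g k) r k.+1) (X i w, Z i w)].
  apply/seteqP; split=> w /= Ww; first by move=> i [k /= kS]; exact: (Ww k kS i).
  by move=> k kS i hk; apply: (Ww i); exists k.
by move=> ->.
Qed.

End pattern_weights.

Lemma covered_prob_le (g : 'I_K -> V) (r : R) :
  P (covered g r) <= P (covered (fun=> 0%R) r).
Proof.
have pf (g' : 'I_K -> V) : P (covered g' r) \is a fin_num.
  by apply: fin_num_measure; exact: measurable_covered.
rewrite -(fineK (pf g)) -(fineK (pf (fun=> 0%R))) lee_fin !covered_prob.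
apply: cover_prob_le => [A _|A _|U U0]; [exact: visit_weight_ge0|exact: visit_weight_ge0|].
rewrite [leLHS](sum_visit_weight g r U0) [leRHS](sum_visit_weight (fun=> 0%R) r U0).
apply: ler_wpM2l; first exact: ltW.
have [k kU] : exists k, k \in U by apply/finset.set0Pn.
have fin (g' : 'I_K -> V) : M (\bigcap_(k in [set` U]) hit (g' k) r k.+1) \is a fin_num.
  rewrite ge0_fin_numE//; apply: (@le_lt_trans _ _ (M (hit (g' k) r k.+1)));
    last by rewrite node_measure_hit lebesgueV_ball_lty.
  apply: le_measure; rewrite ?inE//; [|exact: measurable_hit|by move=> p; apply].
  by apply: fin_bigcap_measurable => // l _; exact: measurable_hit.
apply: fine_le; [exact: fin|exact: (fin (fun=> 0%R))|].
by apply: node_measure_hit_le; rewrite gt_eqF// sqrtr_gt0.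
Qed.

End covering.

(** * From dyadic times to all times *)

Section finitely_many_visitors.
Local Open Scope ereal_scope.
Context {R : realType} {d : nat} {disp : measure_display} {Omega : measurableType disp}.
Variables (P : probability Omega R) (lambda : R) (X : nat -> Omega -> 'rV[R]_d).
Variable xi : nat -> R -> Omega -> 'rV[R]_d.
Hypothesis d0 : (0 < d)%N.
Hypothesis lambda0 : (0 < lambda)%R.
Hypothesis nodes : mobile_nodes P lambda X xi.
Local Notation V := 'rV[R]_d.
Local Notation BV := (borelV R d).

Lemma campbell (f : BV -> \bar R) : measurable_fun setT f -> (forall x, 0 <= f x) ->
  \sum_(i <oo) \int[P]_w f (X i w) = lambda%:E * \int[lebesgueV R d]_x f x.
Proof.
move=> mf f0; have pp := nodes_poisson nodes.
pose m : {measure set BV -> \bar R} := mscale (NngNum (ltW lambda0)) (lebesgueV R d).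
transitivity (\int[intensity pp]_x f x).
  rewrite ge0_integral_measure_series//; apply: eq_eseriesr => i _.
  by apply/esym; apply: integral_image_measure.
transitivity (\int[m]_x f x); last by rewrite ge0_integral_mscale.
apply: eq_measure_integral => A mA _; exact: (intensityE lambda0 pp d0 mA).
Qed.

Let visits (r : R) K : set (BV * K.-tuple BV) := \bigcup_(k in `I_K.+1) hit 0%R r k.

Let measurable_visits r K : measurable (@visits r K).
Proof. by apply: bigcup_measurable => k _; exact: measurable_hit. Qed.

(** Given its start, a node visits with at most twice the probability of ending within [r + c]; by
    Campbell's formula and translation invariance the sum over nodes is a multiple of the volume of
    a ball. The bound involves neither [h] nor [K], hence survives refinement of the grid. *)
Lemma visitors_le (h : R) K (r c : R) : (0 < h)%R ->
  (2^-1)%:E <= walk_measure d (Num.sqrt h) K [set u | enorm (walk 0 u K) <= c]%R ->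
  \sum_(i <oo) P [set w | @visits r K (X i w, steps (xi i) h K w)] <=
  2%:E * (lambda%:E * lebesgueV R d [set x | enorm (x : V) <= r + c]%R).
Proof.
move=> h0 half.
have s0 : Num.sqrt h != 0%R by rewrite gt_eqF// sqrtr_gt0.
pose f x := 2%:E * walk_measure d (Num.sqrt h) K (xsection (hit 0%R (r + c)%R K) x).
have f0 x : 0 <= f x by rewrite mule_ge0.
have mf : measurable_fun setT f.
  apply: measurable_funeM.
  exact: (measurable_fun_xsection (walk_measure d (Num.sqrt h) K) (@measurable_hit R d K 0%R (r + c)%R K)).
have fE : \int[lebesgueV R d]_x f x = 2%:E * lebesgueV R d [set x | enorm (x : V) <= r + c]%R.
  rewrite -(node_measure_hit (Num.sqrt h) K 0%R (r + c)%R K).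
  apply: ge0_integralZl => //.
  exact: (measurable_fun_xsection (walk_measure d (Num.sqrt h) K) (@measurable_hit R d K 0%R (r + c)%R K)).
rewrite muleCA -fE -campbell//.
apply: lee_nneseries => [i _ _|i _]; first exact: measure_ge0.
rewrite (node_visit_prob nodes h0 i (@measurable_visits r K)).
apply: ge0_le_integral => //.
- exact: (measurableT_comp (measurable_fun_xsection (walk_measure d (Num.sqrt h) K)
    (@measurable_visits r K)) (measurable_point (nodes_poisson nodes) i)).
- exact: (measurableT_comp mf (measurable_point (nodes_poisson nodes) i)).
move=> w _; have := walk_measure_maximal r s0 half (X i w).
have -> : \bigcup_(k in `I_K.+1) [set u : K.-tuple BV | enorm (walk (X i w) u k) <= r]%R =
    xsection (@visits r K) (X i w).
  by apply/seteqP; split=> u; rewrite /xsection /visits /= inE => -[k kK uk];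
    exists k => //; move: uk; rewrite /hit /= sub0r enormN.
have -> : [set u : K.-tuple BV | enorm (walk (X i w) u K) <= r + c]%R =
    xsection (hit 0%R (r + c)%R K) (X i w).
  by apply/seteqP; split=> u; rewrite /xsection /hit /= inE /= sub0r enormN.
exact.
Qed.

Variable T : R.
Hypothesis T0 : (0 < T)%R.

(** One [c] serves every mesh because the sum of all increments is always distributed as the
    displacement over [[0, T]]. *)
Lemma walk_measure_tight : exists c : R, forall h K, (0 < h)%R -> (K%:R * h = T)%R ->
  (2^-1)%:E <= walk_measure d (Num.sqrt h) K [set u | enorm (walk 0 u K) <= c]%R.
Proof.
have BM := nodes_brownian nodes 0%N.
pose F (n : nat) := [set w | enorm (xi 0%N T w - xi 0%N 0%R w) <= n%:R]%R.
have mF n : measurable (F n).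
  have mst := measurable_steps BM (n := 1) (ltW T0).
  have := mst measurableT _ (measurable_walk_ball (0%R : V) n%:R 1).
  rewrite setTI; congr measurable; apply/seteqP; split=> w;
    by rewrite /F /= walk_steps// mul1r add0r.
have cvgF : P (F n) @[n --> \oo] --> P (\bigcup_n F n).
  apply: nondecreasing_cvg_mu => //; first exact: bigcupT_measurable.
  move=> m n mn; apply/subsetPset => w /= wm; apply: (le_trans wm).
  by rewrite ler_nat.
have FT : \bigcup_n F n = setT.
  apply/seteqP; split=> // w _.
  exists (Num.bound (enorm (xi 0%N T w - xi 0%N 0%R w))%R) => //.
  by apply: ltW; rewrite /F /=; apply: archi_boundP; exact: enorm_ge0.
rewrite FT probability_setT in cvgF.
have [n Fn] : exists n, (2^-1)%:E <= P (F n).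
  apply/not_existsP => noF; have : (1 : \bar R) <= (2^-1)%:E.
    rewrite -[leLHS](cvg_lim _ cvgF)//; apply: lime_le; first by apply: cvgP; exact: cvgF.
    by apply: nearW => n; apply: ltW; rewrite ltNge; apply/negP/noF.
  by rewrite lee_fin; lra.
exists n%:R => h K h0 Kh; apply: (le_trans Fn).
rewrite -(brownian_steps_law BM h0); last exact: measurable_walk_ball.
apply: le_measure; rewrite ?inE//.
  have := measurable_steps BM (n := K) (ltW h0) measurableT (measurable_walk_ball (0%R : V) n%:R K).
  by rewrite setTI.
by move=> w /=; rewrite walk_steps// Kh add0r.
Qed.


(** The events that node [i] visits on the grid of mesh [T / 2 ^+ n] increase with [n], and their
    sum over [i] is bounded uniformly in [n]. The unions over [n] thus have summable
    probabilities. *)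
Lemma finitely_many_visitors (r : R) : {ae P, forall w, exists N, forall i, (N <= i)%N ->
  forall n k, (k <= 2 ^ n)%N ->
  (r < enorm (X i w + (xi i (k%:R * (T / 2 ^+ n)) w - xi i 0 w)))%R}.
Proof.
have [c half] := walk_measure_tight.
have step0 n : (0 < T / 2 ^+ n)%R by rewrite divr_gt0// exprn_gt0.
have stepT n : ((2 ^ n)%:R * (T / 2 ^+ n) = T)%R.
  by rewrite natrX mulrCA divff ?mulr1// expf_neq0.
pose V_ i n := [set w | exists2 k, (k <= 2 ^ n)%N &
  (enorm (X i w + (xi i (k%:R * (T / 2 ^+ n)) w - xi i 0 w)) <= r)%R].
have VE i n : V_ i n = [set w | @visits r (2 ^ n)
    (X i w, steps (xi i) (T / 2 ^+ n)%R (2 ^ n) w)].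
  apply/seteqP; split=> w /= [k kn wk]; exists k => //; move: wk;
    by rewrite /hit /= walk_steps// sub0r enormN.
have mV i n : measurable (V_ i n).
  rewrite VE; exact: (measurable_node_event nodes (step0 n) i (@measurable_visits r (2 ^ n))).
have ndV i : {homo V_ i : m n / (m <= n)%N >-> (m <= n)%O}.
  apply/nondecreasing_seqP => n; apply/subsetPset => w [k kn wk].
  exists (2 * k)%N; first by rewrite expnS leq_mul2l kn orbT.
  suff -> : ((2 * k)%:R * (T / 2 ^+ n.+1) = k%:R * (T / 2 ^+ n))%R by [].
  rewrite natrM exprS; have := gt_eqF (exprn_gt0 n (ltr0n R 2)).
  by move=> /negbT; move: (2 ^+ n)%R => p p0; field.
have mW i : measurable (\bigcup_n V_ i n) by exact: bigcupT_measurable.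
have PW i : P (V_ i n) @[n --> \oo] --> P (\bigcup_n V_ i n).
  exact: nondecreasing_cvg_mu.
have sumW : \sum_(i <oo) P (\bigcup_n V_ i n) <=
    2%:E * (lambda%:E * lebesgueV R d [set x | enorm (x : V) <= r + c]%R).
  apply: lime_le; first by apply: is_cvg_nneseries => i _ _; exact: measure_ge0.
  apply: nearW => m /=.
  (* The limit in [n] is taken inside a finite sum over the nodes; the number [m] of nodes grows
     only afterwards. *)
  have cvgm : \sum_(0 <= i < m) P (V_ i n) @[n --> \oo] -->
      \sum_(0 <= i < m) P (\bigcup_n V_ i n).
    by apply: cvg_nnesum => i _; [apply: nearW => n; exact: measure_ge0|exact: PW].
  rewrite -(cvg_lim _ cvgm)//; apply: lime_le; first by apply: cvgP; exact: cvgm.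
  apply: nearW => n; apply: le_trans (visitors_le r (step0 n) (half _ _ (step0 n) (stepT n))).
  under eq_bigr do rewrite VE.
  by apply: nneseries_lim_ge => i _ _; exact: measure_ge0.
have sumoo : \sum_(i <oo) P (\bigcup_n V_ i n) < +oo.
  apply: le_lt_trans sumW _; rewrite lte_mul_pinfty//.
  by rewrite lte_mul_pinfty// ?lee_fin ?(ltW lambda0)// lebesgueV_ball_lty.
have limsup0 := lim_sup_set_cvg0 mW sumoo.
exists (lim_sup_set (fun i => \bigcup_n V_ i n)); split => //.
  by apply: bigcapT_measurable => n; apply: bigcup_measurable => k _.
move=> w /= nofin N _; apply: contrapT => noW; apply: nofin; exists N => i Ni n k kn.
rewrite ltNge; apply/negP => ik; apply: noW; exists i => //.
by exists n => //; exists k.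
Qed.

End finitely_many_visitors.

Section covering_times.
Context {R : realType} {d : nat}.
Local Notation V := 'rV[R]_d.

Lemma continuous_enorm : continuous (@enorm R d).
Proof.
move=> x; apply: continuous_comp; last exact: sqrt_continuous.
apply: continuous_big => [|j _ {}x]; first exact: add_continuous.
apply: (@continuous_comp _ _ _ (fun x : V => x ord0 j) (fun y : R => y ^+ 2)).
  exact: coord_continuous.
exact: exprn_continuous.
Qed.

(* Finitely many paths meet the ball at dyadic times, so if all of them avoided
   it at [s], then by continuity they would avoid it at a dyadic time near [s]. *)
Lemma dyadic_covering (x : nat -> V) (y : nat -> R -> V) (T r : R) : 0 < T ->
  (forall i, {within [set s | 0 <= s], continuous (y i)}) ->
  (exists N, forall i, (N <= i)%N -> forall n k, (k <= 2 ^ n)%N ->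
    r < enorm (x i + y i (k%:R * (T / 2 ^+ n)))) ->
  (forall n k, (k < 2 ^ n)%N -> exists i, enorm (x i + y i (k.+1%:R * (T / 2 ^+ n))) <= r) ->
  forall s, 0 <= s <= T -> exists i, enorm (x i + y i s) <= r.
Proof.
move=> T0 cy [N finN] cov s /andP[s0 sT]; apply: contrapT => /forallNP nocov.
have {}nocov i : r < enorm (x i + y i s) by rewrite ltNge; apply/negP.
have near_s : \forall u \near within [set s | 0 <= s] (nbhs s),
    forall i : 'I_N, r < enorm (x i + y i u).
  (* Only the nodes of index below [N] matter: finitely many strict inequalities hold on a common
     neighborhood of [s] within the nonnegative times. *)
  apply: filter_forall => i.
  have /subspace_continuousP/(_ s s0) cys := cy i.
  have cf : enorm (x i + y i u) @[u --> within [set s | 0 <= s] (nbhs s)] -->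
      enorm (x i + y i s).
    apply: (@continuous_cvg _ _ _ _ _ (fun u => x i + y i u) (@enorm R d)).
      exact: continuous_enorm.
    by apply: cvgD => //; exact: cvg_cst.
  have := @cvgr_gt _ _ _ _ _ _ cf _ (nocov i); exact.
have [e /= e0 He] : exists2 e : R, 0 < e & forall u, `|s - u| < e -> 0 <= u ->
    forall i : 'I_N, r < enorm (x i + y i u).
  by have /nbhs_ballP[e e0 He] := near_s; exists e => // u su u0; exact: He.
have pow n : 0 < 2 ^+ n :> R by rewrite exprn_gt0.
have [n ne] : exists n, T / 2 ^+ n < e.
  exists (Num.bound (T / e)); rewrite ltr_pdivrMr// mulrC -ltr_pdivrMr//.
  apply: (lt_trans (archi_boundP _)); first by rewrite divr_ge0// ltW.
  by rewrite -natrX ltr_nat ltn_expl.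
pose h := T / 2 ^+ n; have h0 : 0 < h by rewrite divr_gt0.
have hT : (2 ^ n)%:R * h = T by rewrite natrX /h mulrCA divff ?mulr1// gt_eqF.
have /andP[k1 k2] := truncn_itv (divr_ge0 s0 (ltW h0)).
(* The covered grid time [k.+1%:R * h] follows [s] by at most [h]. The index reaches [2 ^ n] only
   for [s = T], which is itself the last grid time. *)
set k := Num.truncn _ in k1 k2.
rewrite ler_pdivlMr// in k1; rewrite ltr_pdivrMr// in k2.
have [kn|kn] := ltnP k (2 ^ n).
  have [i ir] := cov n k kn; rewrite -/h in ir.
  have [iN|Ni] := ltnP i N; last by have := finN i Ni n k.+1 kn; rewrite -/h ltNge ir.
  have ke : `|s - k.+1%:R * h| < e.
    rewrite distrC ger0_norm; last by rewrite subr_ge0 ltW.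
    by apply: le_lt_trans ne; rewrite -/h lerBlDr -natr1 mulrDl mul1r addrC lerD2l.
  by have := He _ ke (mulr_ge0 (ler0n _ _) (ltW h0)) (Ordinal iN); rewrite /= ltNge ir.
have sE : s = T.
  by apply/eqP; rewrite eq_le sT -hT (le_trans _ k1)// ler_pM2r// ler_nat.
have [|i] := cov n (2 ^ n).-1; first by rewrite prednK// expn_gt0.
by rewrite prednK ?expn_gt0// -/h hT -sE leNgt nocov.
Qed.

Context {Omega : Type} (X : nat -> Omega -> V) (xi : nat -> R -> Omega -> V).

(** An infimum strictly above [t] leaves room for some [t + 1 / (m + 1)] below it, so covering holds
    past [t]. The same margin restores the strict inequality when covering is converted back. *)
Lemma lt_T_isol (t r : R) (g : R -> V) w : (t%:E < T_isol X xi r g w)%E ->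
  exists m, forall s, 0 <= s <= t + m.+1%:R^-1 ->
    exists i, enorm (g s - (X i w + xi i s w)) <= r.
Proof.
rewrite /T_isol; set I := ereal_inf _ => tI.
have [m mI] : exists m, ((t + m.+1%:R^-1)%:E < I)%E.
  move: tI; case: I => [v| |]//; last by exists 0%N; rewrite ltry.
  rewrite lte_fin -subr_gt0 => tv; exists (Num.bound (v - t)^-1).
  rewrite lte_fin -ltrBrDl -[ltRHS]invrK ltf_pV2 ?posrE ?invr_gt0//.
  apply: (lt_le_trans (archi_boundP _)); first by rewrite invr_ge0 ltW.
  by rewrite ler_nat.
exists m => s /andP[s0 sm]; apply: contrapT => nocov.
suff : (I <= s%:E)%E by rewrite leNgt (le_lt_trans _ mI)// lee_fin.
apply: ereal_inf_lbound; exists s => //; split => // -[i _ ci].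
by apply: nocov; exists i.
Qed.

Lemma T_isol_ge (T r : R) (g : R -> V) w :
  (forall s, 0 <= s <= T -> exists i, enorm (g s - (X i w + xi i s w)) <= r) ->
  (T%:E <= T_isol X xi r g w)%E.
Proof.
move=> cov; apply: le_ereal_inf_tmp => _ [s [s0 nocov] <-]; rewrite lee_fin leNgt.
apply/negP => sT; apply: nocov.
by have [|i ci] := cov s; [rewrite s0 ltW|exists i].
Qed.

End covering_times.

Lemma prob_measurable (R : realType) disp (Omega : measurableType disp)
    (P : probability Omega R) E : measurable E -> prob P E = P E.
Proof. exact: measurable_mu_extE. Qed.

(** Monotonicity and subadditivity of the outer measure; the events on [T_isol] are not known to be
    measurable, and paths are regular only off a null set. *)
Lemma prob_negligible_le (R : realType) disp (Omega : measurableType disp)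
    (P : probability Omega R) (N E F : set Omega) :
  measurable N -> P N = 0%E -> E `&` ~` N `<=` F -> (prob P E <= prob P F)%E.
Proof.
move=> mN N0 EF.
apply: (@le_trans _ _ (prob P (F `|` N))).
  apply: le_mu_ext => w Ew; have [Nw|nNw] := pselect (N w); first by right.
  by left; apply: EF.
apply: (le_trans (outer_measureU2 _ F N)).
by rewrite [X in (_ + X)%E](_ : _ = 0%E) ?adde0// -N0; exact: measurable_mu_extE.
Qed.

Section isolation.
Context {R : realType} {d : nat} {disp : measure_display} {Omega : measurableType disp}.
Variables (P : probability Omega R) (lambda r : R) (X : nat -> Omega -> 'rV[R]_d).
Variable xi : nat -> R -> Omega -> 'rV[R]_d.
Hypothesis d0 : (0 < d)%N.
Hypothesis lambda0 : (0 < lambda)%R.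
Hypothesis nodes : mobile_nodes P lambda X xi.
Variable t : R.
Hypothesis t0 : 0 <= t.
Local Notation V := 'rV[R]_d.

Let time m := t + m.+1%:R^-1.

Let time_gt m : t < time m.
Proof. by rewrite ltrDl invr_gt0. Qed.

Let time_gt0 m : 0 < time m.
Proof. exact: le_lt_trans (time_gt m). Qed.

Let time_noninc m m' : (m <= m')%N -> time m' <= time m.
Proof. by move=> mm'; rewrite lerD2l lef_pV2 ?posrE// ler_nat. Qed.

Let step m n := time m / 2 ^+ n.

Let step_gt0 m n : 0 < step m n.
Proof. by rewrite divr_gt0// exprn_gt0. Qed.

Let dyadic_covered (g : R -> V) m n : set Omega :=
  covered X xi (step m n) (fun k : 'I_(2 ^ n) => g (k.+1%:R * step m n)) r.

Let dyadic_coveredE g m n w : dyadic_covered g m n w <->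
  forall k, (k < 2 ^ n)%N -> exists i, enorm (g (k.+1%:R * step m n) -
    (X i w + (xi i (k.+1%:R * step m n) w - xi i 0 w))) <= r.
Proof.
split=> cov k; last first.
  by have [i ci] := cov k (ltn_ord k); exists i; rewrite /hit /= walk_steps//.
move=> kn; have [i] := cov (Ordinal kn).
by rewrite /hit /= walk_steps//; exists i.
Qed.

Let measurable_dyadic_covered g m n : measurable (dyadic_covered g m n).
Proof. by apply: (measurable_covered nodes). Qed.

Let covered_at_dyadics g m := \bigcap_n dyadic_covered g m n.

Let measurable_covered_at_dyadics g m : measurable (covered_at_dyadics g m).
Proof. exact: bigcapT_measurable. Qed.

Let dyadic_covered0_nonincreasing m :
  {homo dyadic_covered (fun=> 0) m : n n' / (n <= n')%N >-> (n' <= n)%O}.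
Proof.
apply/nonincreasing_seqP => n; apply/subsetPset => w /dyadic_coveredE cov.
apply/dyadic_coveredE => k kn.
(* Index [k] denotes time [k.+1], which on the finer grid is time [(2 * k).+2]. *)
have [|i ci] := cov (2 * k).+1.
  by rewrite expnS -[(2 * k).+2]addn2 addnC -mulnS leq_mul2l kn orbT.
suff <- : (2 * k).+2%:R * step m n.+1 = k.+1%:R * step m n by exists i.
rewrite -[(2 * k).+2]addn2 addnC -mulnS natrM /step exprS.
have := gt_eqF (exprn_gt0 n (ltr0n R 2)).
by move=> /negbT; move: (2 ^+ n) => p p0; field.
Qed.

(** For [g], covering at all dyadic times is bounded by covering on each single grid, where the
    finite comparison applies; the limit in [n] is taken for the zero path only. *)
Let prob_covered_at_dyadics_le g m :
  (P (covered_at_dyadics g m) <= P (covered_at_dyadics (fun=> 0%R) m))%E.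
Proof.
have cvg0 : P (dyadic_covered (fun=> 0) m n) @[n --> \oo] -->
    P (covered_at_dyadics (fun=> 0) m).
  apply: nonincreasing_cvg_mu => //; last exact: measurable_covered_at_dyadics.
  by apply: (le_lt_trans (probability_le1 _ (measurable_dyadic_covered _ _ _))); rewrite ltry.
rewrite -(cvg_lim _ cvg0)//; apply: lime_ge; first by apply: cvgP; exact: cvg0.
apply: nearW => n.
apply: le_trans (covered_prob_le d0 lambda0 nodes (step_gt0 m n) _ r).
by apply: le_measure; [rewrite inE; exact: measurable_covered_at_dyadics|
  rewrite inE; exact: measurable_dyadic_covered|by move=> w cw; exact: (cw n Logic.I)].
Qed.

Let regular_paths : {ae P, forall w, [/\ forall i, xi i 0 w = 0,
  forall i, {within [set s | 0 <= s], continuous (xi i ^~ w)} &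
  forall m, exists N, forall i, (N <= i)%N -> forall n k, (k <= 2 ^ n)%N ->
    r < enorm (X i w + (xi i (k%:R * step m n) w - xi i 0 w))]}.
Proof.
have start : {ae P, forall w, forall i, xi i 0 w = 0}.
  by apply: ae_foralln => i; exact: (brownian_start (nodes_brownian nodes i)).
have cont : {ae P, forall w, forall i, {within [set s | 0 <= s], continuous (xi i ^~ w)}}.
  by apply: ae_foralln => i; exact: (brownian_continuous (nodes_brownian nodes i)).
have fin := ae_foralln (fun m => finitely_many_visitors d0 lambda0 nodes (time_gt0 m) r).
near=> w; split; by near: w.
Unshelve. all: by end_near. Qed.

(** Off a null set, [t < T_isol] for [g] implies membership in some [D m], while covering for the
    zero path up to [time m > t] implies [t < T_isol]. The comparison is made at each [m], and the
    limit in [m] is taken on the side of [g]. *)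
Lemma prob_T_isol_le (g : R -> V) :
  (prob P [set w | t%:E < T_isol X xi r g w] <=
   prob P [set w | t%:E < T_isol X xi r (fun=> 0%R) w])%E.
Proof.
have [N [mN N0 regN]] := regular_paths.
have {}regN w : ~ N w -> _ := fun nN => contrapT (fun h => nN (regN w h)).
(* Dyadic grids for different horizons are not nested; intersecting over all [m' >= m] produces an
   increasing sequence. *)
pose D m := \bigcap_(m' in [set m' | (m <= m')%N]) covered_at_dyadics g m'.
have mD m : measurable (D m).
  by apply: bigcap_measurableType => m' _; exact: measurable_covered_at_dyadics.
have mUD : measurable (\bigcup_m D m) by exact: bigcupT_measurable.
have ndD : {homo D : m m' / (m <= m')%N >-> (m <= m')%O}.
  move=> m m' mm'; apply/subsetPset => w Dw m'' m'm''.
  by apply: Dw; exact: leq_trans mm' m'm''.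
have cvgD : P (D m) @[m --> \oo] --> P (\bigcup_m D m) by exact: nondecreasing_cvg_mu.
apply: (@le_trans _ _ (P (\bigcup_m D m))).
  rewrite -(prob_measurable P mUD).
  apply: (prob_negligible_le mN N0) => w [/= tw nN].
  have [m cov] := lt_T_isol tw.
  have [start _ _] := regN w nN.
  exists m => // m' /time_noninc mm' n _; apply/dyadic_coveredE => k kn.
  have [|i ci] := cov (k.+1%:R * step m' n).
    rewrite mulr_ge0 ?(ltW (step_gt0 _ _))//=; apply: le_trans mm'.
    rewrite /step mulrCA ler_piMr ?(ltW (time_gt0 m'))//.
    by rewrite ler_pdivrMr ?exprn_gt0// mul1r -natrX ler_nat.
  by exists i; rewrite start subr0.
rewrite -(cvg_lim _ cvgD)//; apply: lime_le; first by apply: cvgP; exact: cvgD.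
apply: nearW => m; apply: (@le_trans _ _ (P (covered_at_dyadics g m))).
  by apply: le_measure; [rewrite inE; exact: mD|
    rewrite inE; exact: measurable_covered_at_dyadics|by move=> w Dw; exact: (Dw m (leqnn m))].
apply: (le_trans (prob_covered_at_dyadics_le g m)).
have mC := measurable_covered_at_dyadics (fun=> 0) m.
rewrite -(prob_measurable P mC).
apply: (prob_negligible_le mN N0) => w [cov nN].
have [start cont fin] := regN w nN.
apply: (@lt_le_trans _ _ (time m)%:E); first by rewrite lte_fin.
apply: T_isol_ge => s s0m.
have enorm0 (x : V) : enorm (0 - x) = enorm x by rewrite sub0r enormN.
have [||i ci] := @dyadic_covering _ _ (X ^~ w) (fun i u => xi i u w) (time m) r
  (time_gt0 m) cont _ _ s s0m; last by exists i; rewrite enorm0.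
- have [M HM] := fin m; exists M => i Mi n k kn.
  by have := HM i Mi n k kn; rewrite start subr0.
- move=> n k kn; have /dyadic_coveredE/(_ k kn)[i] := cov n Logic.I.
  by rewrite start subr0 enorm0; exists i.
Qed.

End isolation.

Theorem corollary1p4 (R : realType) (d : nat) (d_ge1 : (1 <= d)%N)
    (disp : measure_display) (Omega : measurableType disp)
    (P : probability Omega R)
    (lambda r : R) (lambda_gt0 : 0 < lambda) (r_gt0 : 0 < r)
    (X : nat -> Omega -> 'rV[R]_d) (xi : nat -> R -> Omega -> 'rV[R]_d)
    (nodes : mobile_nodes P lambda X xi)
    (t : R) (t_ge0 : 0 <= t)
    (g : R -> 'rV[R]_d) (g_bounded : bounded_on_compacts g) :
  (prob P [set w | t%:E < T_isol X xi r g w] <=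
   prob P [set w | t%:E < T_isol X xi r (fun=> 0%R) w])%E.
Proof. exact: (@prob_T_isol_le _ _ _ _ P lambda r X xi d_ge1 lambda_gt0 nodes t t_ge0 g). Qed.
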